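(* Let $\alpha$ be a quadratic irrational real algebraic number. There are constants $K, C > 0$ depending only on $\alpha$ such that for every $r \ge 1$, every $\alpha$-PA sentence $S$ with $r$ alternating quantifier blocks can be decided in time at most $$K \cdot 2^{2^{\cdot^{\cdot^{\cdot^{2^{C\,\ell(S)}}}}}} \quad (\text{tower of height } r).$$
   Context: For a real number $\alpha$, an $\alpha$-PA sentence ($\alpha$-Presburger sentence) is a statement $Q_1 \mathbf{x}_1 \in \mathbb{Z}^{n_1} \dots Q_r \mathbf{x}_r \in \mathbb{Z}^{n_r}\ \Phi(\mathbf{x}_1,\dots,\mathbf{x}_r)$, where $Q_1,\dots,Q_r \in \{\forall,\exists\}$ are $r$ alternating quantifiers, $\mathbf{x}_1,\dots,\mathbf{x}_r$ are blocks of integer variables, and $\Phi$ is a Boolean combination of linear inequalities in $\mathbf{x}_1,\dots,\mathbf{x}_r$ with coefficients and constant terms in $\mathbb{Z}[\alpha]$. Deciding a sentence means determining whether it is true. A real algebraic number $\alpha$ of degree $d$ is given by its defining $\mathbb{Z}[x]$-polynomial of degree $d$ together with a rational interval singling out a unique root; it is called quadratic if $d=2$. Elements of $\mathbb{Z}[\alpha]$ are represented as $c_0 + c_1\alpha + \dots + c_{d-1}\alpha^{d-1}$ with $c_i \in \mathbb{Z}$. The encoding length $\ell(S)$ of an $\alpha$-PA sentence $S$ is the total bit length of all symbols in $S$, with integer coefficients and constants written in binary. Tower of height $r$: with $T_1(x) = 2^x$ and $T_{j+1}(x) = 2^{T_j(x)}$, the displayed bound is $K \cdot T_r(C\,\ell(S))$.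 *)

(* Defs.v *)
From mathcomp Require Import all_boot all_order all_algebra.
From mathcomp Require Import classical_sets reals exp.

Set Implicit Arguments.
Unset Strict Implicit.
Unset Printing Implicit Defensive.

Import Order.TTheory GRing.Theory Num.Theory.
Local Open Scope ring_scope.

Definition quadratic_irrational (R : realType) (alpha : R) : Prop :=
  irrational alpha /\
  exists p : {poly int}, size p = 3%N /\ root (map_poly intr p) alpha.

Definition tower (R : realType) (r : nat) (x : R) : R :=
  iter r (fun y => 2 `^ y) x.

(* The pair (c0, c1) represents c0 + c1 alpha. *)
Definition coef := (int * int)%type.

(* (i, j) is the j-th variable of the i-th block, both counted from 0. *)
Definition var := (nat * nat)%type.

(* [Ineq false [:: (c_1, v_1); ...; (c_k, v_k)] d] is the inequality
   c_1 v_1 + ... + c_k v_k <= d, and [Ineq true] is its strict version. *)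
Inductive formula : Type :=
| Ineq of bool & seq (coef * var) & coef
| Not of formula
| And of formula & formula
| Or of formula & formula.

Inductive quantifier : Type := Forall | Exists.

Definition dual (q : quantifier) : quantifier :=
  if q is Forall then Exists else Forall.

Fixpoint vars_in (dims : seq nat) (phi : formula) : bool :=
  match phi with
  | Ineq _ s _ =>
      all (fun cv => (cv.2.1 < size dims)%N && (cv.2.2 < nth 0%N dims cv.2.1)%N)
        s
  | Not f => vars_in dims f
  | And f g | Or f g => vars_in dims f && vars_in dims g
  end.

(* Since the quantifiers alternate, the first one determines all of them. *)
Record sentence (r : nat) : Type := Sentence {
  first_quantifier : quantifier;
  dims : r.-tuple nat;
  body : formula;
  body_closed : vars_in dims body
}.

Definition coef_val (R : realType) (alpha : R) (c : coef) : R :=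
  c.1%:~R + c.2%:~R * alpha.

(* [nth [::] env i] lists the values of the variables of block i. *)
Definition var_val (env : seq (seq int)) (v : var) : int :=
  nth 0 (nth [::] env v.1) v.2.

Fixpoint formula_true (R : realType) (alpha : R) (env : seq (seq int))
    (phi : formula) : bool :=
  match phi with
  | Ineq strict s d =>
      let lhs := \sum_(cv <- s) coef_val alpha cv.1 * (var_val env cv.2)%:~R in
      if strict then lhs < coef_val alpha d else lhs <= coef_val alpha d
  | Not f => ~~ formula_true alpha env f
  | And f g => formula_true alpha env f && formula_true alpha env g
  | Or f g => formula_true alpha env f || formula_true alpha env g
  end.

Fixpoint quantified_true (R : realType) (alpha : R) (q : quantifier)
    (ns : seq nat) (env : seq (seq int)) (phi : formula) : Prop :=
  match ns with
  | [::] => formula_true alpha env phi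
  | n :: ns' =>
      match q with
      | Forall => forall x : n.-tuple int,
          quantified_true alpha (dual q) ns' (rcons env x) phi
      | Exists => exists x : n.-tuple int,
          quantified_true alpha (dual q) ns' (rcons env x) phi
      end
  end.

Definition sentence_true (R : realType) (alpha : R) (r : nat)
    (S : sentence r) : Prop :=
  quantified_true alpha (first_quantifier S) (dims S) [::] (body S).

Inductive symbol : Type :=
| SForall | SExists | SVar | SComma | SZero | SOne | SMinus | SAlpha
| SPlus | SLe | SLt | SNot | SAnd | SOr | SOpen | SClose.

Definition symbol_bits (s : symbol) : seq bool :=
  match s with
  | SForall => [:: false; false; false; false]
  | SExists => [:: false; false; false; true]
  | SVar    => [:: false; false; true;  false]
  | SComma  => [:: false; false; true;  true]
  | SZero   => [:: false; true;  false; false]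
  | SOne    => [:: false; true;  false; true]
  | SMinus  => [:: false; true;  true;  false]
  | SAlpha  => [:: false; true;  true;  true]
  | SPlus   => [:: true;  false; false; false]
  | SLe     => [:: true;  false; false; true]
  | SLt     => [:: true;  false; true;  false]
  | SNot    => [:: true;  false; true;  true]
  | SAnd    => [:: true;  true;  false; false]
  | SOr     => [:: true;  true;  false; true]
  | SOpen   => [:: true;  true;  true;  false]
  | SClose  => [:: true;  true;  true;  true]
  end.

(* Most significant digit first. *)
Fixpoint write_pos (p : BinNums.positive) : seq symbol :=
  match p with
  | BinNums.xH => [:: SOne]
  | BinNums.xO p' => rcons (write_pos p') SZero
  | BinNums.xI p' => rcons (write_pos p') SOne
  end.

Definition write_nat (n : nat) : seq symbol :=
  if bin_of_nat n is BinNums.Npos p then write_pos p else [:: SZero].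

Definition write_int (z : int) : seq symbol :=
  match z with
  | Posz n => write_nat n
  | Negz n => SMinus :: write_nat n.+1
  end.

Definition write_coef (c : coef) : seq symbol :=
  SOpen :: write_int c.1 ++ SPlus :: write_int c.2 ++ [:: SAlpha; SClose].

Definition write_var (v : var) : seq symbol :=
  SVar :: write_nat v.1 ++ SComma :: write_nat v.2.

Fixpoint write_formula (phi : formula) : seq symbol :=
  match phi with
  | Ineq strict s d =>
      flatten [seq SPlus :: write_coef cv.1 ++ write_var cv.2 | cv <- s]
        ++ (if strict then SLt else SLe) :: write_coef d
  | Not f => SNot :: write_formula f
  | And f g =>
      SOpen :: write_formula f ++ SAnd :: write_formula g ++ [:: SClose]
  | Or f g =>
      SOpen :: write_formula f ++ SOr :: write_formula g ++ [:: SClose]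
  end.

(* Each quantifier is followed by the list of the variables of its block;
   [i] is the index of the first block of [ns]. *)
Fixpoint write_prefix (q : quantifier) (i : nat) (ns : seq nat) : seq symbol :=
  if ns is n :: ns' then
    (if q is Forall then SForall else SExists)
      :: flatten [seq write_var (i, j) | j <- iota 0 n]
        ++ write_prefix (dual q) i.+1 ns'
  else [::].

Definition encode (r : nat) (S : sentence r) : seq bool :=
  flatten [seq symbol_bits s |
    s <- write_prefix (first_quantifier S) 0 (dims S)
           ++ write_formula (body S)].

Definition encoding_length (r : nat) (S : sentence r) : nat :=
  size (encode S).

(* Tape letters over a finite work alphabet W: [None] is the blank and
   [Some (inl b)] is the input bit b. *)
Definition letter (W : finType) : Type := option (bool + W).

Inductive direction : Type := ToLeft | Stay | ToRight.

(* A machine has ntapes.+1 tapes, the first of which holds the input.  A state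
   whose verdict is [Some b] is halting, with answer b. *)
Record machine : Type := Machine {
  ntapes : nat;
  state : finType;
  work : finType;
  start : state;
  verdict : state -> option bool;
  transition : state -> {ffun 'I_ntapes.+1 -> letter work} ->
    state * {ffun 'I_ntapes.+1 -> letter work * direction}
}.

(* A two-way infinite tape, blank outside the finite part recorded here;
   [before] lists the cells left of the head from right to left. *)
Record tape (W : finType) : Type := Tape {
  before : seq (letter W);
  scanned : letter W;
  after : seq (letter W)
}.

Definition move (W : finType) (d : direction) (t : tape W) : tape W :=
  let: Tape l x r := t in
  match d with
  | ToLeft => Tape (behead l) (head None l) (x :: r)
  | Stay => t
  | ToRight => Tape (x :: l) (head None r) (behead r)
  end.

Definition write (W : finType) (x : letter W) (t : tape W) : tape W :=
  Tape (before t) x (after t).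

Record config (M : machine) : Type := Config {
  current : state M;
  tapes : {ffun 'I_(ntapes M).+1 -> tape (work M)}
}.

Definition input_tape (W : finType) (w : seq bool) : tape W :=
  let s : seq (letter W) := [seq Some (inl b) | b <- w] in
  Tape [::] (head None s) (behead s).

Definition init (M : machine) (w : seq bool) : config M :=
  Config (start M)
    [ffun i => if i == ord0 then input_tape (work M) w else input_tape _ [::]].

Definition step (M : machine) (c : config M) : config M :=
  if verdict (current c) is Some _ then c
  else
    let: (q, a) := transition (current c) [ffun i => scanned (tapes c i)] in
    Config q [ffun i => move (a i).2 (write (a i).1 (tapes c i))].

Definition decides_in (M : machine) (w : seq bool) (P : Prop) (t : nat) : Prop :=
  exists b : bool,
    verdict (current (iter t (@step M) (init M w))) = Some b /\ (b <-> P).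

(* Main.v *)
(* The field Q(alpha) contains a unit b > 1 such that t = b + 1/b is an integer, so
   after scaling all coefficients lie in Z + Z b.  Let F_0 = 0, F_1 = 1 and
   F_(k+1) = t F_k - F_(k-1), so that (b - 1/b) F_k = b^k - b^-k.  If every variable
   is written as a sum of d_k F_k with digits |d_k| <= t, then b - 1/b times a linear
   form with coefficients in Z + Z b is a Laurent polynomial in b whose coefficients
   are bounded, of the form e_n b^n + .. + e_1 b - e_1 b^-1 - .. - e_n b^-n.  Evaluate
   it by Horner's scheme on elements u + v b: the conjugate u + v/b stays bounded
   because 1/b < 1, so that as soon as |v| is large the sign of the final value is
   the sign of v, and until then (u, v) lies in a finite box.  Since the digits occur
   a second time in reverse order, an automaton reading them once runs the first half
   of the scheme forwards and guesses the second half backwards.  A Boolean combination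
   of inequalities is thus recognised by a nondeterministic automaton whose number of
   states is simply exponential in its length.  The innermost block of variables is
   eliminated by projecting it away, and each of the r - 1 alternations by one subset
   construction followed by complementation; the last projection only requires a search
   for an accepting run.  This leads to a tower of height r. *)

From HB Require Import structures.
Require Import Defs.
From mathcomp Require Import all_boot all_order all_algebra.
From mathcomp Require Import boolp classical_sets reals exp.
From mathcomp Require Import zify ring lra.

Set Implicit Arguments.
Unset Strict Implicit.
Unset Printing Implicit Defensive.

Import Order.TTheory GRing.Theory Num.Theory.

(** * Stack programs and their compilation to machines *)

(** The height [r] leaves no exponential to waste. For a sentence of length l the first automaton
    has already 2^(c l) states, so everything before it, even unary arithmetic, may cost any
    polynomial in 2^l, and each of the r - 1 subset constructions must exponentiate only once.
    Polynomial overhead is harmless because a tower absorbs powers into its argument ([height_exp]);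
    running times are therefore tracked only up to polynomials in a budget, by [Eff]. A second
    obstacle is that integers have no fixed number of digits, so sets are recognised only up to
    leading zero letters: the value of an inequality may not have settled on a short word, and a
    projected variable may need more digits than the others. This is why the initial state of each
    subset construction is closed under letters that vanish outside the projected block. Universal
    quantifiers need no construction of their own: as quantifiers alternate, each inner elimination
    is a negated existential, and only the innermost condition and the final answer are compared
    with a sign. *)

Inductive reg : Type := Inp | Main | Aux | Tmp | Cnt.

Definition idx (r : reg) : 'I_5 :=
  match r with
  | Inp => @Ordinal 5 0 isT
  | Main => @Ordinal 5 1 isT
  | Aux => @Ordinal 5 2 isT
  | Tmp => @Ordinal 5 3 isT
  | Cnt => @Ordinal 5 4 isT
  end.

(** [Main] carries the data, [Aux] and [Tmp] serve to move codes around, and [Cnt] is a unary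
    counter of subtrees that remain to be scanned. *)
Record store : Type :=
  Store { inp : seq bool; main : seq bool; aux : seq bool; tmp : seq bool; cnt : seq bool }.

Definition get (r : reg) (s : store) : seq bool :=
  match r with Inp => inp s | Main => main s | Aux => aux s | Tmp => tmp s | Cnt => cnt s end.

Definition put (r : reg) (w : seq bool) (s : store) : store :=
  let: Store i m a t c := s in
  match r with
  | Inp => Store w m a t c
  | Main => Store i w a t c
  | Aux => Store i m w t c
  | Tmp => Store i m a w c
  | Cnt => Store i m a t w
  end.

Inductive cmd : Type :=
| Push of reg & bool
| Pop of reg
| Seq of cmd & cmd
| Case of reg & cmd & cmd & cmd
| Loop of reg & (option bool -> bool) & cmd.

Definition branch (o : option bool) (c0 c1 c2 : cmd) : cmd :=
  match o with None => c0 | Some false => c1 | Some true => c2 end.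

(** The costs are exact numbers of machine steps. A push takes two, because the head first moves to
    a fresh cell and then writes; a test takes one. *)
Inductive exec : cmd -> store -> store -> nat -> Prop :=
| ExPush r b s : exec (Push r b) s (put r (b :: get r s) s) 2
| ExPop r s : exec (Pop r) s (put r (behead (get r s)) s) 1
| ExSeq c d s1 s2 s3 m n :
    exec c s1 s2 m -> exec d s2 s3 n -> exec (Seq c d) s1 s3 (m + n)
| ExCase r c0 c1 c2 s s' n :
    exec (branch (ohead (get r s)) c0 c1 c2) s s' n ->
    exec (Case r c0 c1 c2) s s' n.+1
| ExStop r (P : option bool -> bool) c s : ~~ P (ohead (get r s)) -> exec (Loop r P c) s s 1
| ExGo r (P : option bool -> bool) c s1 s2 s3 m n :
    P (ohead (get r s1)) -> exec c s1 s2 m -> exec (Loop r P c) s2 s3 n ->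
    exec (Loop r P c) s1 s3 (m + n).+1.

(** The positions inside a program. In [Case] and [Loop] the value [None] is the moment of the
    test. *)
Fixpoint control (c : cmd) : finType :=
  match c with
  | Push _ _ => bool
  | Pop _ => unit
  | Seq c d => (control c + control d)%type
  | Case _ c0 c1 c2 => option (control c0 + (control c1 + control c2))%type
  | Loop _ _ c => option (control c)
  end.

Fixpoint entry (c : cmd) : control c :=
  match c return control c with
  | Push _ _ => false
  | Pop _ => tt
  | Seq c d => inl (entry c)
  | Case _ _ _ _ => None
  | Loop _ _ _ => None
  end.

Definition cell : Type := letter void.
Definition tops : Type := {ffun 'I_5 -> cell}.
Definition action : Type := option (reg * (cell * direction)).

Definition bit_of (x : cell) : option bool := if x is Some (inl b) then Some b else None.

Fixpoint advance (c : cmd) : control c -> tops -> option (control c) * action :=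
  match c return control c -> tops -> option (control c) * action with
  | Push r b => fun q v =>
      if q then (None, Some (r, (Some (inl b), Stay)))
      else (Some true, Some (r, (v (idx r), ToLeft)))
  | Pop r => fun _ _ => (None, Some (r, (None, ToRight)))
  | Seq c d => fun q v =>
      match q with
      | inl q =>
          let: (o, a) := advance q v in
          (Some (if o is Some q' then inl q' else inr (entry d)), a)
      | inr q => let: (o, a) := advance q v in (omap inr o, a)
      end
  | Case r c0 c1 c2 => fun q v =>
      match q with
      | None =>
          (Some (Some (match bit_of (v (idx r)) with
             | None => inl (entry c0)
             | Some false => inr (inl (entry c1))
             | Some true => inr (inr (entry c2)) end)), None)
      | Some (inl q) => let: (o, a) := advance q v in (omap (fun q => Some (inl q)) o, a)
      | Some (inr (inl q)) =>
          let: (o, a) := advance q v in (omap (fun q => Some (inr (inl q))) o, a)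
      | Some (inr (inr q)) =>
          let: (o, a) := advance q v in (omap (fun q => Some (inr (inr q))) o, a)
      end
  | Loop r P c => fun q v =>
      match q with
      | None => (if P (bit_of (v (idx r))) then Some (Some (entry c)) else None, None)
      | Some q => let: (o, a) := advance q v in (Some o, a)
      end
  end.

Definition perform (v : tops) (a : action) : {ffun 'I_5 -> cell * direction} :=
  [ffun i => if a is Some (r, x) then if i == idx r then x else (v i, Stay) else (v i, Stay)].

Definition stack_machine (Q : finType) (q0 : Q) (ver : Q -> option bool)
    (tr : Q -> tops -> Q * action) : machine :=
  @Machine 4 Q void q0 ver (fun q v => let: (q', a) := tr q v in (q', perform v a)).

(** The top of the stack is under the head and the rest to its right. Cells to the left may hold
    anything, since a push overwrites them; [k] allows for blanks recorded at the far end. *)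
Definition is_stack (t : tape void) (s : seq bool) : Prop :=
  exists k, scanned t :: after t = [seq Some (inl b) | b <- s] ++ nseq k (None : cell).

Definition represents (t : {ffun 'I_5 -> tape void}) (s : store) : Prop :=
  forall r, is_stack (t (idx r)) (get r s).

Lemma is_stack_scanned t s : is_stack t s -> bit_of (scanned t) = ohead s.
Proof. by case=> k; case: s => [|b s]; case: k => [|k] //= [-> _]. Qed.

Lemma is_stack_pop t s : is_stack t s -> is_stack (move ToRight (write (None : cell) t)) (behead s).
Proof.
case: t => l x r [k]; rewrite /is_stack /=.
case: s => [|b s] /=.
  case: k => //= k [_ ->]; exists k.-1.+1.
  by case: k.
case=> _ ->; case: s => [|b' s] /=; last by exists k.
by exists k.-1.+1; case: k.
Qed.

Lemma is_stack_push t s b (x : cell) : is_stack t s ->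
  is_stack (move Stay (write (Some (inl b) : cell) (move ToLeft (write (scanned t) t)))) (b :: s).
Proof. by case: t => l y r [k] /= h; exists k; rewrite /= h. Qed.

Lemma idx_inj : injective idx.
Proof. by case; case. Qed.

Lemma get_put r r' w s : get r' (put r w s) = if idx r' == idx r then w else get r' s.
Proof. by case: s; case: r; case: r'. Qed.

Lemma is_stack_stay (t : tape void) (s : seq bool) : is_stack t s ->
  is_stack (move Stay (write (scanned t) t)) s.
Proof. by case: t. Qed.

Section Simulation.
Variables (Q : finType) (q0 : Q) (ver : Q -> option bool) (tr : Q -> tops -> Q * action).
Let M := stack_machine q0 ver tr.

(** A machine contains the program [c] through the embedding [f] and goes on in [e] when [c] ends.
    Leaving [e] free makes the simulation compositional: it may be the entry of the next command or
    the test of an enclosing loop. *)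
Definition hosts (c : cmd) (f : control c -> Q) (e : Q) : Prop :=
  forall q, ver (f q) = None /\
    forall v, tr (f q) v = let: (o, a) := advance q v in (if o is Some q' then f q' else e, a).

Definition reaches (n : nat) (q : Q) (s : store) (q' : Q) (s' : store) : Prop :=
  forall t : {ffun 'I_5 -> tape void}, represents t s ->
    exists2 t' : {ffun 'I_5 -> tape void}, represents t' s' &
      iter n (@step M) (Config (M := M) q t) = Config (M := M) q' t'.

Lemma reaches_trans m n q1 s1 q2 s2 q3 s3 :
  reaches m q1 s1 q2 s2 -> reaches n q2 s2 q3 s3 -> reaches (m + n) q1 s1 q3 s3.
Proof.
move=> h1 h2 t /h1 [t2 /h2 [t3 r3 e3] e2]; exists t3 => //.
by rewrite addnC iterD e2 e3.
Qed.

Definition update (t : {ffun 'I_5 -> tape void}) (a : action) : {ffun 'I_5 -> tape void} :=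
  let x := perform [ffun i => scanned (t i)] a in
  [ffun i => move (x i).2 (write (x i).1 (t i))].

Lemma step_host c (f : control c -> Q) e q t : hosts f e ->
  @step M (Config (M := M) (f q) t) =
  let: (o, a) := advance q [ffun i => scanned (t i)] in
  Config (M := M) (if o is Some q' then f q' else e) (update t a).
Proof.
move=> hf; have [hv ht] := hf q; rewrite /step /= hv /= ht.
by case: (advance _ _) => o a.
Qed.

Lemma represents_idle t s : represents t s -> represents (update t None) s.
Proof. by move=> h r; rewrite !ffunE /=; apply: is_stack_stay. Qed.

Lemma scanned_top t s r : represents t s ->
  bit_of ([ffun i => scanned (t i)] (idx r) : cell) = ohead (get r s).
Proof. by move=> h; rewrite ffunE (is_stack_scanned (h r)). Qed.

(** The embedding is quantified after the execution, so that in the induction every subprogram is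
    hosted by the same machine through a composed embedding. *)
Lemma simulation c s s' n : exec c s s' n ->
  forall (f : control c -> Q) e, hosts f e -> reaches n (f (entry c)) s e s'.
Proof.
elim=> {c s s' n}.
- move=> r b s f e hf t ht; rewrite /= (step_host _ _ hf) /= (step_host _ _ hf) /=.
  eexists; last reflexivity.
  move=> r'; rewrite !ffunE get_put; case: eqP => [/idx_inj ->|ne] /=.
    exact: (is_stack_push b None (ht r)).
  by do 2! apply: is_stack_stay.
- move=> r s f e hf t ht; rewrite /= (step_host _ _ hf) /=.
  eexists; last reflexivity.
  move=> r'; rewrite !ffunE get_put; case: eqP => [/idx_inj ->|ne] /=.
    exact: is_stack_pop.
  exact: is_stack_stay.
- move=> c d s1 s2 s3 m n _ IH1 _ IH2 f e hf /=.
  apply: reaches_trans (_ : reaches _ _ _ (f (inr (entry d))) _) _.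
    apply: (IH1 (fun q => f (inl q))) => q; have [hv ht] := hf (inl q); split=> // v.
    by rewrite ht /=; case: (advance q v) => [[q'|] a].
  apply: (IH2 (fun q => f (inr q))) => q; have [hv ht] := hf (inr q); split=> // v.
  by rewrite ht /=; case: (advance q v) => [[q'|] a].
- move=> r c0 c1 c2 s s' n _ IH f e hf; rewrite -add1n.
  have [q [g [hg hq]]] : exists q, exists g, 
     hosts (c := branch (ohead (get r s)) c0 c1 c2) g e /\
     g (entry _) = f (Some q) /\ q = match ohead (get r s) with
             | None => inl (entry c0)
             | Some false => inr (inl (entry c1))
             | Some true => inr (inr (entry c2)) end.
    case: (ohead _) => [[]|] /=;
      [ exists (inr (inr (entry c2))), (fun q => f (Some (inr (inr q))))
      | exists (inr (inl (entry c1))), (fun q => f (Some (inr (inl q))))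
      | exists (inl (entry c0)), (fun q => f (Some (inl q))) ];
      split=> // q; (split=> [|v]; [exact: (proj1 (hf _)) | rewrite (proj2 (hf _)) /=]);
      by case: (advance q v) => [[q'|] a].
  case: hq => hq eq; refine (reaches_trans (m := 1) _ (IH _ _ hg)) => t ht.
  rewrite /= (step_host _ _ hf) /= (scanned_top _ ht) -eq hq.
  by eexists; last reflexivity; exact: represents_idle.
- move=> r P c s hP f e hf t ht.
  rewrite /= (step_host _ _ hf) /= (scanned_top _ ht) (negbTE hP).
  by eexists; last reflexivity; exact: represents_idle.
- move=> r P c s1 s2 s3 m n hP _ IH1 _ IH2 f e hf; rewrite -add1n.
  apply: (@reaches_trans 1 _ _ s1 (f (Some (entry c))) s1) => [t ht|].
    rewrite /= (step_host _ _ hf) /= (scanned_top _ ht) hP.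
    by eexists; last reflexivity; exact: represents_idle.
  refine (reaches_trans _ (IH2 _ _ hf)).
  apply: (IH1 (fun q => f (Some q))) => q; have [hv ht] := hf (Some q); split=> // v.
  by rewrite ht /=; case: (advance q v) => [[q'|] a].
Qed.

End Simulation.

(** The state [inr None] has no verdict: it reads the top of [Main] and spends one more step to
    enter a halting state. *)
Definition decider (c : cmd) : machine :=
  @stack_machine (control c + option bool)%type (inl (entry c))
    (fun q => if q is inr o then o else None)
    (fun q v => match q with
       | inl q => let: (o, a) := advance q v in
                  (if o is Some q' then inl q' else inr None, a)
       | inr _ => (inr (bit_of (v (idx Main))), None)
       end).

Lemma decider_correct c w s n b (P : Prop) :
  exec c (Store w [::] [::] [::] [::]) s n -> ohead (main s) = Some b -> (b <-> P) ->
  decides_in (decider c) w P n.+1.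
Proof.
move=> hc hb hP.
have h0 : represents (tapes (init (decider c) w)) (Store w [::] [::] [::] [::]).
  case; rewrite !ffunE /=; try by exists 1.
  by rewrite /is_stack /=; case: w {hc} => [|x w]; [exists 1 | exists 0; rewrite cats0].
have hh : @hosts _ (fun q => if q is inr o then o else None)
    (fun q v => match q with
       | inl q => let: (o, a) := advance q v in
                  (if o is Some q' then inl q' else inr None, a)
       | inr _ => (inr (bit_of (v (idx Main))), None)
       end) c inl (inr None).
  by move=> q; split=> // v.
have [t' ht' e] := simulation (inl (entry c)) hc hh h0.
exists b; split=> //.
rewrite /= -[init _ _]/(Config (M := decider c) (inl (entry c)) _) e /step /=.
by rewrite ffunE (is_stack_scanned (ht' Main)) hb.
Qed.

(** * Programs on binary trees *)

Inductive tree : Type := Leaf | Node of tree & tree.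

(* Prefix notation: a stack whose top part is the code of [b] below the code of
   [a] becomes the code of [Node a b] by one push. *)
Fixpoint code (t : tree) : seq bool :=
  if t is Node a b then true :: code a ++ code b else [:: false].

Fixpoint weight (t : tree) : nat :=
  if t is Node a b then (weight a + weight b).+1 else 1.

Lemma size_code t : size (code t) = weight t.
Proof. by elim: t => //= a <- b <-; rewrite size_cat. Qed.

Lemma weight_gt0 t : 0 < weight t.
Proof. by case: t. Qed.

Definition execs (c : cmd) (s s' : store) (N : nat) : Prop :=
  exists2 n, exec c s s' n & n <= N.

Lemma execs_le c s s' M N : M <= N -> execs c s s' M -> execs c s s' N.
Proof. by move=> le [n h hn]; exists n => //; apply: leq_trans le. Qed.

Lemma execs_seq c d s1 s2 s3 M N :
  execs c s1 s2 M -> execs d s2 s3 N -> execs (Seq c d) s1 s3 (M + N).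
Proof.
by move=> [m h1 h2] [n h3 h4]; exists (m + n); [exact: ExSeq h1 h3 | exact: leq_add].
Qed.

Lemma execs_push r b s : execs (Push r b) s (put r (b :: get r s) s) 2.
Proof. by exists 2 => //; constructor. Qed.

Lemma execs_pop r s : execs (Pop r) s (put r (behead (get r s)) s) 1.
Proof. by exists 1 => //; constructor. Qed.

Lemma execs_case r c0 c1 c2 s s' N :
  execs (branch (ohead (get r s)) c0 c1 c2) s s' N -> execs (Case r c0 c1 c2) s s' N.+1.
Proof. by case=> n h le; exists n.+1 => //; constructor. Qed.

Lemma execs_stop r (P : option bool -> bool) c s : ~~ P (ohead (get r s)) -> execs (Loop r P c) s s 1.
Proof. by move=> h; exists 1 => //; constructor. Qed.

Lemma execs_go r (P : option bool -> bool) c s1 s2 s3 M N : P (ohead (get r s1)) ->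
  execs c s1 s2 M -> execs (Loop r P c) s2 s3 N -> execs (Loop r P c) s1 s3 (M + N).+1.
Proof.
move=> h [m h1 h2] [n h3 h4]; exists (m + n).+1; last by rewrite ltnS leq_add.
exact: ExGo h1 h3.
Qed.

Definition noop : cmd := Seq (Push Main true) (Pop Main).

Definition pour (x y : reg) : cmd :=
  Loop x isSome (Case x noop
    (Seq (Pop x) (Push y false)) (Seq (Pop x) (Push y true))).

Definition pour2 : cmd :=
  Loop Aux isSome (Case Aux noop
    (Seq (Pop Aux) (Seq (Push Main false) (Push Tmp false)))
    (Seq (Pop Aux) (Seq (Push Main true) (Push Tmp true)))).

(** Moves exactly one tree code. [Cnt] has one bit for each subtree still expected: a leaf settles
    one, and a node replaces one by two. *)
Definition carry : cmd :=
  Seq (Push Cnt true) (Loop Cnt isSome (Case Main noop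
    (Seq (Pop Main) (Seq (Push Aux false) (Pop Cnt)))
    (Seq (Pop Main) (Seq (Push Aux true) (Push Cnt true))))).

Definition erase : cmd := Loop Aux isSome (Pop Aux).
Definition drop_top : cmd := Seq carry erase.
Definition swap : cmd :=
  Seq carry (Seq (pour Aux Tmp) (Seq carry (Seq (pour Tmp Aux) (pour Aux Main)))).
Definition dup : cmd :=
  Seq carry (Seq pour2 (Seq (pour Tmp Aux) (pour Aux Main))).

Lemma execs_pour x y s : idx x != idx y ->
  execs (pour x y) s (put y (catrev (get x s) (get y s)) (put x [::] s))
    (5 * size (get x s) + 1).
Proof.
move=> ne; move: {2}(get x s) (erefl (get x s)) => w; elim: w s => [|b w IH] s e.
  rewrite e /=; apply: execs_le (_ : execs _ _ _ 1) => //.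
  have -> : put y (get y s) (put x [::] s) = s by case: x y e {ne} => [] [] []; case: s => ????? /= ->.
  by apply: execs_stop; rewrite e.
pose s1 := put y (b :: get y s) (put x w s).
have e1 : get x s1 = w by rewrite /s1; move: ne; clear; case: x; case: y; case: s.
have := IH s1 e1; rewrite e1 e /= => h.
have -> : put y (catrev w (b :: get y s)) (put x [::] s) =
  put y (catrev w (get y s1)) (put x [::] s1).
  by rewrite /s1; move: ne; clear; case: x; case: y; case: s.
apply: execs_le (execs_go (M := 4) _ _ h); first by lia.
  by rewrite e.
apply: execs_case; rewrite e /=.
have h2 : execs (Seq (Pop x) (Push y b)) s s1 3.
  have -> : s1 = put y (b :: get y (put x (behead (get x s)) s)) (put x (behead (get x s)) s).
    by rewrite e /s1; move: ne; clear; case: x; case: y; case: s.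
  exact: execs_seq (execs_pop _ _) (execs_push _ _ _).
by move: (s1) h2 => s2; case: (b).
Qed.

Lemma execs_pour2 i m a t c :
  execs pour2 (Store i m a t c) (Store i (catrev a m) [::] (catrev a t) c) (7 * size a + 1).
Proof.
elim: a m t => [|b a IH] m t; first by apply: execs_stop.
rewrite /pour2 in IH *.
have h := IH (b :: m) (b :: t).
apply: execs_le (execs_go (M := 6) _ _ h) => //=; first by lia.
apply: execs_case => /=; case: (b); apply: execs_seq (execs_pop _ _) _ => /=;
  exact: execs_seq (execs_push _ _ _) (execs_push _ _ _).
Qed.

Lemma execs_erase i m a t c :
  execs erase (Store i m a t c) (Store i m [::] t c) (2 * size a + 1).
Proof.
elim: a => [|b a IH]; first by apply: execs_stop.
rewrite /erase in IH *; have h := execs_pop Aux (Store i m (b :: a) t c).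
by apply: execs_le (execs_go _ h IH) => //=; lia.
Qed.

Lemma execs_carry i t m x c :
  execs carry (Store i (code t ++ m) x c [::]) (Store i m (catrev (code t) x) c [::])
    (8 * weight t + 3).
Proof.
rewrite [8 * _ + 3](_ : _ = 2 + (8 * weight t + 1)); last by lia.
apply: execs_seq (execs_push _ _ _) _ => /=.
set L := Loop _ _ _.
(* The loop is generalized to a counter with further entries [d], and what happens after [t] is a
   continuation of cost [N]; this lets the two subtrees of a node be chained. *)
suff H : forall t m x d s' N, execs L (Store i m (catrev (code t) x) c d) s' N ->
    execs L (Store i (code t ++ m) x c (true :: d)) s' (8 * weight t + N).
  by apply: H; apply: execs_stop.
elim=> {t m x} [|t1 IH1 t2 IH2] m x d s' N h.
  apply: execs_le (execs_go (s1 := Store i (false :: m) x c (true :: d)) (M := 5) isT _ h); first by rewrite [weight _]/=; lia.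
  apply: (@execs_case Main).
  apply: execs_seq (execs_pop _ _) _ => /=.
  exact: execs_seq (execs_push _ _ _) (execs_pop _ _).
have e : catrev (code (Node t1 t2)) x = catrev (code t2) (catrev (code t1) (true :: x)).
  by rewrite /= !catrevE rev_cat -catA.
rewrite e in h; have h1 := IH1 _ _ _ _ _ (IH2 _ _ _ _ _ h).
apply: execs_le (execs_go (s1 := Store i (code (Node t1 t2) ++ m) x c (true :: d)) (M := 6) isT _ h1).
  by rewrite /=; lia.
apply: (@execs_case Main).
apply: execs_seq (execs_pop _ _) _ => /=; rewrite -catA.
exact: execs_seq (execs_push _ _ _) (execs_push _ _ _).
Qed.

Definition St (i m : seq bool) : store := Store i m [::] [::] [::].

Lemma catrev_code t m : catrev (catrev (code t) [::]) m = code t ++ m.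
Proof. by rewrite !catrevE cats0 revK. Qed.

Lemma execs_drop i t m : execs drop_top (St i (code t ++ m)) (St i m) (14 * weight t).
Proof.
apply: execs_le (execs_seq (execs_carry _ _ _ _ _) (execs_erase _ _ _ _ _)).
by rewrite catrevE size_cat size_rev size_code /=; have := weight_gt0 t; lia.
Qed.

Lemma execs_dup i t m :
  execs dup (St i (code t ++ m)) (St i (code t ++ code t ++ m)) (32 * weight t).
Proof.
apply: execs_le (execs_seq (execs_carry _ _ _ _ _)
  (execs_seq (execs_pour2 _ _ _ _ _) (execs_seq (execs_pour (x := Tmp) (y := Aux) _ isT) 
   (_ : execs _ _ _ (5 * weight t + 1))))).
  by rewrite /= !catrevE !size_cat !size_rev size_cat size_rev size_code /=; have := weight_gt0 t; lia.
rewrite /= catrev_code (catrev_code t [::]) cats0.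
have := @execs_pour Aux Main (Store i (code t ++ m) (catrev (code t) [::]) [::] [::]) isT.
by rewrite /= catrev_code catrevE size_cat size_rev size_code addn0.
Qed.

Lemma execs_swap i t u m :
  execs swap (St i (code t ++ code u ++ m)) (St i (code u ++ code t ++ m))
    (32 * (weight t + weight u)).
Proof.
have h1 := execs_carry i t (code u ++ m) [::] [::].
have := @execs_pour Aux Tmp (Store i (code u ++ m) (catrev (code t) [::]) [::] [::]) isT.
rewrite /= (catrev_code t [::]) cats0 => h2.
have h3 := execs_carry i u m [::] (code t).
have := @execs_pour Tmp Aux (Store i m (catrev (code u) [::]) (code t) [::]) isT.
rewrite /= => h4.
have := @execs_pour Aux Main (Store i m (catrev (code t) (catrev (code u) [::])) [::] [::]) isT.
rewrite /= [catrev (catrev _ _) m](_ : _ = code u ++ code t ++ m) => [h5|]; last first.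
  by rewrite !catrevE cats0 rev_cat !revK -catA.
apply: execs_le (execs_seq h1 (execs_seq h2 (execs_seq h3 (execs_seq h4 h5)))).
rewrite !catrevE !size_cat !size_rev !size_code /=.
by have := weight_gt0 t; have := weight_gt0 u; lia.
Qed.

Inductive fn : Type :=
| Id | Blank | Head | Tail
| Pair of fn & fn
| Comp of fn & fn
| If of fn & fn & fn
| While of fn.

Definition hd (t : tree) : tree := if t is Node a _ then a else Leaf.
Definition tl (t : tree) : tree := if t is Node _ b then b else Leaf.
Definition truthy (t : tree) : bool := if t is Node _ _ then true else false.

(** Costs are measured by the weights of the trees involved, since on stacks even a projection or a
    test has to scan or copy its argument. A [While] loop is controlled by the head of its state. *)
Inductive eval : fn -> tree -> tree -> nat -> Prop :=
| EvId x : eval Id x x (weight x)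
| EvNil x : eval Blank x Leaf (weight x)
| EvHead x : eval Head x (hd x) (weight x)
| EvTail x : eval Tail x (tl x) (weight x)
| EvPair f g x u v m n : eval f x u m -> eval g x v n ->
    eval (Pair f g) x (Node u v) (m + n + weight x + weight v)
| EvComp f g x y z m n : eval f x y m -> eval g y z n -> eval (Comp g f) x z (m + n)
| EvIf c f g x b y m n : eval c x b m -> eval (if truthy b then f else g) x y n ->
    eval (If c f g) x y (m + n + weight x + weight b)
| EvStop f x : ~~ truthy (hd x) -> eval (While f) x x (weight x)
| EvGo f x y z m n : truthy (hd x) -> eval f x y m -> eval (While f) y z n ->
    eval (While f) x z (m + n + weight x).

Definition head_cmd : cmd :=
  Case Main noop noop (Seq (Pop Main) (Seq swap drop_top)).

(** [Pair] computes its second component first, as that must lie below the first one on the stack. A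
    loop keeps a copy of the head of its state on top, so that its test needs to see only one
    bit. *)
Fixpoint compile (f : fn) : cmd :=
  match f with
  | Id => noop
  | Blank => Seq drop_top (Push Main false)
  | Head => head_cmd
  | Tail => Case Main noop noop (Seq (Pop Main) drop_top)
  | Pair f g => Seq dup (Seq (compile g) (Seq swap (Seq (compile f) (Push Main true))))
  | Comp g f => Seq (compile f) (compile g)
  | If c f g => Seq dup (Seq (compile c)
      (Case Main noop (Seq drop_top (compile g)) (Seq drop_top (compile f))))
  | While f =>
      Seq (Seq dup head_cmd)
        (Seq (Loop Main (fun o => o == Some true)
          (Seq drop_top (Seq (compile f) (Seq dup head_cmd)))) drop_top)
  end.

Lemma execs_pop_main i b m : execs (Pop Main) (St i (b :: m)) (St i m) 1.
Proof. exact: (execs_pop Main (St i (b :: m))). Qed.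

Lemma execs_noop i m : execs noop (St i m) (St i m) 3.
Proof. exact: execs_seq (execs_push _ _ _) (execs_pop _ _). Qed.

Lemma ohead_code t m : ohead (code t ++ m) = Some (truthy t).
Proof. by case: t. Qed.

Lemma weight_hd x : weight (hd x) <= weight x.
Proof. by case: x => //= a b; lia. Qed.

Lemma execs_head i x m : execs head_cmd (St i (code x ++ m)) (St i (code (hd x) ++ m)) (50 * weight x).
Proof.
case: x => [|a b] /=.
  by apply: (execs_le (M := 4)); [lia | apply: (@execs_case Main); apply: execs_noop].
rewrite -catA.
have h := execs_seq (execs_swap i a b m) (execs_drop i b (code a ++ m)).
apply: (execs_le (M := (1 + (32 * (weight a + weight b) + 14 * weight b)).+1)); first by lia.
apply: (@execs_case Main); exact: execs_seq (execs_pop_main _ _ _) h.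
Qed.

Lemma compile_correct f x y n : eval f x y n -> forall i m,
  execs (compile f) (St i (code x ++ m)) (St i (code y ++ m)) (200 * n).
Proof.
(* The second part describes the loop once the copy of the head is on top. The reserve
   [14 * weight (hd y)] pays for the final [drop_top], and [98 * weight x] covers the initial [dup]
   and [head_cmd], which take 32 and 50. *)
suff H : eval f x y n -> 
    (forall i m, execs (compile f) (St i (code x ++ m)) (St i (code y ++ m)) (200 * n)) /\
    forall g, f = While g -> forall i m, exists2 N, N + 14 * weight (hd y) + 98 * weight x <= 200 * n &
      execs (Loop Main (fun o => o == Some true)
          (Seq drop_top (Seq (compile g) (Seq dup head_cmd)))) 
        (St i (code (hd x) ++ code x ++ m)) (St i (code (hd y) ++ code y ++ m)) N.
  by move=> /H [].
elim=> {f x y n}.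
- move=> x; split=> // i m; apply: execs_le (execs_noop _ _).
  by have := weight_gt0 x; lia.
- move=> x; split=> // i m; apply: execs_le (execs_seq (execs_drop _ _ _) (execs_push _ _ _)).
  by have := weight_gt0 x; lia.
- by move=> x; split=> // i m; apply: execs_le (execs_head _ _ _); lia.
- move=> x; split=> // i m; case: x => [|a b] /=.
    by apply: (execs_le (M := 4)); [lia | apply: (@execs_case Main); apply: execs_noop].
  rewrite -catA; have h := execs_drop i a (code b ++ m).
  apply: (execs_le (M := (1 + 14 * weight a).+1)); first by lia.
  by apply: (@execs_case Main); exact: execs_seq (execs_pop_main _ _ _) h.
- move=> f g x u v m n _ [hf _] _ [hg _]; split=> // i s.
  apply: execs_le (execs_seq (execs_dup _ _ _) (execs_seq (hg _ _)
    (execs_seq (execs_swap _ _ _ _) (execs_seq (hf _ _) _)))); last first.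
    by rewrite /= -catA; exact: (execs_push Main true (St i (code u ++ code v ++ s))).
  by have := weight_gt0 x; lia.
- move=> f g x y z m n _ [hf _] _ [hg _]; split=> // i s.
  by apply: execs_le (execs_seq (hf _ _) (hg _ _)); lia.
- move=> c f g x b y m n _ [hc _] _ [hf _]; split=> // i s.
  have h : execs (Case Main noop (Seq drop_top (compile g)) (Seq drop_top (compile f)))
      (St i (code b ++ code x ++ s)) (St i (code y ++ s)) (14 * weight b + 200 * n).+1.
    apply: execs_case; rewrite /= ohead_code.
    have := execs_seq (execs_drop i b (code x ++ s)) (hf i s).
    by case: (truthy b).
  apply: execs_le (execs_seq (execs_dup _ _ _) (execs_seq (hc _ _) h)).
  by have := weight_gt0 x; lia.
- move=> f x hx.
  have lp i m : execs (Loop Main (fun o => o == Some true)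
          (Seq drop_top (Seq (compile f) (Seq dup head_cmd)))) 
        (St i (code (hd x) ++ code x ++ m)) (St i (code (hd x) ++ code x ++ m)) 1.
    by apply: execs_stop; rewrite /= ohead_code (negbTE hx).
  have w0 := weight_gt0 x; have wh := weight_hd x.
  split=> [i m|g [<-] i m].
    apply: execs_le (execs_seq (execs_seq (execs_dup _ _ _) (execs_head _ _ _)) (execs_seq (lp _ _) (execs_drop _ _ _))).
    by lia.
  by exists 1; [lia | apply: lp].
- move=> f x y z m n hx _ [hf _] hw [hl hl'].
  have w0 := weight_gt0 x; have wh := weight_hd x.
  have wy := weight_gt0 y; have why := weight_hd y.
  have lp i s : exists2 N, N + 14 * weight (hd z) + 98 * weight x <= 200 * (m + n + weight x) &
      execs (Loop Main (fun o => o == Some true)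
          (Seq drop_top (Seq (compile f) (Seq dup head_cmd)))) 
        (St i (code (hd x) ++ code x ++ s)) (St i (code (hd z) ++ code z ++ s)) N.
    have [N hN h] := hl' _ erefl i s.
    eexists; last first.
      refine (execs_go _ (execs_seq (execs_drop _ _ _) (execs_seq (hf _ _)
       (execs_seq (execs_dup _ _ _) (execs_head _ _ _)))) h).
      by rewrite /= ohead_code hx.
    by lia.
  split=> [i s|g [<-] i s]; last exact: lp.
  have [N hN h] := lp i s.
  apply: execs_le (execs_seq (execs_seq (execs_dup _ _ _) (execs_head _ _ _)) (execs_seq h (execs_drop _ _ _))).
  by lia.
Qed.

(** * Programs running in polynomial time *)

Class Enc (T : Type) : Type := enc : T -> tree.

#[export] Instance enc_tree : Enc tree := id.
#[export] Instance enc_unit : Enc unit := fun _ => Leaf.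
#[export] Instance enc_bool : Enc bool := fun b => if b then Node Leaf Leaf else Leaf.
#[export] Instance enc_prod A B {eA : Enc A} {eB : Enc B} : Enc (A * B) :=
  fun z => Node (enc z.1) (enc z.2).
Fixpoint tree_of_seq A (e : A -> tree) (s : seq A) : tree :=
  if s is x :: s' then Node (e x) (tree_of_seq e s') else Leaf.
#[export] Instance enc_seq A {eA : Enc A} : Enc (seq A) := tree_of_seq eA.
(** Unary notation is affordable: the numbers written in a sentence are at most exponential in its
    length, and so is every budget used below. *)
#[export] Instance enc_nat : Enc nat := fun n => enc (nseq n tt).

Definition wt {A : Type} {eA : Enc A} (x : A) : nat := weight (enc x).
#[global] Arguments wt : simpl never.

Definition evals (f : fn) (x y : tree) (N : nat) : Prop := exists2 n, eval f x y n & n <= N.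

Lemma evals_le f x y M N : M <= N -> evals f x y M -> evals f x y N.
Proof. by move=> le [n h hn]; exists n => //; apply: leq_trans le. Qed.

Lemma evals_id x : evals Id x x (weight x).
Proof. by exists (weight x) => //; constructor. Qed.

Lemma evals_nil x : evals Blank x Leaf (weight x).
Proof. by exists (weight x) => //; constructor. Qed.

Lemma evals_head a b : evals Head (Node a b) a (weight (Node a b)).
Proof. by exists (weight (Node a b)) => //; exact: (EvHead (Node a b)). Qed.

Lemma evals_tail a b : evals Tail (Node a b) b (weight (Node a b)).
Proof. by exists (weight (Node a b)) => //; exact: (EvTail (Node a b)). Qed.

Lemma evals_pair f g x u v M N : evals f x u M -> evals g x v N ->
  evals (Pair f g) x (Node u v) (M + N + weight x + weight v).
Proof.
move=> [m h1 h2] [n h3 h4]; exists (m + n + weight x + weight v); last by lia.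
by constructor.
Qed.

Lemma evals_comp f g x y z M N : evals f x y M -> evals g y z N ->
  evals (Comp g f) x z (M + N).
Proof.
by move=> [m h1 h2] [n h3 h4]; exists (m + n); [exact: EvComp h1 h3 | exact: leq_add].
Qed.

Lemma evals_if c f g x b y M N : evals c x b M ->
  evals (if truthy b then f else g) x y N ->
  evals (If c f g) x y (M + N + weight x + weight b).
Proof.
move=> [m h1 h2] [n h3 h4]; exists (m + n + weight x + weight b); last by lia.
exact: EvIf h1 h3.
Qed.

Lemma evals_stop f x : ~~ truthy (hd x) -> evals (While f) x x (weight x).
Proof. by move=> h; exists (weight x) => //; constructor. Qed.

Lemma evals_go f x y z M N : truthy (hd x) -> evals f x y M -> evals (While f) y z N ->
  evals (While f) x z (M + N + weight x).
Proof.
move=> h [m h1 h2] [n h3 h4]; exists (m + n + weight x); last by lia.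
exact: EvGo h h1 h3.
Qed.

(** Time bounds size; thus an [Eff] statement also controls the weights of the values, which is what
    composition requires. *)
Lemma eval_weight f x y n : eval f x y n -> weight x <= n /\ weight y <= 2 * n.
Proof.
elim=> {f x y n} /=; try by move=> *; lia.
- by move=> x; have := weight_gt0 x; lia.
- by move=> x; have := weight_hd x; lia.
- by case=> //= a b; lia.
- by move=> f g x u v m n _ + _; have := weight_gt0 x; lia.
Qed.

Lemma evals_weight f x y N : evals f x y N -> weight x <= N /\ weight y <= 2 * N.
Proof. by move=> [n /eval_weight [h1 h2] h]; lia. Qed.

(** The base is at least 2, so that constants, sums and products can all be absorbed into the
    exponent. *)
Definition pbound G (B h : G -> nat) : Prop := exists k, forall g, h g <= (B g).+2 ^ k.

Section Pbound.
Variables (G : Type) (B : G -> nat).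

Lemma pbound_le (h h' : G -> nat) : (forall g, h g <= h' g) -> pbound B h' -> pbound B h.
Proof. by move=> le [k hk]; exists k => g; apply: leq_trans (hk g). Qed.

Lemma pbound_const n : pbound B (fun=> n).
Proof.
exists n => g; apply: leq_trans (ltnW (ltn_expl n (ltnSn 1))) _.
by case: n => // n; rewrite leq_exp2r.
Qed.

Lemma pbound_budget : pbound B B.
Proof. by exists 1 => g; rewrite expn1; lia. Qed.

Lemma pbound_mul h h' : pbound B h -> pbound B h' -> pbound B (fun g => h g * h' g).
Proof. by move=> [k hk] [l hl]; exists (k + l) => g; rewrite expnD leq_mul. Qed.

Lemma pbound_add h h' : pbound B h -> pbound B h' -> pbound B (fun g => h g + h' g).
Proof.
move=> [k hk] [l hl]; exists (k + l).+1 => g; have := hk g; have := hl g.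
rewrite expnS expnD; set b := _.+2.
have : 0 < b ^ k by rewrite expn_gt0.
have : 0 < b ^ l by rewrite expn_gt0.
move: (b ^ k) (b ^ l) => u v v0 u0 hv hu.
by apply: (@leq_trans (2 * (u * v))); [nia | rewrite leq_mul].
Qed.

Lemma pbound_exp h n : pbound B h -> pbound B (fun g => h g ^ n).
Proof.
move=> [k hk]; exists (k * n) => g; rewrite expnM.
by case: n => // n; rewrite leq_exp2r.
Qed.

End Pbound.

Lemma pbound_trans G (B B' h : G -> nat) : pbound B' h -> pbound B B' -> pbound B h.
Proof.
move=> [k hk] hB; apply: pbound_le hk _; apply: pbound_exp.
by apply: pbound_le (pbound_add hB (pbound_const B 2)) => g; lia.
Qed.

Lemma pbound_comp G G' (B h : G -> nat) (f : G' -> G) :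
  pbound B h -> pbound (fun g => B (f g)) (fun g => h (f g)).
Proof. by move=> [k hk]; exists k => g. Qed.

(* [G] need not be a type of finite objects: its elements may carry proofs and ghost
   data which restrict the inputs [enc g] or bound the budget. *)
Definition Eff G {eG : Enc G} T {eT : Enc T} (B : G -> nat) (f : G -> T) : Prop :=
  exists p : fn, exists2 K, pbound B K & forall g, evals p (enc g) (enc (f g)) (K g).

Section Eff.
Context {G : Type} {eG : Enc G} (B : G -> nat).

Lemma eff_ext T {eT : Enc T} (f f' : G -> T) : f =1 f' -> Eff B f -> Eff B f'.
Proof. by move=> e [p [K hK hp]]; exists p, K => // g; rewrite -e. Qed.

Lemma eff_budget B' T {eT : Enc T} (f : G -> T) : pbound B B' -> Eff B' f -> Eff B f.
Proof. by move=> hB [p [K hK hp]]; exists p, K => //; apply: pbound_trans hB. Qed.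

Lemma eff_recode T T' {eT : Enc T} {eT' : Enc T'} (f : G -> T) (f' : G -> T') :
  (forall g, enc (f g) = enc (f' g)) -> Eff B f -> Eff B f'.
Proof. by move=> e [p [K hK hp]]; exists p, K => // g; rewrite -e. Qed.

Lemma eff_weight T {eT : Enc T} (f : G -> T) : Eff B f -> pbound B (fun g => wt (f g)).
Proof.
move=> [p [K hK hp]]; apply: pbound_le (pbound_mul (pbound_const B 2) hK) => g.
exact: (evals_weight (hp g)).2.
Qed.

Lemma eff_ctx T {eT : Enc T} (f : G -> T) : Eff B f -> pbound B wt.
Proof.
move=> [p [K hK hp]]; apply: pbound_le hK => g.
exact: (evals_weight (hp g)).1.
Qed.

Lemma eff_id : pbound B wt -> Eff B (fun g => g).
Proof. by move=> h; exists Id, wt => // g; apply: evals_id. Qed.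

Lemma eff_comp A {eA : Enc A} T {eT : Enc T} B' (f : G -> A) (h : A -> T) :
  Eff B f -> Eff B' h -> pbound B (fun g => B' (f g)) -> Eff B (fun g => h (f g)).
Proof.
move=> [p [K hK hp]] [q [L hL hq]] hB; exists (Comp q p), (fun g => K g + L (f g)).
  by apply: pbound_add hK _; apply: pbound_trans hB; apply: (pbound_comp f).
by move=> g; apply: evals_comp (hp g) (hq _).
Qed.

Lemma eff_app A {eA : Enc A} T {eT : Enc T} (f : G -> A) (h : A -> T) :
  Eff wt h -> Eff B f -> Eff B (fun g => h (f g)).
Proof. by move=> hh hf; exact: eff_comp hf hh (eff_weight hf). Qed.

Lemma eff_pair A {eA : Enc A} T {eT : Enc T} (f : G -> A) (h : G -> T) :
  Eff B f -> Eff B h -> Eff B (fun g => (f g, h g)).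
Proof.
move=> ef eh; have pc := eff_ctx ef; have ph := eff_weight eh.
move: ef eh => [p [K hK hp]] [q [L hL hq]].
exists (Pair p q), (fun g => K g + L g + wt g + wt (h g)).
  exact: pbound_add (pbound_add (pbound_add hK hL) pc) ph.
by move=> g; apply: evals_pair.
Qed.

Lemma eff_node (f h : G -> tree) : Eff B f -> Eff B h -> Eff B (fun g => Node (f g) (h g)).
Proof. by move=> ef eh; apply: eff_recode (eff_pair ef eh). Qed.

Lemma eff_cons A {eA : Enc A} (f : G -> A) (h : G -> seq A) :
  Eff B f -> Eff B h -> Eff B (fun g => f g :: h g).
Proof. by move=> ef eh; apply: eff_recode (eff_pair ef eh). Qed.

Lemma eff_tree (t : tree) : pbound B wt -> Eff B (fun=> t).
Proof.
move=> h; elim: t => [|a IHa b IHb]; last exact: eff_node.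
by exists Blank, wt => // g; apply: evals_nil.
Qed.

Lemma eff_const T {eT : Enc T} (x : T) : pbound B wt -> Eff B (fun=> x).
Proof. by move=> h; apply: eff_recode (eff_tree (enc x) h). Qed.

Lemma eff_if T {eT : Enc T} (b : G -> bool) (f h : G -> T) :
  Eff B b -> Eff B f -> Eff B h -> Eff B (fun g => if b g then f g else h g).
Proof.
move=> eb ef eh; have pc := eff_ctx ef; have pb := eff_weight eb.
move: eb ef eh => [c [J hJ hc]] [p [K hK hp]] [q [L hL hq]].
exists (If c p q), (fun g => J g + (K g + L g) + wt g + wt (b g)).
  exact: pbound_add (pbound_add (pbound_add hJ (pbound_add hK hL)) pc) pb.
move=> g; apply: evals_if (hc g) _; case: (b g) => /=.
  by apply: evals_le (hp g); lia.
by apply: evals_le (hq g); lia.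
Qed.

End Eff.

Lemma eff_hd : Eff wt hd.
Proof.
exists Head, wt => [|t]; first exact: pbound_budget.
by exists (weight t) => //; constructor.
Qed.

Lemma eff_tl : Eff wt tl.
Proof.
exists Tail, wt => [|t]; first exact: pbound_budget.
by exists (weight t) => //; constructor.
Qed.

Lemma weight_node a b : weight (Node a b) = (weight a + weight b).+1.
Proof. by []. Qed.

Lemma wt_pair A B {eA : Enc A} {eB : Enc B} (z : A * B) : wt z = (wt z.1 + wt z.2).+1.
Proof. by []. Qed.

Lemma wt_cons A {eA : Enc A} (x : A) s : wt (x :: s) = (wt x + wt s).+1.
Proof. by []. Qed.

Lemma wt_nil A {eA : Enc A} : wt ([::] : seq A) = 1.
Proof. by []. Qed.

Lemma wt_gt0 A {eA : Enc A} (x : A) : 0 < wt x.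
Proof. exact: weight_gt0. Qed.

Lemma wt_nat n : wt n = (2 * n).+1.
Proof. by rewrite /wt /enc /enc_nat; elim: n => //= n; rewrite /wt /enc /=; lia. Qed.

Lemma wt_bool (b : bool) : wt b <= 3.
Proof. by case: b. Qed.

Lemma wt_cat A {eA : Enc A} (s t : seq A) : wt (s ++ t) + 1 = wt s + wt t.
Proof. by elim: s => [|x s IH] /=; [rewrite addnC | rewrite !wt_cons; lia]. Qed.

Lemma wt_rev A {eA : Enc A} (s : seq A) : wt (rev s) = wt s.
Proof.
elim: s => // x s IH; rewrite rev_cons -cats1.
pose proof (wt_cat (rev s) [:: x]) as h.
by move: h; rewrite !wt_cons wt_nil; lia.
Qed.

Lemma size_wt A {eA : Enc A} (s : seq A) : (2 * size s).+1 <= wt s.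
Proof. by elim: s => //= x s; rewrite wt_cons; pose proof (wt_gt0 x); lia. Qed.

Lemma wt_nth A {eA : Enc A} x0 (s : seq A) i : i < size s -> wt (nth x0 s i) < wt s.
Proof.
elim: s i => //= x s IH [|i] /= h; rewrite wt_cons ?ltnS ?leq_addr //.
by have := IH _ h; lia.
Qed.

Lemma wt_drop A {eA : Enc A} (s : seq A) i : wt (drop i s) <= wt s.
Proof. by pose proof (wt_cat (take i s) (drop i s)) as h; pose proof (wt_gt0 (take i s)); move: h; rewrite cat_take_drop; lia. Qed.

Lemma wt_map A T {eT : Enc T} (f : A -> T) (s : seq A) m :
  (forall i x0, i < size s -> wt (f (nth x0 s i)) <= m) -> wt (map f s) <= (size s * m.+1).+1.
Proof.
elim: s => //= x s IH h; rewrite wt_cons.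
have := h 0 x isT; have := IH (fun i x0 lt => h i.+1 x0 lt).
by rewrite /=; lia.
Qed.

Section Loop.
Context {G : Type} {eG : Enc G} (B : G -> nat).
Context {X : Type} {eX : Enc X} {A : Type} {eA : Enc A}.
Variables (l : G -> seq X) (a : G -> A) (step : G -> A -> X -> A).

(** The state of the [While] loop consists of the remaining list, which is tested, the accumulator
    and the context. The step has to be fast only at accumulators that really occur. *)
Lemma eff_foldl_raw : Eff B l -> Eff B a ->
  (exists p : fn, exists2 K, pbound B K & forall g s x t, l g = s ++ x :: t ->
     let acc := foldl (step g) (a g) s in
     evals p (enc (g, (acc, x))) (enc (step g acc x)) (K g)) ->
  Eff B (fun g => foldl (step g) (a g) (l g)).
Proof.
move=> el ea [p [K hK hp]].
have pw := eff_ctx el; have pl := eff_weight el; have pa := eff_weight ea.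
move: el ea => [q [L hL hq]] [r [M hM hr]].
pose gg := Comp Tail Tail; pose acc := Comp Head Tail; pose x := Comp Head Head.
pose body := Pair (Comp Tail Head) (Pair (Comp p (Pair gg (Pair acc x))) gg).
pose (W := fun g : G => wt g + wt (l g) + wt (a g) + 2 * K g).
have hW : pbound B W by exact: pbound_add (pbound_add (pbound_add pw pl) pa) (pbound_mul (pbound_const B 2) hK).
have h50 := pbound_mul (pbound_const B 200) hW.
pose N g := (size (l g)).+1 * (200 * W g + K g) + 200 * W g.
exists (Comp acc (Comp (While body) (Pair q (Pair r Id)))).
exists (fun g => L g + M g + 10 * W g + N g).
  apply: pbound_add (pbound_add (pbound_add hL hM) (pbound_mul (pbound_const B 10) hW)) _.
  apply: pbound_add _ (h50); apply: pbound_mul _ (pbound_add (h50) hK).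
  by apply: pbound_le pl => g; pose proof (size_wt (l g)); lia.
move=> g.
have wg0 : 0 < weight (enc g) by apply: weight_gt0.
have start : evals (Pair q (Pair r Id)) (enc g) (Node (enc (l g)) (Node (enc (a g)) (enc g)))
    (L g + M g + 10 * W g).
  apply: evals_le (evals_pair (hq g) (evals_pair (hr g) (evals_id _))).
  by rewrite /W /wt !weight_node; lia.
(* An accumulator is either [a g] or an output of [p], whose weight is at most twice its running
   time. *)
have wacc s t : l g = s ++ t -> weight (enc (foldl (step g) (a g) s)) <= 2 * K g + weight (enc (a g)).
  case/lastP: s => [|s y] e /=; first by lia.
  rewrite foldl_rcons; have := hp g s y t; rewrite e -cats1 -catA => /(_ erefl).
  by move/evals_weight; lia.
have loop s t : l g = s ++ t ->
  evals (While body) (Node (enc t) (Node (enc (foldl (step g) (a g) s)) (enc g)))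
    (Node Leaf (Node (enc (foldl (step g) (a g) (l g))) (enc g)))
    ((size t).+1 * (200 * W g + K g)).
  elim: t s => [|y t IH] s e.
    rewrite e cats0; apply: evals_le (evals_stop _ _) => //.
    have := wacc s [::] e; rewrite /W /wt !weight_node /= mul1n; lia.
  have := IH (rcons s y); rewrite -cats1 -catA cats1 => /(_ e) {}IH.
  have := wacc s (y :: t) e.
  have : weight (enc (y :: t)) <= weight (enc (l g)).
    rewrite e; pose proof (wt_cat s (y :: t)); pose proof (wt_gt0 s); rewrite /wt in H H0; lia.
  have := (evals_weight (hp g s y t e)).2.
  rewrite foldl_rcons in IH => wnew wyt wold.
  apply: evals_le (evals_go _ _ IH) => //; last first.
    apply: evals_pair.
      by apply: evals_comp (evals_head _ _) (evals_tail _ _).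
    apply: evals_pair; last by apply: evals_comp (evals_tail _ _) (evals_tail _ _).
    apply: evals_comp (hp g s y t e).
    apply: evals_pair; first by apply: evals_comp (evals_tail _ _) (evals_tail _ _).
    apply: evals_pair; first by apply: evals_comp (evals_tail _ _) (evals_head _ _).
    by apply: evals_comp (evals_head _ _) (evals_head _ _).
  have eyt : weight (enc (y :: t)) = (weight (enc y) + weight (enc t)).+1 by [].
  have eyt' : enc (y :: t) = Node (enc y) (enc t) by [].
  rewrite eyt in wyt; rewrite [size (_ :: _)]/= [X in _ <= X]mulSn.
  pose proof (weight_gt0 (enc (a g))) as wa0.
  rewrite -/(enc y) -/(enc t) /W /wt !weight_node; cbn [fst snd].
  move: wnew wyt wold wg0 wa0; move: (_ * (200 * _ + _)) => U.
  move: (weight (enc y)) (weight (enc t)) (weight (enc g)) => ? ? ?.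
  move: (weight (enc (l g))) (weight (enc (a g))) (weight (enc (step _ _ _))) => ? ? ?.
  by move: (weight (enc (foldl _ _ s))) (K g) => ? ?; clear; lia.
apply: evals_le (evals_comp (evals_comp start (loop [::] (l g) erefl))
  (evals_comp (evals_tail _ _) (evals_head _ _))).
have := wacc (l g) [::]; rewrite cats0 => /(_ erefl).
rewrite /N /W /wt !weight_node (_ : weight Leaf = 1) //; move: (_ * (200 * _ + _)) wg0 => U.
move: (weight (enc g)) (weight (enc (l g))) (weight (enc (a g))) => ? ? ?.
by move: (weight (enc (foldl _ _ _))) (K g) (L g) (M g) => ? ? ? ?; clear; lia.
Qed.

End Loop.

(** The budget under a binder: the bound variable pays for itself by its weight. *)
Definition ext {G X : Type} {eX : Enc X} (B : G -> nat) (z : G * X) : nat := B z.1 + wt z.2.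

Lemma pbound_lift G X {eX : Enc X} (B h : G -> nat) :
  pbound B h -> pbound (ext (X := X) B) (fun z => h z.1).
Proof.
move=> [k hk]; exists k => z; apply: leq_trans (hk z.1) _.
by case: k {hk} => // k; rewrite leq_exp2r // !ltnS leq_addr.
Qed.

Lemma pbound_ext_snd G X {eX : Enc X} (B : G -> nat) :
  pbound (ext (X := X) B) (fun z => wt z.2).
Proof. by apply: pbound_le (pbound_budget _) => z; apply: leq_addl. Qed.

Lemma pbound_ext G X {eG : Enc G} {eX : Enc X} (B : G -> nat) :
  pbound B wt -> pbound (ext (X := X) B) wt.
Proof.
move=> h; apply: pbound_le (pbound_add (pbound_add (pbound_lift (X := X) h) (pbound_ext_snd B)) (pbound_const _ 1)) => z.
by rewrite wt_pair addn1.
Qed.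

Section Basic.
Context {G : Type} {eG : Enc G} (B : G -> nat).

Lemma eff_fst X {eX : Enc X} Y {eY : Enc Y} (f : G -> X * Y) : Eff B f -> Eff B (fun g => (f g).1).
Proof.
move=> h; apply: (eff_recode (f := fun g => hd (enc (f g)))) => //.
by apply: (eff_app (f := fun g => enc (f g)) eff_hd); apply: eff_recode h.
Qed.

Lemma eff_snd X {eX : Enc X} Y {eY : Enc Y} (f : G -> X * Y) : Eff B f -> Eff B (fun g => (f g).2).
Proof.
move=> h; apply: (eff_recode (f := fun g => tl (enc (f g)))) => //.
by apply: (eff_app (f := fun g => enc (f g)) eff_tl); apply: eff_recode h.
Qed.

Lemma eff_truthy (f : G -> tree) : Eff B f -> Eff B (fun g => truthy (f g)).
Proof.
move=> h; have [p [K hK hp]] := eff_const true (eff_ctx h).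
have [q [L hL hq]] := eff_const false (eff_ctx h).
have hf := eff_weight h; have hc := eff_ctx h; case: h => [r [M hM hr]].
exists (If r p q), (fun g => M g + (K g + L g) + wt g + wt (f g)).
  exact: pbound_add (pbound_add (pbound_add hM (pbound_add hK hL)) hc) hf.
move=> g; apply: evals_if (hr g) _; rewrite /enc /enc_tree.
by case: (truthy _); [apply: evals_le (hp g) | apply: evals_le (hq g)]; lia.
Qed.

Lemma eff_nilp X {eX : Enc X} (f : G -> seq X) : Eff B f -> Eff B (fun g => nilp (f g)).
Proof.
move=> h; apply: (eff_ext (f := fun g => if truthy (enc (f g)) then false else true)).
  by move=> g; case: (f g).
apply: eff_if; try (apply: eff_const; exact: eff_ctx h).
by apply: eff_truthy; apply: eff_recode h.
Qed.

Lemma eff_behead X {eX : Enc X} (f : G -> seq X) : Eff B f -> Eff B (fun g => behead (f g)).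
Proof.
move=> h; apply: (eff_recode (f := fun g => tl (enc (f g)))); first by move=> g; case: (f g).
by apply: (eff_app (f := fun g => enc (f g)) eff_tl); apply: eff_recode h.
Qed.

Lemma eff_head X {eX : Enc X} (x0 : X) (f : G -> seq X) : Eff B f -> Eff B (fun g => head x0 (f g)).
Proof.
move=> h; have hc := eff_ctx h.
apply: (eff_recode (f := fun g => if nilp (f g) then enc x0 else hd (enc (f g)))).
  by move=> g; case: (f g).
apply: eff_if; [exact: eff_nilp | exact: eff_tree |].
by apply: (eff_app (f := fun g => enc (f g)) eff_hd); apply: eff_recode h.
Qed.

Lemma eff_negb (b : G -> bool) : Eff B b -> Eff B (fun g => ~~ b g).
Proof.
move=> h; have hc := eff_ctx h.
by apply: (eff_ext (f := fun g => if b g then false else true)) => [g|];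
  [case: (b g) | apply: eff_if => //; exact: eff_const].
Qed.

Lemma eff_andb (b c : G -> bool) : Eff B b -> Eff B c -> Eff B (fun g => b g && c g).
Proof. by move=> h h'; apply: (eff_if h h'); apply: eff_const; exact: eff_ctx h. Qed.

Lemma eff_orb (b c : G -> bool) : Eff B b -> Eff B c -> Eff B (fun g => b g || c g).
Proof. by move=> h h'; apply: (eff_if h _ h'); apply: eff_const; exact: eff_ctx h. Qed.

(** Iterating a polynomial step may produce exponential growth, so the intermediate accumulators
    need a bound [K] of their own. *)
Lemma eff_foldl X {eX : Enc X} A {eA : Enc A} (l : G -> seq X) (a : G -> A)
    (step : G -> A -> X -> A) (K : G -> nat) :
  Eff B l -> Eff B a ->
  Eff (ext B) (fun z : G * (A * X) => step z.1 z.2.1 z.2.2) ->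
  pbound B K -> (forall g s t, l g = s ++ t -> wt (foldl (step g) (a g) s) <= K g) ->
  Eff B (fun g => foldl (step g) (a g) (l g)).
Proof.
move=> el ea [p [M [k hM] hp]] hK hb; apply: eff_foldl_raw => //.
exists p, (fun g => (B g + K g + wt (l g) + 3) ^ k).
  apply: pbound_exp; apply: pbound_add (pbound_const _ 3).
  exact: pbound_add (pbound_add (pbound_budget _) hK) (eff_weight el).
move=> g s x t e acc; apply: evals_le (hp (g, (acc, x))).
apply: leq_trans (hM _) _; case: k {hM hp} => // k; rewrite leq_exp2r // /ext.
have h1 := hb g s (x :: t) e.
have h2 : (wt x < wt (l g)).
  rewrite e; pose proof (wt_cat s (x :: t)) as h; pose proof (wt_gt0 s).
  by move: h; rewrite wt_cons; pose proof (wt_gt0 t); lia.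
by rewrite [wt (_, _).2]wt_pair /= /acc; lia.
Qed.

End Basic.

Lemma foldl_cons X (s t : seq X) : foldl (fun s x => x :: s) t s = catrev s t.
Proof. by elim: s t => //= x s IH t. Qed.

Lemma eff_id_ext G {eG : Enc G} (B : G -> nat) X {eX : Enc X} : pbound B wt -> Eff (ext B) (fun z : G * X => z).
Proof. by move=> h; apply: eff_id; apply: pbound_ext. Qed.

Section Lists.
Context {G : Type} {eG : Enc G} (B : G -> nat).

Lemma eff_catrev X {eX : Enc X} (l t : G -> seq X) :
  Eff B l -> Eff B t -> Eff B (fun g => catrev (l g) (t g)).
Proof.
move=> h h'; have hc := eff_ctx h.
apply: (eff_ext (f := fun g => foldl (fun s x => x :: s) (t g) (l g))).
  by move=> g; rewrite foldl_cons.
pose proof (eff_id_ext (X := seq X * X) hc) as hz.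
apply: (eff_foldl (K := fun g => wt (l g) + wt (t g)) h h').
- by apply: eff_cons; [apply: eff_snd; apply: eff_snd | apply: eff_fst; apply: eff_snd].
- exact: pbound_add (eff_weight h) (eff_weight h').
move=> g u v e; rewrite foldl_cons catrevE e.
pose proof (wt_cat u v); pose proof (wt_cat (rev u) (t g)); pose proof (wt_gt0 v).
by rewrite wt_rev in H0; lia.
Qed.

Lemma eff_rev X {eX : Enc X} (l : G -> seq X) : Eff B l -> Eff B (fun g => rev (l g)).
Proof. by move=> h; apply: eff_catrev => //; apply: eff_const; exact: eff_ctx h. Qed.

Lemma eff_cat X {eX : Enc X} (l t : G -> seq X) :
  Eff B l -> Eff B t -> Eff B (fun g => l g ++ t g).
Proof.
move=> h h'; apply: (eff_ext (f := fun g => catrev (rev (l g)) (t g))).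
  by move=> g; rewrite catrevE revK.
by apply: eff_catrev => //; apply: eff_rev.
Qed.

Lemma eff_map X {eX : Enc X} Y {eY : Enc Y} (l : G -> seq X) (f : G -> X -> Y) :
  Eff B l -> Eff (ext B) (fun z : G * X => f z.1 z.2) -> Eff B (fun g => map (f g) (l g)).
Proof.
move=> h hf; have hc := eff_ctx h.
have fE g (s : seq X) : foldl (fun s x => f g x :: s) [::] s = rev (map (f g) s).
  by rewrite /rev -foldl_cons; elim: s [::] => //= x s IH t.
apply: (eff_ext (f := fun g => rev (foldl (fun s x => f g x :: s) [::] (l g)))).
  by move=> g; rewrite fE revK.
apply: eff_rev; case: (eff_weight hf) => k hk.
pose (M := fun g : G => (B g + wt (l g) + 2) ^ k).
have hM : pbound B M.
  apply: pbound_exp; apply: pbound_add (pbound_const _ 2).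
  exact: pbound_add (pbound_budget _) (eff_weight h).
apply: (eff_foldl (K := fun g => wt (l g) * (M g + 1) + 1)) => //.
- exact: eff_const.
- pose proof (eff_id_ext (X := seq Y * X) hc) as hz; apply: eff_cons; last first.
    by apply: eff_fst; apply: eff_snd.
  apply: (eff_comp (f := fun z : G * (seq Y * X) => (z.1, z.2.2)) _ hf).
    by apply: eff_pair; [apply: eff_fst | apply: eff_snd; apply: eff_snd].
  by apply: pbound_le (pbound_budget _) => z; rewrite /ext wt_pair /=; lia.
- apply: pbound_add (pbound_const _ 1); apply: pbound_mul (eff_weight h) _.
  exact: pbound_add hM (pbound_const _ 1).
move=> g s t e; rewrite fE wt_rev.
have hb i x0 : i < size s -> wt (f g (nth x0 s i)) <= M g.
  move=> lt; apply: leq_trans (hk (g, nth x0 s i)) _.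
  rewrite /M; case: (k) => // k'; rewrite leq_exp2r // /ext /=.
  pose proof (wt_nth x0 lt) as h1; pose proof (wt_cat s t) as h2; pose proof (wt_gt0 t).
  by rewrite -e in h2; lia.
apply: leq_trans (wt_map hb) _; rewrite addn1 ltnS -[(M g).+1]addn1 leq_mul //.
pose proof (size_wt s); pose proof (wt_cat s t) as h2; pose proof (wt_gt0 t).
by rewrite -e in h2; lia.
Qed.

Lemma eff_filter X {eX : Enc X} (l : G -> seq X) (f : G -> X -> bool) :
  Eff B l -> Eff (ext B) (fun z : G * X => f z.1 z.2) -> Eff B (fun g => filter (f g) (l g)).
Proof.
move=> h hf; have hc := eff_ctx h.
have fE g (s : seq X) : foldl (fun s x => if f g x then x :: s else s) [::] s = rev (filter (f g) s).
  rewrite /rev -foldl_cons; elim: s [::] => //= x s IH t.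
  by rewrite IH; case: (f g x).
apply: (eff_ext (f := fun g => rev (foldl (fun s x => if f g x then x :: s else s) [::] (l g)))).
  by move=> g; rewrite fE revK.
apply: eff_rev.
apply: (eff_foldl (K := fun g => wt (l g))) => //.
- exact: eff_const.
- pose proof (eff_id_ext (X := seq X * X) hc) as hz.
  have h1 : Eff (ext B) (fun z : G * (seq X * X) => z.2.1) by apply: eff_fst; apply: eff_snd.
  have h2 : Eff (ext B) (fun z : G * (seq X * X) => z.2.2) by apply: eff_snd; apply: eff_snd.
  apply: eff_if => //; last exact: eff_cons.
  apply: (eff_comp (f := fun z : G * (seq X * X) => (z.1, z.2.2)) _ hf).
    by apply: eff_pair; [apply: eff_fst | apply: eff_snd; apply: eff_snd].
  by apply: pbound_le (pbound_budget _) => z; rewrite /ext wt_pair /=; lia.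
- exact: eff_weight.
move=> g s t e; rewrite fE wt_rev.
apply: (@leq_trans (wt s)).
  by elim: (s) => //= x s' IH; case: (f g x); rewrite !wt_cons; lia.
pose proof (wt_cat s t) as h2; pose proof (wt_gt0 t).
by rewrite -e in h2; lia.
Qed.

End Lists.

Section Flatten.
Context {G : Type} {eG : Enc G} (B : G -> nat).

Lemma eff_flatten X {eX : Enc X} (l : G -> seq (seq X)) :
  Eff B l -> Eff B (fun g => flatten (l g)).
Proof.
move=> h; have hc := eff_ctx h.
have fE (s : seq (seq X)) : foldl (fun s x => catrev x s) [::] s = rev (flatten s).
  rewrite /rev; elim: s [::] => //= x s IH t.
  by rewrite IH !catrevE rev_cat catA.
apply: (eff_ext (f := fun g => rev (foldl (fun s x => catrev x s) [::] (l g)))).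
  by move=> g; rewrite fE revK.
apply: eff_rev.
apply: (eff_foldl (K := fun g => wt (l g))) => //.
- exact: eff_const.
- pose proof (eff_id_ext (X := seq X * seq X) hc) as hz.
  have h1 : Eff (ext B) (fun z : G * (seq X * seq X) => z.2.1) by apply: eff_fst; apply: eff_snd.
  have h2 : Eff (ext B) (fun z : G * (seq X * seq X) => z.2.2) by apply: eff_snd; apply: eff_snd.
  exact: eff_catrev.
- exact: eff_weight.
move=> g s t e; rewrite fE wt_rev.
apply: (@leq_trans (wt s)).
  elim: (s) => //= x s' IH; pose proof (wt_cat x (flatten s')) as h2.
  by move: h2; rewrite wt_cons; lia.
pose proof (wt_cat s t) as h2; pose proof (wt_gt0 t).
by rewrite -e in h2; lia.
Qed.

Lemma eff_foldr X {eX : Enc X} A {eA : Enc A} (l : G -> seq X) (a : G -> A)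
    (step : G -> X -> A -> A) (K : G -> nat) :
  Eff B l -> Eff B a ->
  Eff (ext B) (fun z : G * (X * A) => step z.1 z.2.1 z.2.2) ->
  pbound B K -> (forall g s t, l g = s ++ t -> wt (foldr (step g) (a g) t) <= K g) ->
  Eff B (fun g => foldr (step g) (a g) (l g)).
Proof.
move=> el ea es hK hb; have hc := eff_ctx el.
apply: (eff_ext (f := fun g => foldl (fun y x => step g x y) (a g) (rev (l g)))).
  by move=> g; rewrite foldl_rev.
apply: (eff_foldl (K := K)) => //; first exact: eff_rev.
  pose proof (eff_id_ext (X := A * X) hc) as hz.
  apply: (eff_comp (f := fun z : G * (A * X) => (z.1, (z.2.2, z.2.1))) _ es).
    apply: eff_pair; first exact: eff_fst.
    by apply: eff_pair; [apply: eff_snd; apply: eff_snd | apply: eff_fst; apply: eff_snd].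
  by apply: pbound_le (pbound_budget _) => z; rewrite /ext !wt_pair /=; lia.
move=> g s t e; rewrite -[s]revK foldl_rev; apply: (hb g (rev t)).
by rewrite -rev_cat -e revK.
Qed.

Lemma eff_has X {eX : Enc X} (l : G -> seq X) (f : G -> X -> bool) :
  Eff B l -> Eff (ext B) (fun z : G * X => f z.1 z.2) -> Eff B (fun g => has (f g) (l g)).
Proof.
move=> h hf; apply: (eff_ext (f := fun g => ~~ nilp (filter (f g) (l g)))).
  by move=> g; elim: (l g) => //= x s <-; case: (f g x).
by apply: eff_negb; apply: eff_nilp; apply: eff_filter.
Qed.

Lemma eff_all X {eX : Enc X} (l : G -> seq X) (f : G -> X -> bool) :
  Eff B l -> Eff (ext B) (fun z : G * X => f z.1 z.2) -> Eff B (fun g => all (f g) (l g)).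
Proof.
move=> h hf; apply: (eff_ext (f := fun g => ~~ has (fun x => ~~ f g x) (l g))).
  by move=> g; rewrite -all_predC; apply: eq_all => x /=; rewrite negbK.
by apply: eff_negb; apply: eff_has => //; apply: eff_negb.
Qed.

(* Natural numbers are stored in unary, as lists of units. *)
Lemma eff_units (n : G -> nat) : Eff B n -> Eff B (fun g => nseq (n g) tt).
Proof. exact: eff_recode. Qed.

Lemma eff_nat_of_units (n : G -> nat) : Eff B (fun g => nseq (n g) tt) -> Eff B n.
Proof. exact: eff_recode. Qed.

Lemma eff_iter A {eA : Enc A} (n : G -> nat) (a : G -> A) (f : G -> A -> A) (K : G -> nat) :
  Eff B n -> Eff B a -> Eff (ext B) (fun z : G * A => f z.1 z.2) ->
  pbound B K -> (forall g i, i <= n g -> wt (iter i (f g) (a g)) <= K g) ->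
  Eff B (fun g => iter (n g) (f g) (a g)).
Proof.
move=> en ea ef hK hb; have hc := eff_ctx en.
have fE g m : foldl (fun x _ => f g x) (a g) (nseq m tt) = iter m (f g) (a g).
  by elim: m (a g) => //= m IH x; rewrite IH -iterSr.
apply: (eff_ext (f := fun g => foldl (fun x _ => f g x) (a g) (nseq (n g) tt))).
  by move=> g; rewrite fE.
apply: (eff_foldl (step := fun g x _ => f g x) (K := K) (eff_units en)) => //.
  pose proof (eff_id_ext (X := A * unit) hc) as hz.
  apply: (eff_comp (f := fun z : G * (A * unit) => (z.1, z.2.1)) _ ef).
    by apply: eff_pair; [apply: eff_fst | apply: eff_fst; apply: eff_snd].
  by apply: pbound_le (pbound_budget _) => z; rewrite /ext !wt_pair /=; lia.
move=> g s t e; have -> : s = nseq (size s) tt by elim: (s) => //= -[] s' <-.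
rewrite fE; apply: hb; rewrite -(size_nseq (n g) tt) e size_cat leq_addr //.
Qed.

Lemma eff_size X {eX : Enc X} (l : G -> seq X) : Eff B l -> Eff B (fun g => size (l g)).
Proof.
move=> h; apply: eff_nat_of_units; have hc := eff_ctx h.
apply: (eff_ext (f := fun g => map (fun=> tt) (l g))).
  by move=> g; elim: (l g) => //= x s ->.
by apply: eff_map h _; apply: eff_const; apply: pbound_ext.
Qed.

Lemma eff_addn (m n : G -> nat) : Eff B m -> Eff B n -> Eff B (fun g => m g + n g).
Proof.
move=> /eff_units h /eff_units h'; apply: eff_nat_of_units.
apply: (eff_ext (f := fun g => nseq (m g) tt ++ nseq (n g) tt)); last exact: eff_cat.
by move=> g; rewrite nseqD.
Qed.

Lemma eff_predn (m : G -> nat) : Eff B m -> Eff B (fun g => (m g).-1).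
Proof.
move=> /eff_units h; apply: eff_nat_of_units.
by apply: (eff_ext (f := fun g => behead (nseq (m g) tt))); [move=> g; case: (m g) | exact: eff_behead].
Qed.

Lemma eff_nat0 (m : G -> nat) : Eff B m -> Eff B (fun g => m g == 0).
Proof.
move=> /eff_units h.
by apply: (eff_ext (f := fun g => nilp (nseq (m g) tt))); [move=> g; case: (m g) | exact: eff_nilp].
Qed.

End Flatten.

Section Arith.
Context {G : Type} {eG : Enc G} (B : G -> nat).

Lemma eff_subn (m n : G -> nat) : Eff B m -> Eff B n -> Eff B (fun g => m g - n g).
Proof.
move=> h h'; have hc := eff_ctx h.
have sE k i : iter i predn k = k - i by elim: i => [|i IH] /=; rewrite ?subn0 // IH subnS.
apply: (eff_ext (f := fun g => iter (n g) predn (m g))) => [g|]; first exact: sE.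
apply: (eff_iter (f := fun _ => predn) (K := fun g => wt (m g))) => //.
- by apply: eff_predn; apply: eff_snd; apply: eff_id_ext.
- exact: eff_weight.
by move=> g i _; rewrite sE !wt_nat; lia.
Qed.

Lemma eff_muln (m n : G -> nat) : Eff B m -> Eff B n -> Eff B (fun g => m g * n g).
Proof.
move=> h h'; have hc := eff_ctx h.
have mE k i : iter i (addn k) 0 = k * i by elim: i => [|i IH] /=; rewrite ?muln0 // IH mulnS.
apply: (eff_ext (f := fun g => iter (n g) (addn (m g)) 0)) => [g|]; first exact: mE.
apply: (eff_iter (f := fun g => addn (m g)) (K := fun g => wt (m g) * wt (n g))) => //.
- exact: eff_const.
- pose proof (eff_id_ext (X := nat) hc) as hz; apply: eff_addn; last exact: eff_snd.
  apply: (eff_comp (B' := B) (h := m) _ h); first exact: eff_fst.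
  by apply: pbound_le (pbound_budget _) => z; apply: leq_addr.
- exact: pbound_mul (eff_weight h) (eff_weight h').
by move=> g i le; rewrite mE !wt_nat; nia.
Qed.

Lemma eff_leq (m n : G -> nat) : Eff B m -> Eff B n -> Eff B (fun g => m g <= n g).
Proof. by move=> h h'; apply: eff_nat0; apply: eff_subn. Qed.

End Arith.

Lemma eff_lift G {eG : Enc G} (B : G -> nat) X {eX : Enc X} T {eT : Enc T} (f : G -> T) :
  Eff B f -> Eff (ext (X := X) B) (fun z => f z.1).
Proof.
move=> h; apply: eff_comp (eff_fst (eff_id_ext (eff_ctx h))) h _.
by apply: pbound_le (pbound_budget _) => z; apply: leq_addr.
Qed.

Definition ipos (z : int) : nat := if z is Posz n then n else 0.
Definition ineg (z : int) : nat := if z is Negz n then n.+1 else 0.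
#[export] Instance enc_int : Enc int := fun z => enc (ipos z, ineg z).

Lemma intE (z : int) : z = (Posz (ipos z) - Posz (ineg z))%R.
Proof. by case: z => n /=; lia. Qed.

Section Integers.
Context {G : Type} {eG : Enc G} (B : G -> nat).

Lemma eff_ipos (z : G -> int) : Eff B z -> Eff B (fun g => ipos (z g)).
Proof.
move=> h; apply: (eff_fst (f := fun g => (ipos (z g), ineg (z g)))).
exact: eff_recode h.
Qed.

Lemma eff_ineg (z : G -> int) : Eff B z -> Eff B (fun g => ineg (z g)).
Proof.
move=> h; apply: (eff_snd (f := fun g => (ipos (z g), ineg (z g)))).
exact: eff_recode h.
Qed.

Lemma eff_int (p n : G -> nat) (z : G -> int) : (forall g, p g = ipos (z g)) ->
  (forall g, n g = ineg (z g)) -> Eff B p -> Eff B n -> Eff B z.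
Proof.
move=> ep en hp hn; apply: (eff_recode (f := fun g => (p g, n g))); last exact: eff_pair.
by move=> g; rewrite ep en.
Qed.

Lemma eff_oppz (z : G -> int) : Eff B z -> Eff B (fun g => - z g)%R.
Proof.
move=> h; apply: (eff_int (p := fun g => ineg (z g)) (n := fun g => ipos (z g))).
- by move=> g; case: (z g) => [[|n]|n].
- by move=> g; case: (z g) => [[|n]|n].
- exact: eff_ineg.
- exact: eff_ipos.
Qed.

(** Truncated subtraction in both directions restores the normal form in which the positive or the
    negative part vanishes. *)
Lemma eff_addz (x y : G -> int) : Eff B x -> Eff B y -> Eff B (fun g => x g + y g)%R.
Proof.
move=> h h'.
have hp : Eff B (fun g => ipos (x g) + ipos (y g)) by apply: eff_addn; apply: eff_ipos.
have hn : Eff B (fun g => ineg (x g) + ineg (y g)) by apply: eff_addn; apply: eff_ineg.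
apply: (eff_int _ _ (eff_subn hp hn) (eff_subn hn hp)) => g; have := intE (x g + y g)%R;
  rewrite {1}[x g]intE {1}[y g]intE; case: (x g + y g)%R => n /=; lia.
Qed.

Lemma eff_mulz (x y : G -> int) : Eff B x -> Eff B y -> Eff B (fun g => x g * y g)%R.
Proof.
move=> h h'.
have hp : Eff B (fun g => ipos (x g) * ipos (y g) + ineg (x g) * ineg (y g)).
  by apply: eff_addn; apply: eff_muln; try exact: eff_ipos; apply: eff_ineg.
have hn : Eff B (fun g => ipos (x g) * ineg (y g) + ineg (x g) * ipos (y g)).
  by apply: eff_addn; apply: eff_muln; try exact: eff_ipos; apply: eff_ineg.
apply: (eff_int _ _ (eff_subn hp hn) (eff_subn hn hp)) => g; have := intE (x g * y g)%R;
  rewrite {1}[x g]intE {1}[y g]intE; case: (x g * y g)%R => n /=; nia.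
Qed.

Lemma eff_lez (x y : G -> int) : Eff B x -> Eff B y -> Eff B (fun g => x g <= y g)%R.
Proof.
move=> h h'; apply: (eff_ext (f := fun g => ipos (x g) + ineg (y g) <= ipos (y g) + ineg (x g))).
  by move=> g; rewrite {3}[x g]intE {3}[y g]intE; lia.
by apply: eff_leq; apply: eff_addn; try exact: eff_ipos; apply: eff_ineg.
Qed.

Lemma eff_absz (x : G -> int) : Eff B x -> Eff B (fun g => `|x g|%N).
Proof.
move=> h; apply: (eff_ext (f := fun g => ipos (x g) + ineg (x g))).
  by move=> g; case: (x g) => n /=; lia.
by apply: eff_addn; [exact: eff_ipos | exact: eff_ineg].
Qed.

Lemma eff_posz (n : G -> nat) : Eff B n -> Eff B (fun g => Posz (n g)).
Proof.
move=> h; apply: (eff_int (p := n) (n := fun=> 0)) => //.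
by apply: eff_const; exact: eff_ctx h.
Qed.

End Integers.

(** * Equality tests on encoded data *)

Fixpoint eqtree (x y : tree) : bool :=
  match x, y with
  | Leaf, Leaf => true
  | Node a b, Node c d => eqtree a c && eqtree b d
  | _, _ => false
  end.

Lemma eqtreeP x y : reflect (x = y) (eqtree x y).
Proof.
elim: x y => [|a IHa b IHb] [|c d] /=; try by constructor.
apply: (iffP andP) => [[/IHa -> /IHb ->] // | [<- <-]].
by split; [apply/IHa | apply/IHb].
Qed.

(* A state lists the pairs of trees that remain to be compared. *)
Definition eqtree_step (t : tree) : tree :=
  let p := hd (hd t) in
  if truthy (hd p) then
    if truthy (tl p) then
      Node (Node (Node (hd (hd p)) (hd (tl p)))
        (Node (Node (tl (hd p)) (tl (tl p))) (tl (hd t)))) (tl t)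
    else Leaf
  else if truthy (tl p) then Leaf else Node (tl (hd t)) (tl t).

Lemma eff_eqtree_step : Eff wt eqtree_step.
Proof.
have h0 : Eff wt (fun t : tree => t) by apply: eff_id; exact: pbound_budget.
have hh (f : tree -> tree) : Eff wt f -> Eff wt (fun t => hd (f t)) by exact: eff_app eff_hd.
have ht (f : tree -> tree) : Eff wt f -> Eff wt (fun t => tl (f t)) by exact: eff_app eff_tl.
have hn (f g : tree -> tree) : Eff wt f -> Eff wt g -> Eff wt (fun t => Node (f t) (g t)).
  exact: eff_node.
have p1 := hh _ (hh _ (hh _ h0)); have p2 := ht _ (hh _ (hh _ h0)).
have c0 : Eff wt (fun t : tree => Leaf) by apply: eff_const; exact: pbound_budget.
apply: eff_if; first exact: eff_truthy.
  apply: eff_if; [exact: eff_truthy | | exact: c0].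
  by repeat first [exact h0 | apply: eff_node | apply hh | apply ht].
apply: eff_if; [exact: eff_truthy | exact: c0 |].
by repeat first [exact h0 | apply: eff_node | apply hh | apply ht].
Qed.

Fixpoint pairs_tree (s : seq (tree * tree)) : tree :=
  if s is (x, y) :: s' then Node (Node x y) (pairs_tree s') else Leaf.

Fixpoint pairs_weight (s : seq (tree * tree)) : nat :=
  if s is (x, y) :: s' then weight x + weight y + pairs_weight s' else 0.

(** The loop works on a list of pairs. Splitting a pair of nodes lowers [pairs_weight] and leaves
    the weight of the encoded list unchanged, so both the number of rounds and the cost of a round
    are under control. *)
Lemma eff_eqtree G {eG : Enc G} (B : G -> nat) (x y : G -> tree) :
  Eff B x -> Eff B y -> Eff B (fun g => eqtree (x g) (y g)).
Proof.
move=> hx hy; have [p [K [k hK] hp]] := eff_eqtree_step; have hc := eff_ctx hx.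
(* The state in which the loop ends: an exhausted list next to a marker on success, and [Leaf] on
   failure. The head of either is [Leaf], which stops the loop. *)
pose F (s : seq (tree * tree)) := if all (fun z => eqtree z.1 z.2) s then Node Leaf (Node Leaf Leaf) else Leaf.
have loop n m s : pairs_weight s <= n -> weight (pairs_tree s) <= m ->
  evals (While p) (Node (pairs_tree s) (Node Leaf Leaf)) (F s) (n.+1 * ((m + 10) ^ k + m + 10)).
  elim: n s => [|n IH] [|[u v] s] /=; try by have := weight_gt0 u; lia.
  - by move=> _ _; apply: evals_le (evals_stop _ _) => //=; nia.
  - by move=> _ _; apply: evals_le (evals_stop _ _) => //=; nia.
  move=> hn hm; have hs := hp (Node (Node (Node u v) (pairs_tree s)) (Node Leaf Leaf)).
  have hs' : K (Node (Node (Node u v) (pairs_tree s)) (Node Leaf Leaf)) <= (m + 10) ^ k.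
    by apply: leq_trans (hK _) _; case: k {hK IH} => // k; rewrite leq_exp2r // /wt /enc /enc_tree /=; lia.
  have {hs} hs := evals_le hs' hs.
  have go s' : eqtree_step (Node (Node (Node u v) (pairs_tree s)) (Node Leaf Leaf)) =
       Node (pairs_tree s') (Node Leaf Leaf) ->
     pairs_weight s' <= n -> weight (pairs_tree s') <= m -> F s' = F ((u, v) :: s) ->
     evals (While p) (Node (Node (Node u v) (pairs_tree s)) (Node Leaf Leaf)) (F ((u, v) :: s))
      (n.+2 * ((m + 10) ^ k + m + 10)).
    move=> e h1 h2 h3; rewrite /enc /enc_tree e in hs.
    apply: evals_le (evals_go _ hs (_ : evals _ _ _ (n.+1 * ((m + 10) ^ k + m + 10)))) => //=.
      by rewrite [X in _ <= X]mulSn; move: (_.+1 * _) => U; lia.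
    by rewrite -h3; apply: IH.
  have stop : eqtree_step (Node (Node (Node u v) (pairs_tree s)) (Node Leaf Leaf)) = Leaf ->
     F ((u, v) :: s) = Leaf ->
     evals (While p) (Node (Node (Node u v) (pairs_tree s)) (Node Leaf Leaf)) (F ((u, v) :: s))
      (n.+2 * ((m + 10) ^ k + m + 10)).
    move=> e ->; rewrite /enc /enc_tree e in hs.
    apply: evals_le (evals_go _ hs (evals_stop _ _)) => //=.
    by rewrite 2!mulSn; move: (_ * _) => U; lia.
  case: u v hn hm hs hs' go stop => [|a b] [|c d] /= hn hm hs hs' go stop.
  - by apply: (go s) => //; lia.
  - exact: stop.
  - exact: stop.
  - apply: (go [:: (a, c), (b, d) & s]) => //=; try by lia.
    by rewrite /F /= andbA.
have start : Eff B (fun g => Node (Node (Node (x g) (y g)) Leaf) (Node Leaf Leaf)).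
  by do !apply: eff_node => //; apply: eff_tree.
have hw := eff_weight hx; have hw' := eff_weight hy.
case: start => q [L hL hq].
have loop' : Eff B (fun g => F [:: (x g, y g)]).
  exists (Comp (While p) q), (fun g => L g + (wt (x g) + wt (y g)).+1 * ((wt (x g) + wt (y g) + 3 + 10) ^ k
      + (wt (x g) + wt (y g) + 3) + 10)).
    have h1 := pbound_add (pbound_add hw hw') (pbound_const B 3).
    have h2 := pbound_add h1 (pbound_const B 10).
    apply: pbound_add hL _; apply: pbound_mul.
      by apply: pbound_le h1 => g; lia.
    by apply: pbound_add _ (pbound_const B 10); apply: pbound_add h1; apply: pbound_exp.
  move=> g; apply: evals_comp (hq g) _.
  by apply: (loop _ _ [:: (x g, y g)]); rewrite /wt /enc /enc_tree /=; lia.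
apply: (eff_ext (f := fun g => truthy (F [:: (x g, y g)]))); last exact: eff_truthy.
by move=> g; rewrite /F /= andbT; case: eqtree.
Qed.

Class EncInj (T : eqType) {eT : Enc T} : Prop := enc_inj : injective (@enc T eT).
Arguments EncInj T {eT}.

#[export] Instance encinj_unit : EncInj unit := fun x y _ => match x, y with tt, tt => erefl end.

#[export] Instance encinj_seq (A : eqType) {eA : Enc A} {iA : EncInj A} : EncInj (seq A).
Proof. by elim=> [|x s IH] [|y t] //= [/iA -> /IH ->]. Qed.

#[export] Instance encinj_prod (A B : eqType) {eA : Enc A} {eB : Enc B}
  {iA : EncInj A} {iB : EncInj B} : EncInj (A * B)%type.
Proof. by case=> [a b] [c d] [/iA -> /iB ->]. Qed.

#[export] Instance encinj_nat : EncInj nat.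
Proof.
move=> m n /(@encinj_seq unit _ encinj_unit (nseq m tt) (nseq n tt)) h.
by rewrite -(size_nseq m tt) h size_nseq.
Qed.

#[export] Instance encinj_int : EncInj int.
Proof.
move=> m n /(@encinj_prod nat nat _ _ encinj_nat encinj_nat (_, _) (_, _)) [h1 h2].
by rewrite [m]intE [n]intE h1 h2.
Qed.

Section Search.
Context {G : Type} {eG : Enc G} (B : G -> nat).

Lemma eff_eqop (T : eqType) {eT : Enc T} {iT : EncInj T} (x y : G -> T) :
  Eff B x -> Eff B y -> Eff B (fun g => x g == y g).
Proof.
move=> hx hy; apply: (eff_ext (f := fun g => eqtree (enc (x g)) (enc (y g)))).
  by move=> g; apply/eqtreeP/eqP => [/iT|->].
by apply: eff_eqtree; [exact: eff_recode hx | exact: eff_recode hy].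
Qed.

End Search.

Section Membership.
Context {G : Type} {eG : Enc G} (B : G -> nat).

Lemma eff_mem (T : eqType) {eT : Enc T} {iT : EncInj T} (x : G -> T) (l : G -> seq T) :
  Eff B x -> Eff B l -> Eff B (fun g => x g \in l g).
Proof.
move=> hx hl; have hc := eff_ctx hx.
apply: (eff_ext (f := fun g => has (fun y => x g == y) (l g))).
  by move=> g; rewrite -has_pred1; apply: eq_has => y /=; rewrite eq_sym.
apply: (eff_has (f := fun g y => x g == y)) => //; apply: eff_eqop; first exact: eff_lift.
by apply: eff_snd; apply: eff_id_ext.
Qed.

Lemma eff_nth T {eT : Enc T} (x0 : T) (l : G -> seq T) (i : G -> nat) :
  Eff B l -> Eff B i -> Eff B (fun g => nth x0 (l g) (i g)).
Proof.
move=> hl hi; have hc := eff_ctx hl.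
have dE (s : seq T) n : iter n behead s = drop n s.
  by elim: n s => [|n IH] [|x s] //; rewrite iterSr /= IH.
apply: (eff_ext (f := fun g => head x0 (iter (i g) behead (l g)))).
  by move=> g; rewrite dE -nth0 nth_drop addn0.
apply: eff_head; apply: (eff_iter (f := fun _ => behead) (K := fun g => wt (l g))) => //.
- by apply: eff_behead; apply: eff_snd; apply: eff_id_ext.
- exact: eff_weight.
by move=> g j _; rewrite dE wt_drop.
Qed.

End Membership.

(** * Cartesian products and sublists *)

Fixpoint prodl X (ls : seq (seq X)) : seq (seq X) :=
  if ls is l :: ls' then flatten [seq [seq x :: s | s <- prodl ls'] | x <- l] else [:: [::]].

Lemma size_prodl X (ls : seq (seq X)) : size (prodl ls) = \prod_(l <- ls) size l.
Proof.
elim: ls => [|l ls IH]; first by rewrite big_nil.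
rewrite big_cons -IH /=; elim: l => //= x l IHl.
by rewrite size_cat size_map IHl mulSn.
Qed.

Lemma mem_prodl (X : eqType) (ls : seq (seq X)) s :
  (s \in prodl ls) = all2 (fun x (l : seq X) => x \in l) s ls.
Proof.
elim: ls s => [|l ls IH] [|y s] //=.
  by apply/negbTE/flatten_mapP => -[x _ /mapP [s _]].
apply/flatten_mapP/andP => [[x hx /mapP [t ht [-> ->]]] | [hy hs]].
  by rewrite -IH.
by exists y => //; apply/mapP; exists s => //; rewrite IH.
Qed.

Lemma all_flatten T (a : pred T) (ss : seq (seq T)) : all a (flatten ss) = all (all a) ss.
Proof. by elim: ss => //= s ss IH; rewrite all_cat IH. Qed.

Lemma wt_all_le X {eX : Enc X} (l : seq X) m : wt l <= m -> all (fun x => wt x <= m) l.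
Proof.
elim: l => //= x l IH; rewrite wt_cons => h; apply/andP; split; first by lia.
by apply: IH; lia.
Qed.

Lemma wt_all X {eX : Enc X} (l : seq X) : all (fun x => wt x <= wt l) l.
Proof. exact: wt_all_le. Qed.

Lemma wt_size_all X {eX : Enc X} (l : seq X) m :
  all (fun x => wt x <= m) l -> wt l <= size l * m.+1 + 1.
Proof.
elim: l => [|x l IH]; first by rewrite wt_nil addn1.
by rewrite [all _ _]/= [size _]/= wt_cons => /andP [h /IH]; lia.
Qed.

Lemma wt_prodl X {eX : Enc X} (ls : seq (seq X)) :
  wt (prodl ls) <= size (prodl ls) * (wt ls).+1 + 1.
Proof.
apply: wt_size_all; elim: ls => //= l ls IH.
rewrite all_flatten all_map; apply: sub_all (wt_all l) => x hx /=.
rewrite all_map; apply: sub_all IH => s hs /=.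
by rewrite !wt_cons; lia.
Qed.

(** The successors matter when a list is empty: the whole product is then 0, while the partial
    products met during the computation need not be. *)
Lemma prod_succ_suffix X (ls s t : seq (seq X)) : ls = s ++ t ->
  \prod_(l <- t) size l <= \prod_(l <- ls) (size l).+1.
Proof.
move=> ->; rewrite big_cat /=.
have h1 : 0 < \prod_(l <- s) (size l).+1 by apply: prodn_gt0.
have h2 : \prod_(l <- t) size l <= \prod_(l <- t) (size l).+1.
  by elim: t => [|x t IH]; rewrite ?big_nil // !big_cons leq_mul.
by nia.
Qed.

Lemma eff_prodl G {eG : Enc G} (B : G -> nat) X {eX : Enc X} (l : G -> seq (seq X)) :
  Eff B l -> pbound B (fun g => \prod_(s <- l g) (size s).+1) -> Eff B (fun g => prodl (l g)).
Proof.
move=> hl hb; have hc := eff_ctx hl.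
pose st (m : seq X) (acc : seq (seq X)) := flatten [seq [seq x :: s | s <- acc] | x <- m].
apply: (eff_ext (f := fun g => foldr st [:: [::]] (l g))).
  by move=> g; elim: (l g) => //= x s ->.
apply: (eff_foldr (step := fun _ => st)
  (K := fun g => (\prod_(s <- l g) (size s).+1) * (wt (l g) + 1) + 1)) => //.
- exact: eff_const.
- pose proof (eff_id_ext (X := seq X * seq (seq X)) hc) as hz; apply: eff_flatten.
  apply: (eff_map (f := fun z x => [seq x :: s | s <- z.2.2])); first by apply: eff_fst; apply: eff_snd.
  pose proof (eff_id_ext (X := X) (eff_ctx hz)) as hz2.
  apply: (eff_map (f := fun z s => z.2 :: s)).
    by apply: eff_snd; apply: eff_snd; apply: eff_fst.
  pose proof (eff_id_ext (X := seq X) (eff_ctx hz2)) as hz3.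
  by apply: eff_cons; [apply: eff_snd; apply: eff_fst | apply: eff_snd].
- apply: pbound_add (pbound_const _ 1); apply: pbound_mul hb _.
  exact: pbound_add (eff_weight hl) (pbound_const _ 1).
move=> g s t e; rewrite (_ : foldr _ _ t = prodl t); last by elim: (t) => //= x r ->.
apply: leq_trans (wt_prodl t) _; rewrite leq_add2r leq_mul //.
  by rewrite size_prodl; apply: prod_succ_suffix e.
pose proof (wt_cat s t) as h; pose proof (wt_gt0 s); rewrite e; move: h; lia.
Qed.

Fixpoint sublists X (l : seq X) : seq (seq X) :=
  if l is x :: l' then [seq x :: s | s <- sublists l'] ++ sublists l' else [:: [::]].

Lemma size_sublists X (l : seq X) : size (sublists l) = 2 ^ size l.
Proof. by elim: l => //= x l IH; rewrite size_cat size_map IH expnS mul2n addnn. Qed.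

Lemma filter_sublists (X : eqType) (l : seq X) (p : pred X) : filter p l \in sublists l.
Proof.
elim: l => //= x l IH; rewrite mem_cat; case: (p x); last by rewrite IH orbT.
by apply/orP; left; apply/mapP; exists (filter p l).
Qed.

Lemma wt_sublists X {eX : Enc X} (l : seq X) :
  wt (sublists l) <= 2 ^ size l * (wt l).+1 + 1.
Proof.
rewrite -size_sublists; apply: wt_size_all; elim: l => //= x l IH.
rewrite all_cat all_map; apply/andP; split; apply: sub_all IH => s hs /=;
  by rewrite !wt_cons; lia.
Qed.

Lemma eff_sublists G {eG : Enc G} (B : G -> nat) X {eX : Enc X} (l : G -> seq X) :
  Eff B l -> pbound B (fun g => 2 ^ size (l g)) -> Eff B (fun g => sublists (l g)).
Proof.
move=> hl hb; have hc := eff_ctx hl.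
pose st (x : X) acc := [seq x :: s | s <- acc] ++ acc.
apply: (eff_ext (f := fun g => foldr st [:: [::]] (l g))).
  by move=> g; elim: (l g) => //= x s ->.
apply: (eff_foldr (step := fun _ => st)
  (K := fun g => 2 ^ size (l g) * (wt (l g) + 1) + 1)) => //.
- exact: eff_const.
- pose proof (eff_id_ext (X := X * seq (seq X)) hc) as hz.
  apply: eff_cat; last by apply: eff_snd; apply: eff_snd.
  apply: (eff_map (f := fun z s => z.2.1 :: s)); first by apply: eff_snd; apply: eff_snd.
  pose proof (eff_id_ext (X := seq X) (eff_ctx hz)) as hz2.
  by apply: eff_cons; [apply: eff_fst; apply: eff_snd; apply: eff_fst | apply: eff_snd].
- apply: pbound_add (pbound_const _ 1); apply: pbound_mul hb _.
  exact: pbound_add (eff_weight hl) (pbound_const _ 1).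
move=> g s t e; rewrite (_ : foldr _ _ t = sublists t); last by elim: (t) => //= x r ->.
apply: leq_trans (wt_sublists t) _; rewrite leq_add2r leq_mul //.
  by rewrite leq_exp2l // e size_cat leq_addl.
pose proof (wt_cat s t) as h; pose proof (wt_gt0 s); rewrite e; move: h; lia.
Qed.

(** * From efficient functions to decision machines *)

Definition absorb : cmd :=
  Loop Aux isSome (Case Aux noop
    (Seq (Pop Aux) (Seq (Push Main false) (Push Main true)))
    (Seq (Pop Aux) (Seq (Seq (Push Main false) (Push Main false))
      (Seq (Push Main true) (Push Main true))))).

Definition reader : cmd := Seq (pour Inp Aux) (Seq (Push Main false) absorb).

(** A list is built from its end: the bits come in reverse order, and each one pushes its own code
    and then the [true] of the node that prepends it. *)
Lemma execs_absorb (s x : seq bool) m :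
  execs absorb (Store [::] (code (enc x) ++ m) s [::] [::])
    (St [::] (code (enc (catrev s x)) ++ m)) (11 * size s + 1).
Proof.
elim: s x => [|b s IH] x; first by apply: execs_stop.
apply: (execs_le (M := (10 + (11 * size s + 1)).+1)); first by rewrite /=; lia.
apply: (execs_go _ _ (IH (b :: x))) => //.
apply: (@execs_case Aux) => /=; case: b.
  apply: (execs_le (M := 1 + ((2 + 2) + (2 + 2)))) => //.
  apply: execs_seq (execs_pop _ _) _ => /=.
  apply: execs_seq; apply: execs_seq; exact: execs_push.
apply: (execs_le (M := 1 + (2 + 2))) => //.
apply: execs_seq (execs_pop _ _) _ => /=.
by apply: execs_seq; exact: execs_push.
Qed.

Lemma execs_reader (w : seq bool) :
  execs reader (Store w [::] [::] [::] [::]) (St [::] (code (enc w))) (30 * size w + 30).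
Proof.
have h1 := @execs_pour Inp Aux (Store w [::] [::] [::] [::]) isT.
have h2 := execs_push Main false (Store [::] [::] (catrev w [::]) [::] [::]).
have := execs_absorb (catrev w [::]) [::] [::].
rewrite [catrev (catrev _ _) _]catrevE !catrevE !cats0 revK => h3.
rewrite /= !catrevE !cats0 in h1 h2.
by apply: execs_le (execs_seq h1 (execs_seq h2 h3)); rewrite size_rev; lia.
Qed.

Theorem decider_of_eff (G : Type) (w : G -> seq bool) (B : G -> nat) (f : G -> bool) :
  @Eff G (fun g => enc (w g)) bool _ B f ->
  exists M : machine, exists2 K, pbound B K &
    forall g (P : Prop), (f g <-> P) -> exists2 t, t <= K g & decides_in M (w g) P t.
Proof.
move=> h; have hc := @eff_ctx _ _ _ _ _ _ h; case: h => p [K hK hp].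
exists (decider (Seq reader (compile p))).
exists (fun g => 30 * @wt _ (fun g => enc (w g)) g + 200 * K g + 31).
  apply: pbound_add _ (pbound_const _ 31).
  exact: pbound_add (pbound_mul (pbound_const _ 30) hc) (pbound_mul (pbound_const _ 200) hK).
move=> g P hP; have [n h1 h2] := hp g.
have hc' := compile_correct h1 [::] [::]; rewrite !cats0 in hc'.
have [m h3 h4] := execs_seq (execs_reader (w g)) hc'.
exists m.+1; last first.
  apply: (decider_correct h3 _ hP).
  by case: (f g).
have : size (w g) <= @wt _ (fun g => enc (w g)) g.
  by pose proof (size_wt (w g)) as hw; apply: leq_trans hw; lia.
by move: h4; move: (@wt _ _ g) => x; lia.
Qed.

Lemma eff_succn G {eG : Enc G} (B : G -> nat) (n : G -> nat) :
  Eff B n -> Eff B (fun g => (n g).+1).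
Proof.
move=> h; apply: (eff_ext (f := fun g => n g + 1)) => [g|]; first exact: addn1.
by apply: (eff_addn h); apply: eff_const; exact: eff_ctx h.
Qed.

Ltac eff_leaf :=
  match goal with
  | h : Eff _ _ |- _ => first
      [ exact h | exact (eff_lift h) | exact (eff_lift (eff_lift h))
      | exact (eff_lift (eff_lift (eff_lift h)))
      | exact (eff_lift (eff_lift (eff_lift (eff_lift h)))) ]
  end.

Ltac eff_pbound :=
  first [ eassumption
        | apply: pbound_ext; eff_pbound
        | match goal with h : Eff _ _ |- _ => exact (eff_ctx h) end
        | exact: pbound_budget ].

(** Directed by the head symbol of the function body; a goal of any other shape is taken to be a
    conditional. *)
Ltac eff1 :=
  cbv beta;
  lazymatch goal with
  | |- Eff _ (fun g => g) => apply: eff_id; eff_pbound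
  | |- Eff _ id => apply: eff_id; eff_pbound
  | |- Eff _ fst => apply: (eff_fst (f := fun z => z))
  | |- Eff _ snd => apply: (eff_snd (f := fun z => z))
  | |- Eff _ (fun=> ?x) => apply: eff_const; eff_pbound
  | |- Eff _ (fun g => fst (@?f g)) => first [eff_leaf | apply: eff_fst]
  | |- Eff _ (fun g => snd (@?f g)) => first [eff_leaf | apply: eff_snd]
  | |- Eff _ (fun g => (@?f g, @?h g)) => apply: eff_pair
  | |- Eff _ (fun g => @?f g :: @?h g) => apply: eff_cons
  | |- Eff _ (fun g => negb (@?b g)) => apply: eff_negb
  | |- Eff _ (fun g => andb (@?b g) (@?c g)) => apply: eff_andb
  | |- Eff _ (fun g => orb (@?b g) (@?c g)) => apply: eff_orb
  | |- Eff _ (fun g => cat (@?b g) (@?c g)) => apply: eff_cat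
  | |- Eff _ (fun g => behead (@?b g)) => apply: eff_behead
  | |- Eff _ (fun g => head ?x0 (@?b g)) => apply: eff_head
  | |- Eff _ (fun g => rev (@?b g)) => apply: eff_rev
  | |- Eff _ (fun g => flatten (@?b g)) => apply: eff_flatten
  | |- Eff _ (fun g => nilp (@?b g)) => apply: eff_nilp
  | |- Eff _ (fun g => size (@?b g)) => apply: eff_size
  | |- Eff _ (fun g => map (@?f g) (@?l g)) => apply: (eff_map (f := f) (l := l))
  | |- Eff _ (fun g => filter (@?f g) (@?l g)) => apply: (eff_filter (f := f) (l := l))
  | |- Eff _ (fun g => has (@?f g) (@?l g)) => apply: (eff_has (f := f) (l := l))
  | |- Eff _ (fun g => all (@?f g) (@?l g)) => apply: (eff_all (f := f) (l := l))
  | |- Eff _ (fun g => nth ?x0 (@?l g) (@?i g)) => apply: eff_nth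
  | |- Eff _ (fun g => S (@?n g)) => apply: eff_succn
  | |- Eff _ (fun g => addn (@?m g) (@?n g)) => apply: eff_addn
  | |- Eff _ (fun g => muln (@?m g) (@?n g)) => apply: eff_muln
  | |- Eff _ (fun g => subn (@?m g) (@?n g)) => apply: eff_subn
  | |- Eff _ (fun g => leq (@?m g) (@?n g)) => apply: eff_leq
  | |- Eff _ (fun g => GRing.add (@?m g) (@?n g)) => apply: eff_addz
  | |- Eff _ (fun g => GRing.mul (@?m g) (@?n g)) => apply: eff_mulz
  | |- Eff _ (fun g => GRing.opp (@?m g)) => apply: eff_oppz
  | |- Eff _ (fun g => Order.le (@?m g) (@?n g)) => apply: eff_lez
  | |- Eff _ (fun g => absz (@?m g)) => apply: eff_absz
  | |- Eff _ (fun g => Posz (@?m g)) => apply: eff_posz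
  | |- Eff _ (fun g => eq_op (@?m g) (@?n g)) => apply: eff_eqop
  | |- Eff _ (fun g => in_mem (@?x g) (mem (@?l g))) => apply: eff_mem
  | |- Eff _ _ => apply: eff_if
  end.

Ltac eff := repeat first [eff_leaf | eff1].

(** * Automata and their determinization *)

(* One digit for each variable, the innermost block first. *)
Definition block_letter : Type := seq (seq int).

(* ((states, initial states), (transitions, final states)) *)
Definition nfa (Q : Type) : Type :=
  ((seq Q * seq Q) * (seq (Q * (block_letter * Q)) * seq Q))%type.

Definition states Q (A : nfa Q) : seq Q := A.1.1.
Definition initial Q (A : nfa Q) : seq Q := A.1.2.
Definition trans Q (A : nfa Q) : seq (Q * (block_letter * Q)) := A.2.1.
Definition final Q (A : nfa Q) : seq Q := A.2.2.

Section Automata.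
Variable Q : eqType.
Implicit Types (A : nfa Q) (p q : Q) (U : seq Q) (w : seq block_letter).

Fixpoint steps A p w q : Prop :=
  if w is a :: w' then exists2 p', (p, (a, p')) \in trans A & steps A p' w' q else p = q.

Definition accepts A w : Prop :=
  exists p q, [/\ p \in initial A, q \in final A & steps A p w q].

Lemma steps_cat A p w1 w2 q :
  steps A p (w1 ++ w2) q <-> exists2 p', steps A p w1 p' & steps A p' w2 q.
Proof.
elim: w1 p => [|a w1 IH] p /=.
  by split=> [h|[p' -> ]] //; exists p.
split=> [[p' h /IH [p'' h1 h2]]|[p'' [p' h h1] h2]].
  by exists p'' => //; exists p'.
by exists p' => //; apply/IH; exists p''.
Qed.

Definition well_formed A (al : seq block_letter) : Prop :=
  [/\ {subset initial A <= states A}, {subset final A <= states A} &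
      forall p a q, (p, (a, q)) \in trans A -> [/\ p \in states A, a \in al & q \in states A]].

Definition is_zero (a : block_letter) : bool := all (all (eq_op^~ (0 : int))) a.

(** One step along letters that vanish on all blocks but the innermost; the digits of the block to
    be projected away are free. *)
Definition grow A U : seq Q :=
  [seq q <- states A | (q \in U) ||
    has (fun e => [&& e.1 \in U, is_zero (behead e.2.1) & e.2.2 == q]) (trans A)].

(** At least one round is made even if there are no states, so that the result is a filter of
    [states A] and hence one of its sublists. *)
Definition clos A : seq Q := iter (size (states A)).+1 (grow A) (initial A).

Lemma filter_size_eq (T : eqType) (s : seq T) (a b : pred T) :
  subpred a b -> size (filter b s) <= size (filter a s) -> filter b s = filter a s.
Proof.
move=> ab; rewrite !size_filter => h.
have {}h : count a s = count b s.
  by apply/eqP; rewrite eqn_leq h andbT; apply: sub_count.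
elim: s h => //= x s IH; have le := sub_count ab s.
case: (boolP (a x)) => [/ab -> /=|na]; first by move=> [/IH ->].
by case: (b x) => /=; [lia | move=> /IH ->].
Qed.

Lemma grow_sub A U q : U = filter (mem U) (states A) \/ {subset U <= states A} ->
  q \in U -> q \in grow A U.
Proof.
move=> h qU; rewrite mem_filter qU /=.
by case: h => [e|]; [move: qU; rewrite e mem_filter => /andP [] | apply].
Qed.

(** Reachability by saturation: the rounds form an increasing chain inside [states A], and each of
    them gains a state until the chain becomes stationary. *)
Lemma mem_clos A al q : well_formed A al ->
  q \in clos A <-> exists p w, [/\ p \in initial A, all is_zero (map behead w) & steps A p w q].
Proof.
move=> [iS _ tS]; set I := initial A; pose U k := iter k (grow A) I.
have US k : {subset U k <= states A}.
  by case: k => [|k] x; [exact: iS | rewrite /U /= mem_filter => /andP []].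
have mono k : {subset U k <= U k.+1}.
  by move=> x xU; apply: (grow_sub _ xU); right; exact: US.
have grow_ext V W : V =i W -> grow A V = grow A W.
  by move=> e; apply: eq_filter => x; rewrite e; congr (_ || _); apply: eq_has => y; rewrite e.
have stab : exists2 k, k <= size (states A) & U k.+1 =i U k.
  have : forall n, (exists2 k, k < n & U k.+1 =i U k) \/ n <= count (mem (U n)) (states A).
    elim=> [|n [[k lk hk]|IH]]; [by right | by left; exists k => //; lia |].
    case: (leqP n.+1 (count (mem (U n.+1)) (states A))) => [?|lt]; [by right | left].
    exists n => // x; apply/idP/idP; last exact: mono.
    have e := @filter_size_eq _ (states A) (mem (U n)) (mem (U n.+1)) (@mono n).
    rewrite !size_filter in e; have {}e := e (leq_trans (ltnSE lt) IH).
    move=> xU; have : x \in filter (mem (U n.+1)) (states A).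
      by rewrite mem_filter; apply/andP; split=> //; exact: US xU.
    by rewrite e mem_filter => /andP [].
  move=> /(_ (size (states A)).+1) [[k lk hk]|]; first by exists k.
  by move=> h; have := count_size (mem (U (size (states A)).+1)) (states A); lia.
have [k lk hk] := stab.
have stab' m : U (m + k) =i U k.
  by elim: m => // m IH x; rewrite addSn {1}/U /= (grow_ext _ _ IH) -[grow _ _]/(U k.+1) hk.
have Uc : clos A =i U k.
  by move=> x; rewrite -(stab' ((size (states A)).+1 - k)) subnK // leqW.
rewrite Uc; split.
  elim: (k) q => [|j IH] q; first by move=> qI; exists q, [::]; split.
  rewrite /U /= mem_filter => /andP [/orP [/IH //|/hasP [[p [a q']] ht /and3P /= [/IH [p0 [w [h1 h2 h3]]] hz /eqP e]]] _].
  exists p0, (rcons w a); split=> //; first by rewrite map_rcons all_rcons hz.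
  by rewrite -cats1; apply/steps_cat; exists p => //=; exists q; rewrite -?e.
move=> [p [w [pI]]]; have : p \in U k.
  by suff: {subset I <= U k}; [apply | elim: (k) => // j IH x /IH /mono].
elim: w p {pI} => [|a w IH] p pU /=; first by move=> _ <-.
move=> /andP [hz hw] [p' ht hs]; apply: (IH p') => //.
rewrite -hk /U /= mem_filter; have [_ _ ->] := tS _ _ _ ht; rewrite andbT.
by apply/orP; right; apply/hasP; exists (p, (a, p')) => //=; rewrite pU hz eqxx.
Qed.

Definition dstep A U (a : block_letter) : seq Q :=
  [seq q <- states A |
    has (fun e => [&& e.1 \in U, behead e.2.1 == a & e.2.2 == q]) (trans A)].

(** For every letter of [al] each subset has one and only one successor, so that exchanging final
    and non-final subsets complements the language. *)
Definition det A (al : seq block_letter) : nfa (seq Q) :=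
  ((sublists (states A), [:: clos A]),
   (flatten [seq [seq (U, (a, dstep A U a)) | a <- al] | U <- sublists (states A)],
    [seq U <- sublists (states A) | ~~ has (mem (final A)) U])).

End Automata.

Section Determinization.
Variable Q : eqType.
Implicit Types (A : nfa Q) (p q : Q) (U : seq Q) (w : seq block_letter).

Lemma clos_sublists A : clos A \in sublists (states A).
Proof. exact: filter_sublists. Qed.

Lemma mem_dstep A U a q : (q \in dstep A U a) =
  (q \in states A) && has (fun e => [&& e.1 \in U, behead e.2.1 == a & e.2.2 == q]) (trans A).
Proof. by rewrite mem_filter andbC. Qed.

Lemma det_trans A al U a V : ((U, (a, V)) \in trans (det A al)) =
  [&& U \in sublists (states A), a \in al & V == dstep A U a].
Proof.
apply/flatten_mapP/and3P => [[U' hU /mapP [a' ha [-> -> ->]]] | [hU ha /eqP ->]] //.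
by exists U => //; apply/mapP; exists a.
Qed.

Lemma det_well_formed A al : well_formed (det A al) al.
Proof.
split=> [U|U|U a V].
- by rewrite inE => /eqP ->; exact: clos_sublists.
- by rewrite mem_filter => /andP [].
- by rewrite det_trans => /and3P [-> -> /eqP ->]; split=> //; exact: filter_sublists.
Qed.

Lemma det_steps A al al' U w V : well_formed A al' -> U \in sublists (states A) ->
  all (mem al) w -> steps (det A al) U w V ->
  forall q, q \in V <-> exists p w', [/\ p \in U, map behead w' = w & steps A p w' q].
Proof.
move=> wf; have [_ _ tS] := wf; elim: w U => [|a w IH] U hU /=.
  move=> _ <- q; split=> [qU|[p [w' [pU hw h]]]]; first by exists q, [::]; split.
  by case: w' hw h => //= _ <-.
move=> /andP [ha hw] [U']; rewrite det_trans => /and3P [_ _ /eqP ->] hs q.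
rewrite (IH _ (filter_sublists _ _) hw hs); split=> [[p [w' [pU <- h]]]|].
  move: pU; rewrite mem_dstep => /andP [_ /hasP [[p0 [b p1]] /= ht /and3P [p0U /eqP hb /eqP e]]].
  exists p0, (b :: w'); split=> //=; first by rewrite hb.
  by rewrite e in ht; exists p.
move=> [p [[|b w'] [pU] //= [hb hw'] [p' ht hs']]].
exists p', w'; split=> //; rewrite mem_dstep; have [_ _ -> /=] := tS _ _ _ ht.
by apply/hasP; exists (p, (b, p')) => //=; rewrite pU hb !eqxx.
Qed.

Lemma det_total A al U w : U \in sublists (states A) -> all (mem al) w ->
  exists2 V, V \in sublists (states A) & steps (det A al) U w V.
Proof.
elim: w U => [|a w IH] U hU /=; first by move=> _; exists U.
move=> /andP [ha hw]; have hd : dstep A U a \in sublists (states A) by exact: filter_sublists.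
have [V hV hs] := IH _ hd hw; exists V => //; exists (dstep A U a) => //.
by rewrite det_trans hU ha eqxx.
Qed.

(** The prefix [v] stands for leading positions at which only the projected block has non-zero
    digits; the initial state [clos A] has read all such prefixes in advance. *)
Lemma det_accepts A al al' w : well_formed A al' -> all (mem al) w ->
  accepts (det A al) w <-> 
  ~ exists v w', [/\ all is_zero (map behead v), map behead w' = w & accepts A (v ++ w')].
Proof.
move=> wf hw; have wf' := wf; have [_ _ tS] := wf'.
have [V hV hs] := det_total (clos_sublists A) hw.
have hq := det_steps wf (clos_sublists A) hw hs.
have key : has (mem (final A)) V <->
    exists v w', [/\ all is_zero (map behead v), map behead w' = w & accepts A (v ++ w')].
  split=> [/hasP [q /hq [p [w' [/(mem_clos _ wf) [p0 [v [h1 h2 h3]]] h4 h5]]] qF]|].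
    by exists v, w'; split=> //; exists p0, q; split=> //; apply/steps_cat; exists p.
  move=> [v [w' [h1 h2 [p0 [q [h3 h4 /steps_cat [p h5 h6]]]]]]].
  apply/hasP; exists q => //; apply/hq; exists p, w'; split=> //.
  by apply/(mem_clos _ wf); exists p0, v.
rewrite -key; split=> [[p [q []]]|nV].
  rewrite inE => /eqP -> ; rewrite mem_filter => /andP [/negP nq hq' hs'].
  move=> hV'; apply: nq; have hq2 := det_steps wf (clos_sublists A) hw hs'.
  have /hasP [x xV xF] := hV'; apply/hasP; exists x => //.
  by apply/hq2; apply/hq.
exists (clos A), V; split=> //; first by rewrite inE.
by rewrite mem_filter hV andbT; apply/negP.
Qed.

Lemma clos_accepts A al : well_formed A al ->
  has (mem (final A)) (clos A) <-> exists2 v, all is_zero (map behead v) & accepts A v.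
Proof.
move=> wf; split=> [/hasP [q /(mem_clos _ wf) [p [v [h1 h2 h3]]] qF]|[v h1 [p [q [h2 h3 h4]]]]].
  by exists v => //; exists p, q.
by apply/hasP; exists q => //; apply/(mem_clos _ wf); exists p, v.
Qed.

End Determinization.

(** * A numeration system *)

Fixpoint irange (n : nat) : seq int :=
  if n is m.+1 then [:: Posz n, (- Posz n)%R & irange m] else [:: 0%R].

Lemma mem_irange n z : (z \in irange n) = (`|z|%N <= n).
Proof. by elim: n => [|n IH] /=; rewrite !inE ?IH; lia. Qed.

Lemma size_irange n : size (irange n) = (2 * n).+1.
Proof. by elim: n => //= n ->; lia. Qed.

Lemma all2_nseq_r (X Y : Type) (r : X -> Y -> bool) (s : seq X) n (y : Y) :
  all2 r s (nseq n y) = (size s == n) && all (r^~ y) s.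
Proof. by elim: s n => [|x s IH] [|n] //=; rewrite IH eqSS andbCA. Qed.

Section Values.
Variable t : nat.
Hypothesis t_gt2 : 2 < t.
Local Open Scope ring_scope.

(** The second component is the value without the last digit. By the recurrence of the bases, the
    value after appending a digit depends linearly on these two. *)
Definition dnext (z : int * int) (d : int) : int * int := (Posz t * z.1 - z.2 + d, z.1).

(* Integers are written in the numeration system with bases F_1 = 1, F_2 = t,
   F_(k+1) = t F_k - F_(k-1), most significant digit first. *)
Definition dval (ds : seq int) : int := (foldl dnext (0, 0) ds).1.

Definition base_pair (k : nat) : int * int :=
  iter k (fun z => (z.2, Posz t * z.2 - z.1)) (0, 1).
Definition base_value (k : nat) : int := (base_pair k).1.
Local Notation F := base_value.

Lemma base_valueSS k : F k.+2 = Posz t * F k.+1 - F k.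
Proof. by []. Qed.

Lemma dval_from X Y ds :
  (foldl dnext (X, Y) ds).1 = X * F (size ds).+1 - Y * F (size ds) + dval ds.
Proof.
rewrite /dval; elim: ds X Y => [|d ds IH] X Y.
  by rewrite /= /base_value /=; ring.
rewrite /= IH (IH (Posz t * 0 - 0 + d) 0) base_valueSS; ring.
Qed.

Lemma dval_cons d ds : dval (d :: ds) = d * F (size ds).+1 + dval ds.
Proof. rewrite {1}/dval /= dval_from /=; ring. Qed.

Lemma dval_pad m ds : dval (nseq m 0 ++ ds) = dval ds.
Proof. by elim: m => //= m IH; rewrite dval_cons IH mul0r add0r. Qed.

Lemma dval_opp ds : dval (map -%R ds) = - dval ds.
Proof.
elim: ds => [|d ds IH]; first by rewrite /dval /= oppr0.
by rewrite /= !dval_cons IH size_map; ring.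
Qed.

Lemma base_growth k : 0 <= F k /\ 2 * F k <= F k.+1 /\ 1 <= F k.+1.
Proof.
elim: k => [|k [h0 [h1 h2]]]; first by rewrite /base_value /=; lia.
by split; [lia | split]; rewrite base_valueSS; nia.
Qed.

Lemma base_unbounded k : Posz k < F k.+1.
Proof.
elim: k => [|k IH]; first by rewrite /base_value /=; lia.
by have [_ [h1 _]] := base_growth k.+1; lia.
Qed.

(** Greedy expansion: from x < t F_(k+1) - F_k the quotient of x by F_(k+1) is less than t. *)
Lemma digits_nonneg k x : 0 <= x < F k.+1 ->
  exists2 ds, dval ds = x & size ds = k /\ all (fun d => (`|d|%N <= t)%N) ds.
Proof.
elim: k x => [|k IH] x /andP [h0 h1].
  by exists [::] => //; rewrite /base_value /= in h1; rewrite /dval /=; lia.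
have [g0 [g1 g2]] := base_growth k.
have hd := divz_eq x (F k.+1); have hm := modz_ge0 x (_ : F k.+1 != 0).
have hn := ltz_pmod x (_ : 0 < F k.+1).
have [ds e [e1 e2]] : exists2 ds, dval ds = (x %% F k.+1)%Z &
   size ds = k /\ all (fun d => (`|d|%N <= t)%N) ds.
  by apply: IH; apply/andP; split; [apply: hm | apply: hn]; lia.
exists ((x %/ F k.+1)%Z :: ds); first by rewrite dval_cons e1 e.
rewrite /= e1 e2 andbT; split=> //.
have q0 : 0 <= (x %/ F k.+1)%Z by rewrite divz_ge0 //; lia.
have : (x %/ F k.+1)%Z < Posz t; last by lia.
rewrite ltz_divLR; last by lia.
by rewrite base_valueSS in h1; lia.
Qed.

(** Every sufficiently large length is provided, because all variables of a word have to share one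
    length. Negative numbers take the negated digits. *)
Lemma digits_exist x : exists k, forall m, (k <= m)%N ->
  exists2 ds, dval ds = x & size ds = m /\ all (fun d => (`|d|%N <= t)%N) ds.
Proof.
have pos y : 0 <= y -> exists k, forall m, (k <= m)%N ->
  exists2 ds, dval ds = y & size ds = m /\ all (fun d => (`|d|%N <= t)%N) ds.
  move=> h0; exists `|y|%N => m hm.
  have [|ds e [e1 e2]] := @digits_nonneg `|y|%N y.
    by have := base_unbounded `|y|%N; rewrite h0 /=; lia.
  exists (nseq (m - size ds) 0 ++ ds); first by rewrite dval_pad.
  rewrite size_cat size_nseq all_cat e2 andbT; split; first by lia.
  by apply/allP => d /nseqP [-> _]; lia.
case: (lerP 0 x) => hx; first exact: pos.
have [|k hk] := pos (- x); first by lia.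
exists k => m /hk [ds e [e1 e2]]; exists (map -%R ds).
  by rewrite dval_opp e opprK.
rewrite size_map all_map; split=> //.
by apply: sub_all e2 => d /=; lia.
Qed.

Definition alphabet (ns : seq nat) : seq block_letter :=
  prodl [seq prodl (nseq n (irange t)) | n <- ns].

Definition zeros (ns : seq nat) : block_letter := [seq nseq n 0 | n <- ns].

Lemma mem_block n s : (s \in prodl (nseq n (irange t))) =
  (size s == n) && all (fun d => (`|d|%N <= t)%N) s.
Proof.
rewrite mem_prodl all2_nseq_r; congr (_ && _).
by apply: eq_all => d; rewrite /= mem_irange.
Qed.

Lemma mem_alphabet_cons n ns b a : (b :: a \in alphabet (n :: ns)) =
  [&& size b == n, all (fun d => (`|d|%N <= t)%N) b & a \in alphabet ns].
Proof. by rewrite /alphabet mem_prodl /= mem_block -mem_prodl -andbA. Qed.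

Lemma mem_alphabet_inv n ns a : a \in alphabet (n :: ns) ->
  exists b a', a = b :: a' /\ size b = n.
Proof.
rewrite /alphabet mem_prodl; case: a => //= b a /andP [].
by rewrite mem_block => /andP [/eqP h _] _; exists b, a.
Qed.

Lemma zeros_alphabet ns : zeros ns \in alphabet ns.
Proof.
elim: ns => [|n ns IH] //=; rewrite mem_alphabet_cons size_nseq eqxx IH andbT.
by apply/allP => d /nseqP [-> _]; lia.
Qed.

Lemma is_zero_alphabet ns a : a \in alphabet ns -> is_zero a -> a = zeros ns.
Proof.
elim: ns a => [|n ns IH] a; first by rewrite inE => /eqP ->.
move=> ha; have [b [a' [e hb]]] := mem_alphabet_inv ha; subst a.
move: ha; rewrite mem_alphabet_cons => /and3P [_ _ ha] /= /andP [hz hz'].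
rewrite (IH a') // /zeros /= -hb; congr (_ :: _).
by elim: (b) hz => //= x s IHs /andP [/eqP -> /IHs {1}->].
Qed.

Lemma is_zero_zeros ns : is_zero (zeros ns).
Proof. by apply/allP => s /mapP [n _ ->]; apply/allP => d /nseqP [-> _]. Qed.

Lemma behead_alphabet n ns : map behead (alphabet (n :: ns)) =i alphabet ns.
Proof.
move=> a; apply/mapP/idP => [[b hb ->]|ha].
  have [c [a' [e hc]]] := mem_alphabet_inv hb; subst b.
  by move: hb; rewrite mem_alphabet_cons => /and3P [_ _].
exists (nseq n 0 :: a) => //; rewrite mem_alphabet_cons size_nseq eqxx ha andbT.
by apply/allP => d /nseqP [-> _]; lia.
Qed.

Definition digit (a : block_letter) (b j : nat) : int := nth 0 (nth [::] a b) j.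

Definition column (w : seq block_letter) (b j : nat) : seq int := [seq digit a b j | a <- w].

Definition wval (ns : seq nat) (w : seq block_letter) : seq (seq int) :=
  [seq [seq dval (column w b j) | j <- iota 0 (nth 0%N ns b)] | b <- iota 0 (size ns)].

Lemma wval_cons n ns w :
  wval (n :: ns) w = [seq dval (column w 0 j) | j <- iota 0 n] :: wval ns (map behead w).
Proof.
rewrite /wval /=; congr (_ :: _); rewrite -[1%N]addn0 iotaDl -map_comp.
apply: eq_map => b /=; apply: eq_map => j; rewrite /column -map_comp.
by congr dval; apply: eq_map => a /=; rewrite /digit nth_behead.
Qed.

Lemma digit_zeros ns b j : digit (zeros ns) b j = 0.
Proof.
rewrite /digit /zeros; case: (ltnP b (size ns)) => h.
  by rewrite (nth_map 0%N) // nth_nseq if_same.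
by rewrite [nth [::] _ b]nth_default ?nth_nil // size_map.
Qed.

Lemma column_cat w w' b j : column (w ++ w') b j = column w b j ++ column w' b j.
Proof. exact: map_cat. Qed.

Lemma wval_pad ns m w : wval ns (nseq m (zeros ns) ++ w) = wval ns w.
Proof.
apply: eq_map => b; apply: eq_map => j; rewrite column_cat /column map_nseq digit_zeros.
exact: dval_pad.
Qed.

Lemma zero_word ns v : all (mem (alphabet ns)) v -> all is_zero v -> v = nseq (size v) (zeros ns).
Proof.
elim: v => //= a v IH /andP [h1 h2] /andP [h3 h4].
by rewrite (is_zero_alphabet h1 h3) {1}(IH h2 h4).
Qed.

(** The values of the new block may have more digits than [w], in which case [w] is padded by zero
    letters in front. *)
Lemma extend_word n ns w xs : all (mem (alphabet ns)) w -> size xs = n ->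
  exists m W, [/\ all (mem (alphabet (n :: ns))) W,
    map behead W = nseq m (zeros ns) ++ w & wval (n :: ns) W = xs :: wval ns w].
Proof.
move=> hw hx.
have [M [hM hD]] : exists M, (size w <= M)%N /\ exists D : seq (seq int), size D = size xs /\
   forall j, (j < size xs)%N -> let ds := nth [::] D j in
    [/\ dval ds = nth 0 xs j, size ds = M & all (fun d => (`|d|%N <= t)%N) ds].
  have [k hk] : exists k, forall m, (k <= m)%N -> exists D : seq (seq int), size D = size xs /\
     forall j, (j < size xs)%N -> let ds := nth [::] D j in
      [/\ dval ds = nth 0 xs j, size ds = m & all (fun d => (`|d|%N <= t)%N) ds].
    elim: (xs) => [|x s [k IH]]; first by exists 0%N => m _; exists [::].
    have [k' hk'] := digits_exist x; exists (k + k')%N => m hm.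
    have [|D [sD hD]] := IH m; first by lia.
    have [|ds e [e1 e2]] := hk' m; first by lia.
    exists (ds :: D); split=> /=; first by rewrite sD.
    by case=> [|j] //= hj; apply: hD.
  exists (k + size w)%N; split; first by lia.
  by apply: hk; lia.
case: hD => D [sD hD]; pose m := (M - size w)%N.
pose w1 := nseq m (zeros ns) ++ w.
have sw1 : size w1 = M by rewrite size_cat size_nseq /m subnK.
have hw1 : all (mem (alphabet ns)) w1.
  by rewrite all_cat hw andbT; apply/allP => a /nseqP [-> _]; exact: zeros_alphabet.
pose W := [seq [seq nth 0 (nth [::] D j) i | j <- iota 0 n] :: nth [::] w1 i | i <- iota 0 M].
have bW : map behead W = w1.
  rewrite -map_comp; apply: (@eq_from_nth _ [::]); first by rewrite size_map size_iota sw1.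
  by move=> i; rewrite size_map size_iota => hi; rewrite (nth_map 0%N) ?size_iota //= nth_iota.
exists m, W; split=> //; last first.
  rewrite wval_cons bW wval_pad; congr (_ :: _).
  apply: (@eq_from_nth _ 0); first by rewrite size_map size_iota hx.
  move=> j; rewrite size_map size_iota => hj; rewrite (nth_map 0%N) ?size_iota // nth_iota // add0n.
  have hj' : (j < size xs)%N by rewrite hx.
  have [h1 h2 h3] := hD j hj'; rewrite -h1.
  congr dval; rewrite /column -map_comp; apply: (@eq_from_nth _ 0).
    by rewrite size_map size_iota h2.
  move=> i; rewrite size_map size_iota => hi.
  rewrite (nth_map 0%N) ?size_iota // nth_iota //= /digit /=.
  by rewrite (nth_map 0%N) ?size_iota // nth_iota.
apply/allP => a /mapP [i]; rewrite mem_iota => /andP [_ hi] -> /=.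
rewrite mem_alphabet_cons size_map size_iota eqxx /=; apply/andP; split; last first.
  by move/allP: hw1; apply; apply: mem_nth; rewrite sw1.
apply/allP => d /mapP [j]; rewrite mem_iota => /andP [_ hj] -> /=.
have [|h1 h2 /allP h3] := hD j; first by rewrite hx.
by apply: h3; apply: mem_nth; rewrite h2.
Qed.

(** Acceptance is required only after some number of leading zeros: the automaton of an inequality
    answers only on words long enough to settle its sign. *)
Definition recognises (Q : eqType) (A : nfa Q) (ns : seq nat) (P : seq (seq int) -> Prop) : Prop :=
  well_formed A (alphabet ns) /\
  forall w, all (mem (alphabet ns)) w ->
    (P (wval ns w) <-> exists m, accepts A (nseq m (zeros ns) ++ w)).

Lemma well_formed_eq (Q : eqType) (A : nfa Q) (al al' : seq block_letter) :
  al =i al' -> well_formed A al -> well_formed A al'.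
Proof.
by move=> e [h1 h2 h3]; split=> // p a q /h3 [k1 k2 k3]; rewrite -e.
Qed.

Lemma accepts_alphabet (Q : eqType) (A : nfa Q) al w :
  well_formed A al -> accepts A w -> all (mem al) w.
Proof.
move=> [_ _ h] [p [q [_ _]]]; elim: w p => //= a w IH p [p' /h [_ ha _] /IH ->].
by rewrite andbT.
Qed.

Lemma projection (Q : eqType) (A : nfa Q) n ns P w :
  recognises A (n :: ns) P -> all (mem (alphabet ns)) w ->
  (exists v w', [/\ all is_zero (map behead v), map behead w' = w & accepts A (v ++ w')]) <->
  exists2 xs, size xs = n & P (xs :: wval ns w).
Proof.
move=> [wf hP] hw; split=> [[v [w' [h1 h2 h3]]]|[xs hx hxs]].
  have hal := accepts_alphabet wf h3.
  have : P (wval (n :: ns) (v ++ w')) by apply/(hP _ hal); exists 0%N.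
  rewrite wval_cons map_cat h2 (@zero_word ns (map behead v)) //.
    by rewrite wval_pad => h; eexists; last exact: h; rewrite size_map size_iota.
  move: hal; rewrite all_cat all_map => /andP [hv _].
  by apply: sub_all hv => a ha /=; rewrite -(behead_alphabet n); apply: map_f.
have [m [W [h1 h2 h3]]] := extend_word hw hx.
move: hxs; rewrite -h3 => /(hP _ h1) [m' hm'].
(* The prefix consists of the [m'] zero letters demanded by [recognises] and of the [m] letters by
   which the new block is longer than [w]. *)
exists (nseq m' (zeros (n :: ns)) ++ take m W), (drop m W); split.
- rewrite map_cat all_cat map_take h2 take_size_cat ?size_nseq //.
  rewrite map_nseq; apply/andP; split; apply/allP => a /nseqP [-> _]; exact: is_zero_zeros.
- by rewrite map_drop h2 drop_size_cat ?size_nseq.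
- by rewrite -catA cat_take_drop.
Qed.

Lemma det_recognises (Q : eqType) (A : nfa Q) n ns (al : seq block_letter) P :
  recognises A (n :: ns) P -> al =i alphabet (n :: ns) ->
  recognises (det A (map behead al)) ns (fun e => ~ exists2 xs, size xs = n & P (xs :: e)).
Proof.
move=> hA hal; have [wf _] := hA.
have hal' : map behead al =i alphabet ns.
  move=> a; rewrite -(behead_alphabet n); apply/mapP/mapP => -[b hb ->];
  by exists b; rewrite // ?hal // -hal.
have hacc w : all (mem (alphabet ns)) w -> accepts (det A (map behead al)) w <->
   ~ exists2 xs, size xs = n & P (xs :: wval ns w).
  move=> hw; rewrite -(projection hA hw); apply: det_accepts wf _.
  by apply: sub_all hw => a /=; rewrite hal'.
split; first exact: well_formed_eq hal' (det_well_formed _ _).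
move=> w hw; split=> [h|[m h]]; first by exists 0%N; apply/hacc.
have hm : all (mem (alphabet ns)) (nseq m (zeros ns) ++ w).
  by rewrite all_cat hw andbT; apply/allP => a /nseqP [-> _]; exact: zeros_alphabet.
by move/(hacc _ hm): h; rewrite wval_pad.
Qed.

Lemma clos_recognises (Q : eqType) (A : nfa Q) n P : recognises A [:: n] P ->
  has (mem (final A)) (clos A) <-> exists2 xs, size xs = n & P [:: xs].
Proof.
move=> hA; have [wf _] := hA; rewrite (clos_accepts wf).
rewrite -(projection (w := [::]) hA) //; split=> [[v h1 h2]|[v [w' [h1 h2 h3]]]].
  by exists v, [::]; split=> //; rewrite cats0.
by case: w' h2 h3 => //= _; rewrite cats0; exists v.
Qed.

End Values.

(** * Automata for inequalities *)

(* (strict, (terms, bound)): the pair (u, v) of integers stands for u + v b, where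
   b is the quadratic unit of trace t *)
Definition atom : Type := (bool * (seq ((int * int) * (nat * nat)) * (int * int)))%type.
Definition point : Type := (int * int)%type.

Definition strict (at_ : atom) : bool := at_.1.
Definition terms (at_ : atom) : seq ((int * int) * (nat * nat)) := at_.2.1.
Definition bound (at_ : atom) : int * int := at_.2.2.

Definition eval_step (z : seq bool * seq bool) (op : nat) : seq bool * seq bool :=
  if op == 0 then (head false z.2 :: z.1, behead z.2)
  else if op == 1 then (~~ head false z.1 :: behead z.1, z.2)
  else if op == 2 then ((head false z.1 && head false (behead z.1)) :: behead (behead z.1), z.2)
  else ((head false z.1 || head false (behead z.1)) :: behead (behead z.1), z.2).

(* Postfix evaluation: 0 reads the next truth value, 1, 2 and 3 are negation,
   conjunction and disjunction. *)
Definition eval_prog (prog : seq nat) (bs : seq bool) : bool :=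
  head false (foldl eval_step ([::], bs) prog).1.

Lemma all2_map_same (T X Y : Type) (r : X -> Y -> bool) (g : T -> X) (h : T -> Y) (s : seq T) :
  all2 r (map g s) (map h s) = all (fun x => r (g x) (h x)) s.
Proof. by elim: s => //= x s ->. Qed.

Lemma all2_nth (X Y : Type) (r : X -> Y -> bool) x0 y0 (s : seq X) (l : seq Y) i :
  all2 r s l -> i < size l -> r (nth x0 s i) (nth y0 l i).
Proof.
elim: s l i => [|x s IH] [|y l] [|i] //= /andP [h1 h2] hi //.
exact: IH.
Qed.

Lemma all2_size_eq (X Y : Type) (r : X -> Y -> bool) (s : seq X) (l : seq Y) :
  all2 r s l -> size s = size l.
Proof. by elim: s l => [|x s IH] [|y l] //= /andP [_ /IH ->]. Qed.

Section Body.
Variable t : nat.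
Hypothesis t_gt2 : 2 < t.
Local Open Scope ring_scope.

Definition lin (s : seq ((int * int) * (nat * nat))) (a : block_letter) : int * int :=
  foldr (fun cv acc => let d := digit (rev a) cv.2.1 cv.2.2 in
    (cv.1.1 * d + acc.1, cv.1.2 * d + acc.2)) (0, 0) s.

(** Bounds the absolute values of both u + v b and its conjugate u + v/b, because b and 1/b are less
    than t. *)
Definition cnorm (c : int * int) : nat := (`|c.1| + t * `|c.2|)%N.
(** A common bound for the norms of all points fed to the scheme. Digits contribute a factor t, and
    the middle term [mid] raises it to 3 t. *)
Definition cap (at_ : atom) : nat :=
  (3 * t * (foldr (fun cv n => cnorm cv.1 + n) 0 (terms at_) + cnorm (bound at_)))%N.

(* u + v b goes to (u + v b) b + e, where b^2 = t b - 1; [sstep] stops once |v| has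
   determined the sign. *)
Definition hstep (z e : point) : point := (e.1 - z.2, z.1 + Posz t * z.2 + e.2).
Definition sstep (E : nat) (z e : point) : point := if (`|z.2| <= 2 * E)%N then hstep z e else z.
Definition opp2 (e : point) : point := (- e.1, - e.2).
(* - d (b - 1/b) *)
Definition mid (d : int * int) : point :=
  (Posz t * d.1 + Posz 2 * d.2, - (Posz 2 * d.1 + Posz t * d.2)).
(** If |v| <= 2 E before a step and the input is bounded by E, then |u| <= 3 E afterwards; with |u|
    <= 3 E before, the new |v| is at most 3 E + 2 t E + E. This is the source of the factor 2 t +
    4. *)
Definition box (E : nat) : seq point :=
  flatten [seq [seq (u, v) | v <- irange ((2 * t + 4) * E)] | u <- irange ((2 * t + 4) * E)].
Definition decided (E : nat) (f : point) : bool := ~~ (`|f.2| <= 2 * E)%N || (f == (0, 0)).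
(** Meaningful at decided points. The first test says v < - 2 E, put as a weak inequality, a form
    for which the efficiency rules are stated. *)
Definition holds (at_ : atom) (f : point) : bool :=
  (f.2 + Posz (2 * cap at_).+1 <= 0) || (~~ strict at_ && (f == (0, 0))).

Definition atom_states (at_ : atom) : seq (point * point) :=
  flatten [seq [seq (p, q) | q <- box (cap at_)] | p <- box (cap at_)].
(** Each guess carries the truth value that it entails, so that [body_nfa] can keep just the
    combinations on which the Boolean program has the desired value. *)
Definition atom_initial (at_ : atom) : seq ((point * point) * bool) :=
  [seq (((0, 0), f), holds at_ f) | f <- box (cap at_) & decided (cap at_) f].
(** Here the two halves meet: the middle input leads from the point reached forwards to the point at
    which the backward half begins. *)
Definition atom_final (at_ : atom) : seq (point * point) :=
  [seq x <- atom_states at_ | x.2 == sstep (cap at_) x.1 (mid (bound at_))].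
Definition atom_trans (a : block_letter) (at_ : atom) : seq ((point * point) * (point * point)) :=
  flatten [seq [seq (x, y) | y <- atom_states at_ &
      (y.1 == sstep (cap at_) x.1 (lin (terms at_) a)) &&
      (x.2 == sstep (cap at_) y.2 (opp2 (lin (terms at_) a)))] | x <- atom_states at_].

(* A state has for each inequality the point reached by the forward half of the
   evaluation and the point at which the backward half must resume; the latter is
   guessed in the initial state. *)
Definition body_nfa (ats : seq atom) (prog : seq nat) (sg : bool) (al : seq block_letter) :
    nfa (seq (point * point)) :=
  ((prodl (map atom_states ats),
    [seq map fst l | l <- prodl (map atom_initial ats) & eval_prog prog (map snd l) == sg]),
   (flatten [seq [seq (map fst l, (a, map snd l)) | l <- prodl (map (atom_trans a) ats)] | a <- al],
    prodl (map atom_final ats))).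

Lemma mem_box E z : (z \in box E) = ((`|z.1| <= (2 * t + 4) * E) && (`|z.2| <= (2 * t + 4) * E))%N.
Proof.
case: z => u v; apply/flatten_mapP/andP => [[u' hu /mapP [v' hv [-> ->]]]|[hu hv]].
  by rewrite -!mem_irange.
by exists u; rewrite ?mem_irange //; apply/mapP; exists v; rewrite ?mem_irange.
Qed.

Lemma mem_atom_states at_ x :
  (x \in atom_states at_) = (x.1 \in box (cap at_)) && (x.2 \in box (cap at_)).
Proof.
case: x => p q; apply/flatten_mapP/andP => [[p' hp /mapP [q' hq [-> ->]]]|[hp hq]] //.
by exists p => //; apply/mapP; exists q.
Qed.

Lemma mem_atom_trans a at_ x y : ((x, y) \in atom_trans a at_) =
  [&& x \in atom_states at_, y \in atom_states at_,
   y.1 == sstep (cap at_) x.1 (lin (terms at_) a) &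
   x.2 == sstep (cap at_) y.2 (opp2 (lin (terms at_) a))].
Proof.
apply/flatten_mapP/idP => [[x' hx /mapP [y']]|/and4P [h1 h2 h3 h4]].
  by rewrite mem_filter => /andP [/andP [h1 h2] h3] [-> ->]; rewrite hx h3 h1 h2.
by exists x => //; apply/mapP; exists y => //; rewrite mem_filter h3 h4.
Qed.

Lemma body_trans ats prog sg al s a s' :
  ((s, (a, s')) \in trans (body_nfa ats prog sg al)) <->
  a \in al /\ exists2 l, l \in prodl (map (atom_trans a) ats) & s = map fst l /\ s' = map snd l.
Proof.
split=> [/flatten_mapP [b hb /mapP [l hl [-> -> ->]]]|[ha [l hl [-> ->]]]].
  by split=> //; exists l.
by apply/flatten_mapP; exists a => //; apply/mapP; exists l.
Qed.

Lemma body_well_formed ats prog sg al : well_formed (body_nfa ats prog sg al) al.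
Proof.
split=> [s|s|s a s'].
- case/mapP=> l; rewrite mem_filter => /andP [_]; rewrite !mem_prodl => hl ->.
  elim: ats l hl => [|at_ ats IH] [|[x b] l] //= /andP [hx /IH ->].
  rewrite andbT; case/mapP: hx => f; rewrite mem_filter => /andP [_ hf] [-> _].
  by rewrite mem_atom_states /= hf andbT mem_box.
- rewrite /final /states /= !mem_prodl; elim: ats s => [|at_ ats IH] [|x s] //= /andP [hx /IH ->].
  by move: hx; rewrite mem_filter andbT => /andP [].
- case/body_trans=> ha [l]; rewrite mem_prodl => hl [-> ->].
  suff [h1 h2] : all2 (fun x (l : seq (point * point)) => x \in l) (map fst l) (map atom_states ats) /\
    all2 (fun x (l : seq (point * point)) => x \in l) (map snd l) (map atom_states ats).
    by split; rewrite // /states /= mem_prodl.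
  elim: ats l hl => [|at_ ats IH] [|[x y] l] //= /andP [hx /IH [-> ->]].
  by move: hx; rewrite mem_atom_trans !andbT => /and4P [].
Qed.

Definition es (at_ : atom) (w : seq block_letter) : seq point := map (lin (terms at_)) w.
Definition run (at_ : atom) (z : point) (l : seq point) : point := foldl (sstep (cap at_)) z l.
Definition verdict_point (at_ : atom) (w : seq block_letter) : point :=
  run at_ (0, 0) (es at_ w ++ mid (bound at_) :: rev (map opp2 (es at_ w))).

Lemma body_steps ats prog sg al s w s' : steps (body_nfa ats prog sg al) s w s' ->
  forall i, (i < size ats)%N ->
  let at_ := nth (false, ([::], (0, 0))) ats i in
  let x := nth ((0, 0), (0, 0)) s i in let y := nth ((0, 0), (0, 0)) s' i in
  y.1 = run at_ x.1 (es at_ w) /\ x.2 = run at_ y.2 (rev (map opp2 (es at_ w))).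
Proof.
elim: w s => [|a w IH] s /=; first by move=> ->.
move=> [s1 /body_trans [_ [l hl [-> e1]]] /IH {}IH] i hi.
move: hl; rewrite mem_prodl => hl; have sl := all2_size_eq hl; rewrite size_map in sl.
have := all2_nth (((0, 0), (0, 0)), ((0, 0), (0, 0))) [::] hl (i := i).
rewrite size_map => /(_ hi); rewrite (nth_map (false, ([::], (0, 0)))) //.
have [-> h2] := IH i hi; move: h2; rewrite e1.
rewrite !(nth_map (((0, 0), (0, 0)), ((0, 0), (0, 0)))) ?sl //.
case: (nth _ l i) => x y /=; rewrite mem_atom_trans => h2 /and4P [_ _ /eqP <- /eqP ->].
by rewrite h2 rev_cons /run foldl_rcons.
Qed.

Lemma map_in_prodl (X : eqType) (T : Type) (g : T -> X) (h : T -> seq X) (s : seq T) :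
  (map g s \in prodl (map h s)) = all (fun x => g x \in h x) s.
Proof. by rewrite mem_prodl all2_map_same. Qed.

Definition small (at_ : atom) (e : point) : bool := (cnorm e <= cap at_)%N.

Lemma small_coords at_ e : small at_ e -> (`|e.1| <= cap at_)%N /\ (`|e.2| <= cap at_)%N.
Proof.
rewrite /small /cnorm; have : (`|e.2| <= t * `|e.2|)%N by rewrite leq_pmull //; lia.
lia.
Qed.

Lemma run_box at_ l : all (small at_) l -> run at_ (0, 0) l \in box (cap at_).
Proof.
move=> hl; rewrite mem_box.
suff : ((`|(run at_ (0%R, 0%R) l).1| <= 3 * cap at_) && (`|(run at_ (0%R, 0%R) l).2| <= (2 * t + 4) * cap at_))%N.
  by move=> /andP [h1 h2]; rewrite h2 andbT; apply: leq_trans h1 _; rewrite leq_mul //; lia.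
elim/last_ind: l hl => [|l e IH]; first by rewrite /run /=; lia.
rewrite all_rcons /run foldl_rcons -/(run _ _ _) => /andP [/small_coords [h1 h2] /IH].
case: (run _ _ _) => u v /= /andP [h3 h4]; rewrite /sstep /hstep /=.
case: ifP => [h5|_] /=; last by rewrite h3 h4.
by apply/andP; split; nia.
Qed.

Lemma lin_small (ns : seq nat) at_ a : a \in alphabet t ns -> small at_ (lin (terms at_) a).
Proof.
move=> ha; have hd b j : (`|digit (rev a) b j| <= t)%N.
  have {}ha : all (all (fun d : int => (`|d| <= t)%N)) a.
    elim: ns a ha => [|n ns IH] a; first by rewrite inE => /eqP ->.
    move=> ha; have [c [a' [e _]]] := mem_alphabet_inv ha; subst a.
    by move: ha; rewrite mem_alphabet_cons => /and3P [_ /= -> /IH].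
  rewrite /digit; case: (ltnP b (size (rev a))) => hb; last by rewrite [nth _ _ b]nth_default // nth_nil.
  have /allP hr : all (all (fun d : int => (`|d| <= t)%N)) (rev a) by rewrite all_rev.
  have /allP hs := hr _ (mem_nth [::] hb).
  case: (ltnP j (size (nth [::] (rev a) b))) => hj; last by rewrite nth_default.
  by apply: hs; apply: mem_nth.
suff : (`|(lin (terms at_) a).1| + t * `|(lin (terms at_) a).2| <= t * foldr (fun cv n => cnorm cv.1 + n) 0 (terms at_))%N.
  by rewrite /small /cap => h; apply: (leq_trans h); rewrite -mulnA mulnDr; lia.
elim: (terms at_) => [|[c v] s IH] /=; first by lia.
move: IH; set z := lin s a; set S := foldr _ _ _ => IH.
have := hd v.1 v.2; set d := digit _ _ _ => hdd; rewrite /cnorm /=.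
have habs (x y : int) : (`|(x * d + y)%R| <= `|x| * t + `|y|)%N.
  have := abszM x d; have : (`|x| * `|d| <= `|x| * t)%N by rewrite leq_mul.
  by move: (x * d)%R => xd; lia.
have h1 := habs c.1 z.1; have h2 := habs c.2 z.2.
have h3 := leq_mul (leqnn t) h2.
by rewrite !mulnDr; rewrite !mulnDr in h3; lia.
Qed.

Lemma mid_small at_ : small at_ (mid (bound at_)).
Proof.
rewrite /small /cap /cnorm /mid /=; case: (bound at_) => d1 d2 /=.
set S := foldr _ _ _; have e1 := abszM (Posz t) d1; have e2 := abszM (Posz t) d2.
rewrite !absz_nat in e1 e2.
have h1 : (`|d1| <= t * `|d1|)%N by rewrite leq_pmull //; lia.
have h2 : (`|d2| <= t * `|d2|)%N by rewrite leq_pmull //; lia.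
have h3 : (t * `|d2| <= t * (t * `|d2|))%N by rewrite leq_pmull //; lia.
have h4 : (`|(Posz t * d1 + Posz 2 * d2)%R| <= t * `|d1| + 2 * `|d2|)%N.
  by move: (Posz t * d1) e1 => x e1; lia.
have h5 : (t * `|(- (Posz 2 * d1 + Posz t * d2))%R| <= t * (2 * `|d1| + t * `|d2|))%N.
  by rewrite leq_mul //; move: (Posz t * d2) e2 => x e2; lia.
rewrite !mulnDr !mulnA in h5 *; move: (Posz t * d1 + _)%R (`|- _|%N) h4 h5 => x y h4 h5.
by rewrite mulnA in h3; lia.
Qed.

Lemma opp2_small at_ e : small at_ e -> small at_ (opp2 e).
Proof. by rewrite /small /cnorm /= !abszN. Qed.

Lemma es_small ns at_ w : all (mem (alphabet t ns)) w -> all (small at_) (es at_ w).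
Proof. by rewrite all_map; apply: sub_all => a; exact: lin_small. Qed.

Lemma es_cat at_ w1 w2 : es at_ (w1 ++ w2) = es at_ w1 ++ es at_ w2.
Proof. exact: map_cat. Qed.

Definition back (at_ : atom) (w1 w2 : seq block_letter) : seq point :=
  es at_ w1 ++ mid (bound at_) :: rev (map opp2 (es at_ w2)).

Lemma back_small ns at_ w1 w2 : all (mem (alphabet t ns)) w1 -> all (mem (alphabet t ns)) w2 ->
  all (small at_) (back at_ w1 w2).
Proof.
move=> h1 h2; rewrite all_cat (es_small _ h1) /= mid_small all_rev all_map.
by apply: sub_all (es_small at_ h2) => e; exact: opp2_small.
Qed.

(** The accepting run on [w1 ++ w2] after [w1]: the second component belongs to the moment of the
    full evaluation at which the mirror image of the unread part [w2] has just been consumed. *)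
Definition body_state (ats : seq atom) (w1 w2 : seq block_letter) : seq (point * point) :=
  [seq (run at_ (0, 0) (es at_ w1), run at_ (0, 0) (back at_ (w1 ++ w2) w2)) | at_ <- ats].

(** A guess is not free: the final condition fixes the second component at the end of the word and
    the transitions propagate it back to the start, where it must equal [verdict_point]. *)
Lemma body_accepts ats prog sg ns al w : al =i alphabet t ns -> all (mem (alphabet t ns)) w ->
  accepts (body_nfa ats prog sg al) w <->
  all (fun at_ => decided (cap at_) (verdict_point at_ w)) ats /\
  eval_prog prog [seq holds at_ (verdict_point at_ w) | at_ <- ats] = sg.
Proof.
move=> hal hw; split.
  move=> [p [q [/mapP [l]]]]; rewrite mem_filter mem_prodl => /andP [/eqP hsg hl] -> hq hs.
  move: hq; rewrite /final /= mem_prodl => hq.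
  have sl := all2_size_eq hl; have sq := all2_size_eq hq; rewrite !size_map in sl sq.
  pose at0 : atom := (false, ([::], (0, 0))); pose x0 : point * point := ((0, 0), (0, 0)).
  have key i : (i < size ats)%N -> let at_ := nth at0 ats i in
     decided (cap at_) (verdict_point at_ w) /\ 
     nth false (map snd l) i = holds at_ (verdict_point at_ w).
    move=> hi; have [/= h1 h2] := body_steps hs hi.
    have := all2_nth (x0, false) [::] hl (i := i); have := all2_nth x0 [::] hq (i := i).
    rewrite !size_map => /(_ hi) hq' /(_ hi) hl'.
    rewrite !(nth_map at0) // in hq' hl'.
    rewrite !(nth_map (x0, false)) ?sl // in h1 h2 *.
    case/mapP: hl' h1 h2 => f; rewrite mem_filter => /andP [hd _] -> /= h1 h2.
    move: hq'; rewrite mem_filter => /andP [/eqP h3 _].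
    have -> : verdict_point (nth at0 ats i) w = f.
      by rewrite h2 h3 h1 /verdict_point /run -[in RHS]foldl_rcons -foldl_cat cat_rcons.
    by [].
  split.
    apply/(all_nthP at0) => i hi; exact: (key i hi).1.
  rewrite -hsg; congr eval_prog; apply: (@eq_from_nth _ false); rewrite !size_map ?sl // => i hi.
  by rewrite (nth_map at0) // (key i hi).2.
move=> [hd hs].
have hb at_ w1 w2 : all (mem (alphabet t ns)) w1 -> all (mem (alphabet t ns)) w2 ->
   run at_ (0, 0) (back at_ w1 w2) \in box (cap at_).
  by move=> h1 h2; apply: run_box; apply: back_small h1 h2.
have hf at_ w1 : all (mem (alphabet t ns)) w1 -> run at_ (0, 0) (es at_ w1) \in box (cap at_).
  by move=> h1; apply: run_box; apply: es_small h1.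
have path w1 w2 : all (mem (alphabet t ns)) w1 -> all (mem (alphabet t ns)) w2 ->
    steps (body_nfa ats prog sg al) (body_state ats w1 w2) w2 (body_state ats (w1 ++ w2) [::]).
  elim: w2 w1 => [|a w2 IH] w1 h1 /=; first by rewrite cats0.
  move=> /andP [ha h2]; exists (body_state ats (rcons w1 a) w2); last first.
    by rewrite -cat_rcons; apply: IH => //; rewrite all_rcons h1 andbT.
  apply/body_trans; split; first by rewrite hal.
  exists [seq ((run at_ (0, 0) (es at_ w1), run at_ (0, 0) (back at_ (w1 ++ a :: w2) (a :: w2))),
               (run at_ (0, 0) (es at_ (rcons w1 a)), run at_ (0, 0) (back at_ (rcons w1 a ++ w2) w2))) | at_ <- ats].
    rewrite map_in_prodl; apply/allP => at_ _; rewrite mem_atom_trans !mem_atom_states /=.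
    have h1' : all (mem (alphabet t ns)) (rcons w1 a) by rewrite all_rcons h1 andbT.
    have h12 : all (mem (alphabet t ns)) (w1 ++ a :: w2) by rewrite all_cat /= h1 h2 andbT.
    have ha2 : all (mem (alphabet t ns)) (a :: w2) by rewrite /= h2 andbT.
    rewrite cat_rcons !hf // !hb //=; apply/andP; split.
      by rewrite /es map_rcons /run foldl_rcons.
    by rewrite /back /= rev_cons -rcons_cons -rcons_cat /run foldl_rcons.
  by split; rewrite -map_comp.
exists (body_state ats [::] w), (body_state ats w [::]); split; last exact: path.
- rewrite /initial /=; apply/mapP.
  exists [seq (((0, 0), verdict_point at_ w), holds at_ (verdict_point at_ w)) | at_ <- ats].
    rewrite mem_filter map_in_prodl -map_comp.
    rewrite (_ : [seq _ | at_ <- ats] = [seq holds at_ (verdict_point at_ w) | at_ <- ats]) //.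
    rewrite hs eqxx /=; apply/allP => at_ hat.
    apply/mapP; exists (verdict_point at_ w) => //; rewrite mem_filter (allP hd) //=.
    exact: (hb at_ w w).
  by rewrite -map_comp.
- rewrite /final /= map_in_prodl; apply/allP => at_ hat; rewrite mem_filter mem_atom_states /= cats0.
  rewrite hf // (hb at_ w [::]) // !andbT.
  by rewrite /back /= cats1 /run foldl_rcons.
Qed.

End Body.

(** * The sign of a clipped evaluation *)

Section Signs.
Variable t : nat.
Hypothesis t_gt2 : 2 < t.
Variable R : realFieldType.
Variable b : R.
Hypothesis b_gt1 : (1 < b)%R.
Hypothesis b_root : (b ^+ 2 = t%:R * b - 1)%R.
Local Open Scope ring_scope.

Definition oval (z : int * int) : R := z.1%:~R + z.2%:~R * b.
(** The conjugate of [oval]: t - b = 1/b is the other root of the equation of b. *)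
Definition cval (z : int * int) : R := z.1%:~R + z.2%:~R * (t%:R - b).

Let t_ge3 : 3 <= t%:R :> R.
Proof. by rewrite ler_nat. Qed.

Let b_gt2 : 2 < b.
Proof. by have := b_root; have := t_ge3; have := b_gt1; rewrite expr2; nra. Qed.

Let b_inv : b * (t%:R - b) = 1.
Proof. by have := b_root; rewrite expr2; lra. Qed.

Let c_bound : 0 < t%:R - b < 1 / 2%:R.
Proof. by have := b_inv; have := b_gt2; nra. Qed.

Lemma oval_hstep z e : oval (hstep t z e) = b * oval z + oval e.
Proof.
rewrite /oval /hstep /= !rmorphD !rmorphM /= rmorphN /= -[(Posz t)%:~R]/(t%:R : R).
have : z.2%:~R * (b * b) = z.2%:~R * (t%:R * b - 1) :> R by rewrite -expr2 b_root.
by move: (z.1%:~R) (z.2%:~R) (e.1%:~R) (e.2%:~R) => *; lra.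
Qed.

Lemma cval_hstep z e : cval (hstep t z e) = (t%:R - b) * cval z + cval e.
Proof.
rewrite /cval /hstep /= !rmorphD !rmorphM /= rmorphN /= -[(Posz t)%:~R]/(t%:R : R).
have h : (t%:R - b) * (t%:R - b) = t%:R * (t%:R - b) - 1 :> R.
  by have := b_inv; lra.
have : z.2%:~R * ((t%:R - b) * (t%:R - b)) = z.2%:~R * (t%:R * (t%:R - b) - 1) :> R by rewrite h.
by move: (t%:R - b) (z.1%:~R) (z.2%:~R) (e.1%:~R) (e.2%:~R) => *; lra.
Qed.

Lemma oval0 : oval (0, 0) = 0.
Proof. by rewrite /oval /= mul0r addr0. Qed.

Lemma foldl_hstep z l :
  oval (foldl (hstep t) z l) = b ^+ size l * oval z + oval (foldl (hstep t) (0, 0) l).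
Proof.
elim: l z => [|e l IH] z /=.
  by rewrite expr0 mul1r oval0 addr0.
rewrite IH (IH (hstep t (0, 0) e)) !oval_hstep exprS.
by rewrite oval0; ring.
Qed.

Definition oval_digits (l : seq point) : R := oval (dval t (map fst l), dval t (map snd l)).

(** Binet's formula for the bases. *)
Lemma base_value_oval k :
  (base_value t k)%:~R * (b - (t%:R - b)) = b ^+ k - (t%:R - b) ^+ k.
Proof.
suff [] : (base_value t k)%:~R * (b - (t%:R - b)) = b ^+ k - (t%:R - b) ^+ k /\
  (base_value t k.+1)%:~R * (b - (t%:R - b)) = b ^+ k.+1 - (t%:R - b) ^+ k.+1 by [].
elim: k => [|k [IH1 IH2]]; first by rewrite /base_value /= !expr0 !expr1; split; ring.
split=> //; rewrite base_valueSS rmorphB rmorphM /= mulrBl -mulrA IH1 IH2.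
rewrite !(exprS _ k.+1) !(exprS _ k) -[(Posz t)%:~R]/(t%:R : R).
have := b_root; rewrite expr2 => h.
have h' : (t%:R - b) * (t%:R - b) = t%:R * (t%:R - b) - 1 :> R by have := b_inv; lra.
rewrite !mulrA h; move: h'; move: (t%:R - b) => c h'.
by rewrite h'; move: (b ^+ k) (c ^+ k) => x y; ring.
Qed.

(** Induction on pairs of outer inputs: with k the length of the list, the outermost e is weighted
    by b^(2k) - 1 = b^k (b^k - b^-k), and Binet's formula turns the bracket into F_k (b - 1/b). *)
Lemma palindrome l m :
  oval (foldl (hstep t) (0, 0) (l ++ m :: rev (map opp2 l))) =
  b ^+ size l * ((b - (t%:R - b)) * oval_digits l + oval m).
Proof.
elim: l => [|e l IH] /=.
  by rewrite oval_hstep /oval_digits /oval /dval /= expr0; ring.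
rewrite rev_cons -rcons_cons -rcons_cat foldl_rcons oval_hstep foldl_hstep IH.
rewrite size_cat /= size_rev size_map.
have -> : oval (opp2 e) = - oval e by rewrite /oval /= !rmorphN /=; ring.
have -> : oval (hstep t (0, 0) e) = oval e by rewrite oval_hstep oval0 mulr0 add0r.
have -> : oval_digits (e :: l) = (base_value t (size l).+1)%:~R * oval e + oval_digits l.
  by rewrite /oval_digits /= !dval_cons !size_map /oval /= !rmorphD !rmorphM /=; ring.
have hF := base_value_oval (size l).+1.
have e1 : b ^+ (size l + (size l).+1) * b = b ^+ (size l).+1 * b ^+ (size l).+1.
  by rewrite -exprD -exprSr; congr (b ^+ _); lia.
have e2 : b ^+ (size l).+1 * (t%:R - b) ^+ (size l).+1 = 1.
  by rewrite -exprMn b_inv expr1n.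
have e3 : b ^+ (size l).+1 = b * b ^+ size l by rewrite exprS.
set u := b ^+ (size l).+1 in hF e1 e2 e3 *; set v := (t%:R - b) ^+ (size l).+1 in hF e2.
set G := b - (t%:R - b) in hF *.
transitivity ((u * u - u * v) * oval e + u * (G * oval_digits l + oval m)).
  by rewrite e2 -e1 {1}e3; ring.
by rewrite -mulrBr -hF; ring.
Qed.

Lemma oval_mid d : oval (mid t d) = - ((b - (t%:R - b)) * oval d).
Proof.
rewrite /oval /mid /= !rmorphD !rmorphM /= !rmorphN /= !rmorphD !rmorphM /=.
rewrite -[(Posz t)%:~R]/(t%:R : R) -[(Posz 2)%:~R]/(2%:R : R).
have : d.1%:~R * (b * b) = d.1%:~R * (t%:R * b - 1) :> R by rewrite -expr2 b_root.
have : d.2%:~R * (b * b) = d.2%:~R * (t%:R * b - 1) :> R by rewrite -expr2 b_root.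
by move: (d.1%:~R) (d.2%:~R) => *; lra.
Qed.

(** The square of b - 1/b is t^2 - 4, which is at least 5. *)
Lemma gap_gt2 : 2 < b - (t%:R - b).
Proof.
have h : (b - (t%:R - b)) * (b - (t%:R - b)) = t%:R * t%:R - 4%:R :> R.
  by have := b_inv; lra.
have := b_gt2; have := c_bound; have := t_ge3; move: h; move: (t%:R - b) => c; nra.
Qed.

Lemma small_bounds at_ e : small t at_ e ->
  `|oval e| <= (cap t at_)%:R /\ `|cval e| <= (cap t at_)%:R.
Proof.
rewrite /small /cnorm -(ler_nat R) natrD natrM !natr_absz !intr_norm => h.
have ht := t_ge3; have hc := c_bound; have h1 := ler_normD e.1%:~R (e.2%:~R * b).
have h2 := ler_normD e.1%:~R (e.2%:~R * (t%:R - b)).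
rewrite !normrM in h1 h2; rewrite (gtr0_norm (_ : 0 < b)) in h1; last by have := b_gt2; lra.
rewrite (gtr0_norm (_ : 0 < t%:R - b)) in h2; last by lra.
have p : 0 <= `|e.2%:~R| :> R by [].
by rewrite /oval /cval; split; nra.
Qed.

Lemma oval_cval z : oval z = cval z + z.2%:~R * (b - (t%:R - b)).
Proof. by rewrite /oval /cval; ring. Qed.

(** While nothing is clipped, the conjugate is multiplied by 1/b < 1/2 and moved by at most E, so it
    stays within 2 E. Once |v| > 2 E, the value cval + v (b - 1/b) exceeds 2 E with the sign of v,
    because the gap exceeds 2; since b > 2, inputs bounded by E cannot bring it back. Hence freezing
    the point preserves the sign. *)
Lemma clip_invariant at_ l : all (small t at_) l ->
  let E := (cap t at_)%:R : R in let z := foldl (hstep t) (0, 0) l in let f := run t at_ (0, 0) l in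
  [\/ f = z /\ `|cval z| <= 2 * E, Posz (2 * cap t at_) < f.2 /\ 2 * E < oval z |
      f.2 < - Posz (2 * cap t at_) /\ oval z < - (2 * E)].
Proof.
elim/last_ind: l => [|l e IH].
  by move=> _; apply: Or31; split; rewrite // /cval /= mul0r addr0 normr0 mulr_ge0 ?ler0n.
rewrite all_rcons => /andP [/small_bounds [he hc] /IH] /=.
rewrite /run !foldl_rcons -/(run _ _ _ _); move: (foldl _ _ _) (run _ _ _ _) => z f.
rewrite oval_hstep cval_hstep; have := c_bound; have := gap_gt2; have g2 := b_gt2.
set c := t%:R - b; set G := b - c => G2 c2.
set E := (cap t at_)%:R in he hc *; have E0 : 0 <= E by rewrite ler0n.
have up : 2 * E < oval z -> 2 * E < b * oval z + oval e.
  by move: he; rewrite ler_norml => /andP [h1 h2] h3; nra.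
have down : oval z < - (2 * E) -> b * oval z + oval e < - (2 * E).
  by move: he; rewrite ler_norml => /andP [h1 h2] h3; nra.
have twoE : (Posz (2 * cap t at_))%:~R = 2 * E :> R.
  by rewrite -[(Posz _)%:~R]/((2 * cap t at_)%:R : R) natrM.
case=> [[-> hz]|[h1 h2]|[h1 h2]].
- rewrite /sstep; case: ifP => hle.
    apply: Or31; split=> //; move: hz hc; rewrite !ler_norml => /andP [h1 h2] /andP [h3 h4].
    by apply/andP; split; nra.
  move: hz; rewrite ler_norml => /andP [hz1 hz2].
  case: (lerP 0 z.2) => hs.
    have hz : Posz (2 * cap t at_) + 1 <= z.2 by clear -hle hs; lia.
    apply: Or32; split; first by clear -hz; lia.
    apply: up; rewrite oval_cval; move: hz; rewrite -(ler_int R) rmorphD /= twoE => hz.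
    by rewrite -/c -/G; nra.
  have hz : z.2 <= - (Posz (2 * cap t at_) + 1) by clear -hle hs; lia.
  apply: Or33; split; first by clear -hz; lia.
  apply: down; rewrite oval_cval; move: hz; rewrite -(ler_int R) rmorphN rmorphD /= twoE => hz.
  by rewrite -/c -/G; nra.
- have -> : sstep t (cap t at_) f e = f by rewrite /sstep; case: ifP => //; clear -h1; lia.
  by apply: Or32; split=> //; exact: up.
- have -> : sstep t (cap t at_) f e = f by rewrite /sstep; case: ifP => //; clear -h1; lia.
  by apply: Or33; split=> //; exact: down.
Qed.

Lemma holds_correct ns at_ w : all (mem (alphabet t ns)) w ->
  decided (cap t at_) (verdict_point t at_ w) ->
  holds t at_ (verdict_point t at_ w) =
  if strict at_ then oval_digits (es at_ w) < oval (bound at_)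
  else oval_digits (es at_ w) <= oval (bound at_).
Proof.
move=> hw hd; set V := oval_digits (es at_ w); set d := oval (bound at_).
have := clip_invariant (back_small t_gt2 at_ hw hw); rewrite /back palindrome oval_mid -/V -/d.
rewrite -/(verdict_point t at_ w); set f := verdict_point t at_ w in hd *.
set z := foldl _ _ _; set n := size _; set E := (cap t at_)%:R.
have G2 := gap_gt2; set G := b - _ in G2 *.
have -> : G * V + - (G * d) = G * (V - d) by ring.
have E0 : 0 <= E by rewrite ler0n.
have bn : 0 < b ^+ n by apply: exprn_gt0; have := b_gt2; lra.
have twoE : (Posz (2 * cap t at_))%:~R = 2 * E :> R.
  by rewrite -[(Posz _)%:~R]/((2 * cap t at_)%:R : R) natrM.
have ez : oval z = b ^+ n * (G * (V - d)).
  by rewrite /z palindrome oval_mid -/V -/d -/G -/n; ring.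
have bG : 0 < b ^+ n * G by apply: mulr_gt0 => //; lra.
rewrite -ez => inv.
(* The first case of the invariant also occurs here, namely when the threshold was crossed by the
   very last input. *)
have pos : Posz (2 * cap t at_) < f.2 -> d < V.
  move=> hf; suff: 0 < oval z.
    by rewrite ez mulrA pmulr_rgt0 // subr_gt0.
  case: inv => [[e h]|[h1 h2]|[h1 h2]]; [|by lra|by clear -hf h1; lia].
  move: h; rewrite ler_norml => /andP [h1 h2]; rewrite oval_cval -/G.
  have : (Posz (2 * cap t at_) + 1)%:~R <= f.2%:~R :> R by rewrite ler_int; clear -hf; lia.
  by rewrite rmorphD /= twoE e; nra.
have neg : f.2 < - Posz (2 * cap t at_) -> V < d.
  move=> hf; suff: oval z < 0.
    by rewrite ez mulrA pmulr_rlt0 // subr_lt0.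
  case: inv => [[e h]|[h1 h2]|[h1 h2]]; [|by clear -hf h1; lia|by lra].
  move: h; rewrite ler_norml => /andP [h1 h2]; rewrite oval_cval -/G.
  have : f.2%:~R <= (- (Posz (2 * cap t at_) + 1))%:~R :> R by rewrite ler_int; clear -hf; lia.
  by rewrite rmorphN rmorphD /= twoE e; nra.
have zer : f = (0, 0) -> V = d.
  move=> hf; rewrite hf /= in inv; case: inv => [[e h]|[h1 h2]|[h1 h2]]; [|by clear -h1; lia|by clear -h1; lia].
  move: ez; rewrite -e oval0 mulrA => /esym/eqP; rewrite mulf_eq0 (gt_eqF bG) /= subr_eq0.
  by move/eqP.
move: hd; rewrite /decided /holds; case/orP => [hd|/eqP hf].
  have f0 : (f == (0, 0)) = false.
    by apply/negbTE/negP => /eqP hf; move: hd; rewrite hf /=; clear; lia.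
  rewrite f0 andbF orbF; case: (lerP 0 f.2) => hs.
    have h : d < V by apply: pos; clear -hd hs; lia.
    rewrite (ltNge V) (ltW h) (leNgt V) h /= if_same; clear -hs; lia.
  have h : V < d by apply: neg; clear -hd hs; lia.
  rewrite (ltW h) h if_same; clear -hs hd; lia.
rewrite hf eqxx andbT (zer hf) ltxx lexx /=; case: (strict at_) => /=; clear; lia.
Qed.

Lemma dval_lin x (f g : block_letter -> int) w :
  dval t [seq x * f a + g a | a <- w] = x * dval t (map f w) + dval t (map g w).
Proof.
elim: w => [|a w IH] /=; first by rewrite /dval /= mulr0 addr0.
by rewrite !dval_cons IH !size_map; ring.
Qed.

Lemma oval_digits_lin s w : oval_digits (map (lin s) w) =
  \sum_(cv <- s) oval cv.1 * (dval t [seq digit (rev a) cv.2.1 cv.2.2 | a <- w])%:~R.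
Proof.
rewrite /oval_digits -!map_comp; elim: s => [|cv s IH].
  have h1 : map (fst \o lin [::]) w = nseq (size w) 0 by elim: (w) => //= a u ->.
  by rewrite big_nil h1 -[nseq _ _]cats0 dval_pad oval0.
rewrite big_cons -IH; set D := fun a => digit (rev a) cv.2.1 cv.2.2.
rewrite (eq_map (_ : fst \o lin (cv :: s) =1 fun a => cv.1.1 * D a + (fst \o lin s) a)) //.
rewrite (eq_map (_ : snd \o lin (cv :: s) =1 fun a => cv.1.2 * D a + (snd \o lin s) a)) //.
by rewrite !dval_lin /oval /= !rmorphD !rmorphM /=; ring.
Qed.

End Signs.

(** * Padding until every inequality is settled *)

Section Settling.
Variable t : nat.
Hypothesis t_gt2 : 2 < t.
Local Open Scope ring_scope.

Definition shift (z : point) : point := hstep t z (0, 0).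

(** If v is followed by w, the next second component is t w - v. Its absolute value is at least 3
    |w| - |v|, which exceeds |w| as soon as |v| < |w|. *)
Lemma shift_growing z : (`|z.2| < `|(shift z).2|)%N ->
  forall m, (m <= `|(iter m shift z).2|)%N /\ (`|(iter m shift z).2| < `|(iter m.+1 shift z).2|)%N.
Proof.
move=> hz; elim=> [|m [IH1 IH2]] //=; split; first exact: leq_ltn_trans IH2.
move: IH2; rewrite /=; case: (iter m shift z) => u v; rewrite /shift /hstep /= !addr0 !add0r.
set w := (u + Posz t * v)%R => h.
have h2 : (3 * `|w| <= `|(Posz t * w)%R|)%N by rewrite abszM leq_mul.
by move: (Posz t * w)%R h2 => x h2; lia.
Qed.

(** The orbit may begin along the contracting direction, but |v| can decrease only finitely often.
    When it first fails to decrease, growth sets in at once or, if |v| is repeated, one step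
    later. *)
Lemma shift_unbounded z : z != (0, 0) -> forall N, exists m, (N < `|(iter m shift z).2|)%N.
Proof.
move=> hz N; have [n le] : exists n, (`|z.2| <= n)%N by exists `|z.2|%N.
have grow y : (`|y.2| < `|(shift y).2|)%N -> exists m, (N < `|(iter m shift y).2|)%N.
  move=> /shift_growing /(_ N) [h1 h2]; exists N.+1; exact: leq_ltn_trans h2.
have next y : (exists m, (N < `|(iter m shift (shift y)).2|)%N) -> exists m, (N < `|(iter m shift y).2|)%N.
  by move=> [m h]; exists m.+1; rewrite iterSr.
elim: n z hz le => [|n IH] z hz le; case: (ltnP `|z.2| `|(shift z).2|) => h; try exact: grow.
  exfalso; move: hz le h; case: z => u v; rewrite /shift /hstep /= => hz le.
  have -> : v = 0 by lia.
  rewrite !addr0 mulr0 addr0 => h; have u0 : u = 0 by lia.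
  by move: hz; rewrite u0 (_ : v = 0) ?eqxx //; lia.
case: (ltnP `|(shift z).2| `|z.2|) => h'.
  apply: next; apply: IH; last by rewrite -ltnS; exact: leq_trans h' le.
  move: h' hz; case: z {le h} => u v; rewrite /shift /hstep /= !addr0 add0r => h' _.
  by apply/eqP => -[e1 e2]; lia.
apply: next; apply: grow; move: h h' hz; case: z {le} => u v; rewrite /shift /hstep /= !addr0 !add0r => h h' hz.
set w := (u + Posz t * v)%R in h h' *.
have h2 : (3 * `|w| <= `|(Posz t * w)%R|)%N by rewrite abszM leq_mul.
have w0 : (0 < `|w|)%N.
  case: (posnP `|w|) => // w0; move: hz; have v0 : v = 0 by lia.
  by move: w0; rewrite /w v0 mulr0 addr0 => u0; rewrite (_ : u = 0) ?eqxx //; lia.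
by move: (Posz t * w)%R h2 => x h2; lia.
Qed.

Lemma sstep0 E : sstep t E (0, 0) (0, 0) = (0, 0).
Proof. by rewrite /sstep /hstep /=; congr (_, _); lia. Qed.

Lemma settle E f : exists M, forall m, (M <= m)%N ->
  decided E (iter m (fun z => sstep t E z (0, 0)) f).
Proof.
have stay z : decided E z -> forall m, decided E (iter m (fun z => sstep t E z (0, 0)) z).
  move=> hz; elim=> // m; rewrite iterS; move: (iter m _ _) => y.
  case/orP => [h|/eqP ->]; first by rewrite /sstep (negbTE h) /decided h.
  by rewrite sstep0 /decided eqxx orbT.
suff [M hM] : exists M, decided E (iter M (fun z => sstep t E z (0, 0)) f).
  by exists M => m le; rewrite -(subnK le) iterD; apply: stay.
case: (eqVneq f (0, 0)) => [->|nz]; first by exists 0%N; rewrite /decided eqxx orbT.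
have [M hM] := shift_unbounded nz (2 * E).
elim: M f {nz} hM => [|M IH] f hM; first by exists 0%N; rewrite /decided -ltnNge hM.
case: (boolP (decided E f)) => [h|nd]; first by exists 0%N.
rewrite iterSr in hM; have [m h] := IH _ hM; exists m.+1; rewrite iterSr.
suff -> : sstep t E f (0, 0) = shift f by [].
by move: nd; rewrite /decided /sstep negb_or negbK => /andP [-> _].
Qed.

Lemma lin_zeros s ns : lin s (zeros ns) = (0, 0).
Proof.
have h b j : digit (rev (zeros ns)) b j = 0 by rewrite /zeros -map_rev digit_zeros.
by elim: s => //= cv s ->; rewrite h !mulr0 !addr0.
Qed.

(** The leading zeros appear at both ends of the palindrome: in front they leave the origin fixed,
    and at the back they continue the scheme from the previous result. *)
Lemma verdict_point_pad at_ ns m w : verdict_point t at_ (nseq m (zeros ns) ++ w) =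
  iter m (fun z => sstep t (cap t at_) z (0, 0)) (verdict_point t at_ w).
Proof.
rewrite /verdict_point es_cat [es at_ (nseq _ _)]map_nseq lin_zeros map_cat map_nseq rev_cat.
rewrite (_ : opp2 (0, 0) = (0, 0)) // (_ : rev (nseq m _) = nseq m (0, 0)); last first.
  by apply: (@eq_from_nth _ (0, 0)) => [|i]; rewrite size_rev size_nseq // => hi;
     rewrite nth_rev ?size_nseq // !nth_nseq !if_same.
have z0 : iter m (fun z => sstep t (cap t at_) z (0, 0)) (0, 0) = (0, 0).
  by elim: (m) => //= k ->; rewrite sstep0.
have zi x : foldl (sstep t (cap t at_)) x (nseq m (0, 0)) = iter m (fun z => sstep t (cap t at_) z (0, 0)) x.
  by elim: (m) x => //= k IH x; rewrite IH -iterSr.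
rewrite -/(es at_ w) (_ : _ ++ mid _ _ :: _ = nseq m (0, 0) ++
  (es at_ w ++ mid t (bound at_) :: rev (map opp2 (es at_ w))) ++ nseq m (0, 0)); last first.
  by rewrite -!catA.
by rewrite /run !foldl_cat !zi z0.
Qed.

Variable R : realFieldType.
Variable b : R.
Hypothesis b_gt1 : (1 < b)%R.
Hypothesis b_root : (b ^+ 2 = t%:R * b - 1)%R.

(** Words list the innermost block first, while variables count blocks from the outside; hence
    [rev]. *)
Definition atom_true (e : seq (seq int)) (at_ : atom) : bool :=
  let lhs := \sum_(cv <- terms at_) oval b cv.1 * (var_val (rev e) cv.2)%:~R in
  if strict at_ then lhs < oval b (bound at_) else lhs <= oval b (bound at_).

Definition valid_atom (ns : seq nat) (at_ : atom) : bool :=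
  all (fun cv => (cv.2.1 < size ns)%N && (cv.2.2 < nth 0%N (rev ns) cv.2.1)%N) (terms at_).

Lemma size_letter ns a : a \in alphabet t ns -> size a = size ns.
Proof. by rewrite mem_prodl => /all2_size_eq ->; rewrite size_map. Qed.

Lemma var_val_wval ns w i j : all (mem (alphabet t ns)) w -> (i < size ns)%N ->
  (j < nth 0%N (rev ns) i)%N ->
  var_val (rev (wval t ns w)) (i, j) = dval t [seq digit (rev a) i j | a <- w].
Proof.
move=> hw hi; rewrite nth_rev // => hj; rewrite /var_val /=.
have sw : size (wval t ns w) = size ns by rewrite size_map size_iota.
have hi' : (size ns - i.+1 < size ns)%N by lia.
rewrite nth_rev sw // (nth_map 0%N) ?size_iota // nth_iota // add0n.
rewrite (nth_map 0%N) ?size_iota // nth_iota // add0n; congr dval.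
rewrite /column; apply/eq_in_map => a ha; have sa := size_letter (allP hw _ ha).
by rewrite /digit nth_rev ?sa.
Qed.

Lemma atom_true_wval ns w at_ : all (mem (alphabet t ns)) w -> valid_atom ns at_ ->
  atom_true (wval t ns w) at_ =
  if strict at_ then oval_digits t b (es at_ w) < oval b (bound at_)
  else oval_digits t b (es at_ w) <= oval b (bound at_).
Proof.
move=> hw /allP hv; rewrite oval_digits_lin /atom_true.
suff -> : \sum_(cv <- terms at_) oval b cv.1 * (var_val (rev (wval t ns w)) cv.2)%:~R =
  \sum_(cv <- terms at_) oval b cv.1 * (dval t [seq digit (rev a) cv.2.1 cv.2.2 | a <- w])%:~R by [].
rewrite !big_seq; apply: eq_bigr => -[c [i j]] hcv; have /andP [/= h1 h2] := hv _ hcv.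
by rewrite (var_val_wval hw).
Qed.

Lemma body_recognises ats prog sg ns al : al =i alphabet t ns -> all (valid_atom ns) ats ->
  recognises t (body_nfa t ats prog sg al) ns
    (fun e => eval_prog prog (map (atom_true e) ats) = sg).
Proof.
move=> hal hv; split; first exact: well_formed_eq hal (body_well_formed _ _ _ _ _).
have key w : all (mem (alphabet t ns)) w ->
   all (fun at_ => decided (cap t at_) (verdict_point t at_ w)) ats ->
   map (atom_true (wval t ns w)) ats = [seq holds t at_ (verdict_point t at_ w) | at_ <- ats].
  move=> hw hd; apply/eq_in_map => at_ hat.
  by rewrite (atom_true_wval hw (allP hv _ hat)) (holds_correct t_gt2 b_gt1 b_root hw (allP hd _ hat)).
have pad m w : all (mem (alphabet t ns)) w -> all (mem (alphabet t ns)) (nseq m (zeros ns) ++ w).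
  move=> hw; rewrite all_cat hw andbT; apply/allP => a /nseqP [-> _]; exact: zeros_alphabet.
move=> w hw; split=> [h|[m /(body_accepts t_gt2 ats prog sg hal (pad m w hw)) [hd hs]]]; last first.
  by rewrite -(key _ (pad m w hw) hd) wval_pad in hs.
have [M hM] : exists M, all (fun at_ => decided (cap t at_) 
    (verdict_point t at_ (nseq M (zeros ns) ++ w))) ats.
  suff [M hM] : exists M, forall m, (M <= m)%N -> all (fun at_ => decided (cap t at_) 
    (verdict_point t at_ (nseq m (zeros ns) ++ w))) ats by exists M; exact: hM.
  elim: (ats) => [|at_ l [M IH]]; first by exists 0%N.
  have [M' hM'] := settle (cap t at_) (verdict_point t at_ w).
  exists (maxn M M') => m le /=; rewrite verdict_point_pad hM' ?IH //; lia.
exists M; apply/(body_accepts t_gt2 ats prog sg hal (pad M w hw)); split=> //.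
by rewrite -(key _ (pad M w hw) hM) wval_pad.
Qed.

End Settling.

(** * Parsing *)

(* The symbols are read from right to left.  The state consists of the number
   being read with the weight of its next digit, a saved number, a flag that
   holds inside a coefficient, the last coefficient, the pending variables, the
   inequalities and the postfix program found so far, the pending binary
   connectives, and the quantifier blocks found so far. *)
Definition pstate : Type :=
  ((((int * int) * (int * bool)) * ((int * int) * seq (nat * nat))) *
   ((seq atom * seq nat) * (seq nat * seq (bool * nat))))%type.

Definition mkp n w c1 inc cs vs ats prog ops blocks : pstate :=
  ((((n, w), (c1, inc)), (cs, vs)), ((ats, prog), (ops, blocks))).

Definition p_num (s : pstate) := s.1.1.1.1.
Definition p_w (s : pstate) := s.1.1.1.2.
Definition p_c1 (s : pstate) := s.1.1.2.1.
Definition p_inc (s : pstate) := s.1.1.2.2.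
Definition p_cs (s : pstate) := s.1.2.1.
Definition p_vs (s : pstate) := s.1.2.2.
Definition p_ats (s : pstate) := s.2.1.1.
Definition p_prog (s : pstate) := s.2.1.2.
Definition p_ops (s : pstate) := s.2.2.1.
Definition p_blocks (s : pstate) := s.2.2.2.

Definition atom0 : atom := (false, ([::], (0, 0)))%R.

Definition add_term (tm : (int * int) * (nat * nat)) (ats : seq atom) : seq atom :=
  (strict (head atom0 ats), (tm :: terms (head atom0 ats), bound (head atom0 ats))) :: behead ats.

(** Reading from the right supplies each binary digit with a known weight. Moreover [SAlpha]
    announces a coefficient before the ambiguous symbols [SPlus] and [SOpen] are met; the flag
    [p_inc] then tells their two uses apart. *)
Definition act (x : symbol) (s : pstate) : pstate :=
  match x with
  | SZero => mkp (p_num s) (p_w s + p_w s)%R (p_c1 s) (p_inc s) (p_cs s) (p_vs s) (p_ats s) (p_prog s) (p_ops s) (p_blocks s)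
  | SOne => mkp (p_num s + p_w s)%R (p_w s + p_w s)%R (p_c1 s) (p_inc s) (p_cs s) (p_vs s) (p_ats s) (p_prog s) (p_ops s) (p_blocks s)
  | SMinus => mkp (- p_num s)%R (p_w s) (p_c1 s) (p_inc s) (p_cs s) (p_vs s) (p_ats s) (p_prog s) (p_ops s) (p_blocks s)
  | SClose => s
  | SAlpha => mkp (p_num s) (p_w s) (p_c1 s) true (p_cs s) (p_vs s) (p_ats s) (p_prog s) (p_ops s) (p_blocks s)
  | SPlus => if p_inc s
      then mkp 0%R 1%R (p_num s) (p_inc s) (p_cs s) (p_vs s) (p_ats s) (p_prog s) (p_ops s) (p_blocks s)
      else mkp (p_num s) (p_w s) (p_c1 s) (p_inc s) (0, 0)%R [::]
             (add_term (p_cs s, head (0, 0) (p_vs s)) (p_ats s)) (p_prog s) (p_ops s) (p_blocks s)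
  | SOpen => if p_inc s
      then mkp 0%R 1%R 0%R false (p_num s, p_c1 s) (p_vs s) (p_ats s) (p_prog s) (p_ops s) (p_blocks s)
      else mkp (p_num s) (p_w s) (p_c1 s) (p_inc s) (p_cs s) (p_vs s) (p_ats s)
             (head 0 (p_ops s) :: p_prog s) (behead (p_ops s)) (p_blocks s)
  | SComma => mkp 0%R 1%R (p_num s) (p_inc s) (p_cs s) (p_vs s) (p_ats s) (p_prog s) (p_ops s) (p_blocks s)
  | SVar => mkp 0%R 1%R 0%R (p_inc s) (p_cs s) ((`|p_num s|, `|p_c1 s|)%N :: p_vs s) (p_ats s) (p_prog s) (p_ops s) (p_blocks s)
  | SLt => mkp (p_num s) (p_w s) (p_c1 s) (p_inc s) (0, 0)%R (p_vs s)
             ((true, ([::], p_cs s)) :: p_ats s) (0 :: p_prog s) (p_ops s) (p_blocks s)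
  | SLe => mkp (p_num s) (p_w s) (p_c1 s) (p_inc s) (0, 0)%R (p_vs s)
             ((false, ([::], p_cs s)) :: p_ats s) (0 :: p_prog s) (p_ops s) (p_blocks s)
  | SAnd => mkp (p_num s) (p_w s) (p_c1 s) (p_inc s) (p_cs s) (p_vs s) (p_ats s) (p_prog s) (2 :: p_ops s) (p_blocks s)
  | SOr => mkp (p_num s) (p_w s) (p_c1 s) (p_inc s) (p_cs s) (p_vs s) (p_ats s) (p_prog s) (3 :: p_ops s) (p_blocks s)
  | SNot => mkp (p_num s) (p_w s) (p_c1 s) (p_inc s) (p_cs s) (p_vs s) (p_ats s) (1 :: p_prog s) (p_ops s) (p_blocks s)
  | SForall => mkp (p_num s) (p_w s) (p_c1 s) (p_inc s) (p_cs s) [::] (p_ats s) (p_prog s) (p_ops s) ((false, size (p_vs s)) :: p_blocks s)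
  | SExists => mkp (p_num s) (p_w s) (p_c1 s) (p_inc s) (p_cs s) [::] (p_ats s) (p_prog s) (p_ops s) ((true, size (p_vs s)) :: p_blocks s)
  end.

Definition read (s : pstate) (l : seq symbol) : pstate := foldl (fun s x => act x s) s (rev l).

Lemma read_cat s l l' : read s (l ++ l') = read (read s l') l.
Proof. by rewrite /read rev_cat foldl_cat. Qed.

Lemma read_cons s x l : read s (x :: l) = act x (read s l).
Proof. by rewrite /read rev_cons foldl_rcons. Qed.

Lemma read_rcons s x l : read s (rcons l x) = read (act x s) l.
Proof. by rewrite /read rev_rcons. Qed.

Lemma read1 s x : read s [:: x] = act x s.
Proof. by []. Qed.

Definition clean cs vs ats prog ops blocks : pstate :=
  mkp 0%R 1%R 0%R false cs vs ats prog ops blocks.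

Section Reading.
Variables (c1 : int) (inc : bool) (cs : int * int) (vs : seq (nat * nat)) (ats : seq atom).
Variables (prog ops : seq nat) (blocks : seq (bool * nat)).
Local Notation st n w := (mkp n w c1 inc cs vs ats prog ops blocks).

Lemma read_pos p n w : exists w', read (st n w) (write_pos p) = st (n + w * Posz (nat_of_pos p))%R w'.
Proof.
elim: p n w => [p IH|p IH|] n w /=.
- rewrite read_rcons /act; have [w' ->] := IH (n + w)%R (w + w)%R.
  exists w'; congr (st _ _); rewrite /= NatTrec.doubleE; lia.
- rewrite read_rcons /act; have [w' ->] := IH n (w + w)%R.
  exists w'; congr (st _ _); rewrite /= NatTrec.doubleE; lia.
- by exists (w + w)%R; rewrite /read /= /act; congr (st _ _); rewrite /p_num /p_w /=; lia.
Qed.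

Lemma read_nat k : exists w', read (st 0%R 1%R) (write_nat k) = st (Posz k) w'.
Proof.
rewrite /write_nat; have := bin_of_natK k; case: (bin_of_nat k) => [|p] /= e.
  by exists 2%R; rewrite -e.
have [w' ->] := read_pos p 0%R 1%R; exists w'; congr (st _ _).
by rewrite -[in RHS]e; lia.
Qed.

Lemma read_int z : exists w', read (st 0%R 1%R) (write_int z) = st z w'.
Proof.
case: z => k; first exact: read_nat.
rewrite /write_int read_cons; have [w' ->] := read_nat k.+1.
by exists w'; rewrite /act; congr (st _ _); rewrite /=; lia.
Qed.

End Reading.

Lemma read_coef cs vs ats prog ops blocks c :
  read (clean cs vs ats prog ops blocks) (write_coef c) = clean c vs ats prog ops blocks.
Proof.
case: c => z1 z2; rewrite /write_coef read_cons read_cat read_cons read_cat.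
rewrite {3}/read /=.
have [w' /= e] := read_int 0%R true cs vs ats prog ops blocks z2.
rewrite /act /= e /=.
have [w'' /= e2] := read_int z2 true cs vs ats prog ops blocks z1.
by rewrite /p_c1 /= in e2 *; rewrite e2.
Qed.

Lemma read_var cs vs ats prog ops blocks v :
  read (clean cs vs ats prog ops blocks) (write_var v) = clean cs (v :: vs) ats prog ops blocks.
Proof.
case: v => i j; rewrite /write_var read_cons read_cat read_cons.
have [w' /= e] := read_nat 0%R false cs vs ats prog ops blocks j.
rewrite e /=.
have [w'' /= e2] := read_nat (Posz j) false cs vs ats prog ops blocks i.
by rewrite e2.
Qed.

Fixpoint fats (phi : formula) : seq atom :=
  match phi with
  | Ineq b s d => [:: (b, (s, d))]
  | Not f => fats f
  | And f g | Or f g => fats f ++ fats g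
  end.

(** Prefix order, as the parser produces it. The reversed list is the postfix program, which
    consumes the inequalities from the last to the first. *)
Fixpoint fprog (phi : formula) : seq nat :=
  match phi with
  | Ineq _ _ _ => [:: 0]
  | Not f => 1 :: fprog f
  | And f g => 2 :: fprog f ++ fprog g
  | Or f g => 3 :: fprog f ++ fprog g
  end.

Lemma read_formula phi ats prog ops blocks :
  read (clean (0, 0)%R [::] ats prog ops blocks) (write_formula phi) =
  clean (0, 0)%R [::] (fats phi ++ ats) (fprog phi ++ prog) ops blocks.
Proof.
elim: phi ats prog ops => [b s d|f IH|f IHf g IHg|f IHf g IHg] ats prog ops /=.
- rewrite read_cat read_cons read_coef.
  have -> : act (if b then SLt else SLe) (clean d [::] ats prog ops blocks) =
    clean (0, 0)%R [::] ((b, ([::], d)) :: ats) (0 :: prog) ops blocks by case: b.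
  elim: s => [|[c v] s IH]; first by [].
  rewrite (_ : flatten _ = SPlus :: (write_coef c ++ write_var v) ++
    flatten [seq SPlus :: write_coef cv.1 ++ write_var cv.2 | cv <- s]) //.
  by rewrite read_cons !read_cat IH read_var read_coef.
- by rewrite read_cons IH.
- by rewrite read_cons read_cat read_cons read_cat read1 [act SClose _]/= IHg [act _ _]/= IHf /= -!catA.
- by rewrite read_cons read_cat read_cons read_cat read1 [act SClose _]/= IHg [act _ _]/= IHf /= -!catA.
Qed.

Fixpoint pblocks (q : quantifier) (ns : seq nat) : seq (bool * nat) :=
  if ns is n :: ns' then (if q is Exists then true else false, n) :: pblocks (dual q) ns' else [::].

Lemma read_vars cs vs ats prog ops blocks i js :
  read (clean cs vs ats prog ops blocks) (flatten [seq write_var (i, j) | j <- js]) =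
  clean cs ([seq (i, j) | j <- js] ++ vs) ats prog ops blocks.
Proof.
elim: js => [|j js IH]; first by [].
rewrite (_ : flatten _ = write_var (i, j) ++ flatten [seq write_var (i, j) | j <- js]) //.
by rewrite read_cat IH read_var.
Qed.

Lemma read_prefix q i ns ats prog ops :
  read (clean (0, 0)%R [::] ats prog ops [::]) (write_prefix q i ns) =
  clean (0, 0)%R [::] ats prog ops (pblocks q ns).
Proof.
elim: ns q i => [|n ns IH] q i //=.
rewrite read_cons read_cat IH read_vars cats0.
by case: q; rewrite /= /act /= size_map size_iota.
Qed.

Definition code_of (x : symbol) : seq bool := rev (symbol_bits x).

Definition chunk_step (z : seq bool * seq (seq bool)) (b : bool) : seq bool * seq (seq bool) :=
  if size z.1 == 3 then ([::], (b :: z.1) :: z.2) else (b :: z.1, z.2).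

Definition chunks (w : seq bool) : seq (seq bool) := (foldl chunk_step ([::], [::]) w).2.

(** Consing reverses both the bits of a symbol and the sequence of symbols; the former is matched by
    [code_of], and the latter is the order in which the parser wants to read. *)
Lemma chunks_symbols (l : seq symbol) :
  chunks (flatten [seq symbol_bits x | x <- l]) = rev [seq code_of x | x <- l].
Proof.
suff H out : foldl chunk_step ([::], out) (flatten [seq symbol_bits x | x <- l]) =
    ([::], rev [seq code_of x | x <- l] ++ out) by rewrite /chunks H cats0.
elim: l out => [|x l IH] out; first by [].
rewrite [flatten _]/= foldl_cat rev_cons cat_rcons -IH.
by congr foldl; case: x.
Qed.

(** [SClose] has no effect and falls under the default. *)
Definition pstep (s : pstate) (g : seq bool) : pstate :=
  if g == code_of SZero then act SZero s else
  if g == code_of SOne then act SOne s else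
  if g == code_of SMinus then act SMinus s else
  if g == code_of SAlpha then act SAlpha s else
  if g == code_of SPlus then act SPlus s else
  if g == code_of SOpen then act SOpen s else
  if g == code_of SComma then act SComma s else
  if g == code_of SVar then act SVar s else
  if g == code_of SLt then act SLt s else
  if g == code_of SLe then act SLe s else
  if g == code_of SAnd then act SAnd s else
  if g == code_of SOr then act SOr s else
  if g == code_of SNot then act SNot s else
  if g == code_of SForall then act SForall s else
  if g == code_of SExists then act SExists s else s.

Lemma pstep_code s x : pstep s (code_of x) = act x s.
Proof. by case: x. Qed.

Definition pstate0 : pstate := clean (0, 0)%R [::] [::] [::] [::] [::].

Definition parse_bits (w : seq bool) : pstate := foldl pstep pstate0 (chunks w).

Lemma parse_encode r (S : sentence r) : parse_bits (encode S) =
  clean (0, 0)%R [::] (fats (body S)) (fprog (body S)) [::]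
    (pblocks (first_quantifier S) (dims S)).
Proof.
rewrite /parse_bits /encode chunks_symbols -map_rev.
set l := _ ++ _.
have -> : foldl pstep pstate0 (map code_of (rev l)) = read pstate0 l.
  by rewrite /read; elim: (rev l) pstate0 => //= x s IH p; rewrite pstep_code IH.
by rewrite /l read_cat read_formula !cats0 read_prefix.
Qed.

Lemma eval_prog_formula (T : bool -> seq ((int * int) * (nat * nat)) -> (int * int) -> bool)
    (V : formula -> bool) (phi : formula) :
  (forall b s d, V (Ineq b s d) = T b s d) -> (forall f, V (Not f) = ~~ V f) ->
  (forall f g, V (And f g) = V f && V g) -> (forall f g, V (Or f g) = V f || V g) ->
  eval_prog (rev (fprog phi)) [seq T a.1 a.2.1 a.2.2 | a <- rev (fats phi)] = V phi.
Proof.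
move=> h0 h1 h2 h3; set tr := fun a : atom => T a.1 a.2.1 a.2.2.
suff H st bs : foldl eval_step (st, map tr (rev (fats phi)) ++ bs) (rev (fprog phi)) = (V phi :: st, bs).
  by rewrite /eval_prog -[map _ _]cats0 H.
elim: phi st bs => [b s d|f IH|f IHf g IHg|f IHf g IHg] st bs /=.
- by rewrite h0.
- by rewrite rev_cons foldl_rcons IH /= h1.
- by rewrite rev_cons foldl_rcons !rev_cat map_cat -catA foldl_cat IHg IHf /= h2.
- by rewrite rev_cons foldl_rcons !rev_cat map_cat -catA foldl_cat IHg IHf /= h3.
Qed.

(** * A quadratic unit *)

Section QuadraticUnit.
Local Open Scope ring_scope.

(* (a, (b, c)) is the binary form a x^2 + b x y + c y^2. *)
Definition form : Type := (int * (int * int))%type.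
Definition disc (f : form) : int := f.2.1 * f.2.1 - Posz 4 * (f.1 * f.2.2).
Definition indefinite (f : form) : bool := (0 < f.1) && (f.2.2 < 0).

(** A step along the river in Conway's topograph of the form: the value s at (1, 1) replaces that
    one of the values a > 0 > c which has the same sign. *)
Definition reduce (f : form) : form :=
  let s := f.1 + f.2.1 + f.2.2 in
  if 0 < s then (s, (f.2.1 + Posz 2 * f.2.2, f.2.2)) else (f.1, (f.2.1 + Posz 2 * f.1, s)).

Lemma disc_reduce f : disc (reduce f) = disc f.
Proof. by case: f => a [b c]; rewrite /reduce /disc; case: ifP => _ /=; ring. Qed.

Definition carries (p q r s : int) (f g : form) : Prop :=
  [/\ g.1 = f.1 * p * p + f.2.1 * p * r + f.2.2 * r * r,
      g.2.1 = Posz 2 * f.1 * p * q + f.2.1 * (p * s + q * r) + Posz 2 * f.2.2 * r * s &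
      g.2.2 = f.1 * q * q + f.2.1 * q * s + f.2.2 * s * s].

Section Cycle.
Variable D : int.
Hypothesis nonsquare : forall x : int, x * x <> D.

Lemma reduce_indefinite f : disc f = D -> indefinite f -> indefinite (reduce f).
Proof.
case: f => a [b c]; rewrite /reduce /disc /indefinite /= => hD /andP [ha hc].
case: ifP => /= hs; first by rewrite hs hc.
(* If s were 0, the discriminant would be the square of a - c. *)
rewrite ha /= lt_neqAle leNgt hs andbT; apply/eqP => e.
apply: (nonsquare (x := a - c)); rewrite -hD.
have -> : b = - a - c by lia.
ring.
Qed.

Lemma orbit_invariant f k : disc f = D -> indefinite f ->
  disc (iter k reduce f) = D /\ indefinite (iter k reduce f).
Proof.
move=> hD hf; elim: k => // k [h1 h2].
by rewrite iterS disc_reduce; split=> //; exact: reduce_indefinite.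
Qed.

(** Each step multiplies by an elementary matrix with non-negative entries, which raises the sum of
    the entries by at least one. An orbit that returns to its start therefore yields an automorphism
    other than the identity. *)
Lemma orbit_carries f k : disc f = D -> indefinite f ->
  exists p q r s, [/\ [/\ 0 <= p, 0 <= q, 0 <= r & 0 <= s], p * s - q * r = 1,
    Posz k + 2 <= p + q + r + s & carries p q r s f (iter k reduce f)].
Proof.
move=> hD hf; elim: k => [|k [p [q [r [s [[h1 h2 h3 h4] hd hk [e1 e2 e3]]]]]]].
  by exists 1, 0, 0, 1; split; [split | | | split] => //=; lia.
rewrite iterS; set g := iter k reduce f in e1 e2 e3 *; rewrite /reduce; case: ifP => _.
  exists (p + q), q, (r + s), s; split; [by split; lia | by rewrite -hd; ring | | ].
    by have h : 1 <= q + s; [nia | lia].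
  by split=> /=; rewrite ?e1 ?e2 ?e3; ring.
exists p, (p + q), r, (r + s); split; [by split; lia | by rewrite -hd; ring | | ].
  by have h : 1 <= p + r; [nia | lia].
by split=> /=; rewrite ?e1 ?e2 ?e3; ring.
Qed.

(** An automorphism of the form satisfies a (s - p) = b r and a q = - c r. Substituted into the
    determinant, these equations say that its trace solves a Pell equation for the discriminant. *)
Lemma carries_self p q r s f : 0 < f.1 -> f.2.2 < 0 -> 0 <= p -> 0 <= q -> 0 <= r -> 0 <= s ->
  p * s - q * r = 1 -> 3 <= p + q + r + s -> carries p q r s f f ->
  0 < r /\ f.1 * f.1 * ((p + s) * (p + s) - Posz 4) = disc f * (r * r).
Proof.
case: f => a [b c] /= ha hc hp hq hr hs hd hk [/= e1 e2 e3].
have h1 : a * (s - p) = b * r.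
  have : s * (Posz 2 * (a * p * p + b * p * r + c * r * r)) -
     r * (Posz 2 * a * p * q + b * (p * s + q * r) + Posz 2 * c * r * s) =
     (Posz 2 * a * p + b * r) * (p * s - q * r) by ring.
  by rewrite -e1 -e2 hd; lia.
have h2 : a * q = - (c * r).
  have : s * (Posz 2 * a * p * q + b * (p * s + q * r) + Posz 2 * c * r * s) -
     r * (Posz 2 * (a * q * q + b * q * s + c * s * s)) =
     (Posz 2 * a * q + b * s) * (p * s - q * r) by ring.
  by rewrite -e2 -e3 hd; lia.
have r0 : 0 < r.
  (* With r = 0 only the identity would be left, whose entries add up to 2. *)
  rewrite lt_neqAle hr andbT; apply/eqP => r0; rewrite -r0 in h1 h2 hd hk.
  by nia.
split=> //; rewrite /disc /=.
have -> : a * a * ((p + s) * (p + s) - Posz 4) =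
  (a * (s - p)) * (a * (s - p)) + Posz 4 * (a * q) * (a * r) + Posz 4 * a * a * (p * s - q * r - 1) by ring.
by rewrite h1 h2 hd; ring.
Qed.

End Cycle.

(** Pigeonhole on the orbit of x^2 - D y^2: since a > 0 > c, both b^2 and 4 a |c| are bounded by the
    discriminant 4 D, so that only finitely many forms can occur. *)
Lemma unit_trace D : 0 < D -> (forall x : int, x * x <> Posz 4 * D) -> exists (t : nat) (a r : int),
  [/\ (2 < t)%N, 0 < a, 0 < r & a * a * (Posz t * Posz t - Posz 4) = Posz 4 * D * (r * r)].
Proof.
move=> D0 ns; pose f0 : form := (1, (0, - D)).
have hD0 : disc f0 = Posz 4 * D by rewrite /disc /=; ring.
have i0 : indefinite f0 by rewrite /indefinite /=; lia.
pose g k := iter k reduce f0.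
have hg k : disc (g k) = Posz 4 * D /\ indefinite (g k) := orbit_invariant ns k hD0 i0.
pose enum k := [:: (g k).1; (g k).2.1; (g k).2.2].
pose L := prodl (nseq 3 (irange `|Posz 4 * D|)).
have hL k : enum k \in L.
  rewrite mem_prodl all2_nseq_r /= !mem_irange andbT.
  have [] := hg k; rewrite /disc /indefinite; case: (g k) => a [b c] /= hd /andP [ha hc].
  have : 0 <= b * b by nia.
  have : a <= Posz 4 * D by nia.
  have : - c <= Posz 4 * D by nia.
  have : b <= Posz 4 * D /\ - b <= Posz 4 * D by split; nia.
  by move=> [h1 h2] h3 h4 _; apply/and3P; split; lia.
have : ~~ uniq [seq enum k | k <- iota 0 (size L).+1].
  apply/negP => u; have := uniq_leq_size u; rewrite size_map size_iota => /(_ L).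
  have sub : {subset [seq enum k | k <- iota 0 (size L).+1] <= L} by move=> x /mapP [k _ ->].
  by move=> /(_ sub); rewrite ltnn.
case/(uniqPn [::]) => i [j [ij]]; rewrite size_map size_iota => hj.
have hi := ltn_trans ij hj.
rewrite !(nth_map 0%N) ?size_iota // !nth_iota // !add0n => -[e1 e2 e3].
have eg : g j = g i by move: e1 e2 e3; case: (g i) => a [b c]; case: (g j) => a' [b' c'] /= -> -> ->.
have [hd hi'] := hg i.
have [p [q [r [s [[h1 h2 h3 h4] h5 h6 h7]]]]] := orbit_carries (j - i) hd hi'.
rewrite -iterD subnK ?(ltnW ij) // -/(g j) eg in h7.
have [ha hc] := andP hi'.
have [|r0 e] := carries_self ha hc h1 h2 h3 h4 h5 _ h7; first by lia.
exists `|(p + s)%R|%N, (g i).1, r; split=> //; last by rewrite gez0_abs ?e ?hd //; lia.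
have : 0 < (g i).1 * (g i).1 * ((p + s) * (p + s) - Posz 4).
  by rewrite e hd; nia.
by move=> h; have : 0 < (p + s) * (p + s) - Posz 4; [nia | nia].
Qed.

Section Unit.
Variables (R : realType) (alpha : R).

Theorem quadratic_unit : quadratic_irrational alpha ->
  exists (t : nat) (b : R), [/\ (2 < t)%N, 1 < b, b ^+ 2 = t%:R * b - 1 &
    exists (m : nat) (A B : int), (0 < m)%N /\ m%:R * alpha = A%:~R + B%:~R * b].
Proof.
move=> [irr [p [sp rp]]].
set a := p`_2; set b := p`_1; set c := p`_0.
have a0 : a != 0 by have := lead_coef_eq0 p; rewrite lead_coefE sp /= => ->; rewrite -size_poly_eq0 sp.
have root_eq : a%:~R * alpha ^+ 2 + b%:~R * alpha + c%:~R = 0 :> R.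
  move: rp; rewrite /root horner_poly sp !big_ord_recr big_ord0 /= => /eqP <-.
  by rewrite expr0 expr1 -/a -/b -/c; ring.
(* Thus y is a square root of the discriminant; it is irrational together with [alpha]. *)
pose D := b * b - Posz 4 * (a * c); pose y := 2%:R * a%:~R * alpha + b%:~R.
have aR0 : a%:~R != 0 :> R by rewrite intr_eq0.
have y2 : y * y = D%:~R.
  rewrite /y /D !(rmorphB, rmorphM) /=.
  have -> : c%:~R = - (a%:~R * alpha ^+ 2 + b%:~R * alpha) :> R by rewrite -[RHS]addr0 -root_eq; ring.
  by rewrite -[(Posz 4)%:~R]/(4%:R : R); ring.
have y_irr (z : int) (n : int) : n != 0 -> n%:~R * y = z%:~R -> False.
  move=> n0 e; apply: irr; exists ((z%:~R - n%:~R * b%:~R) / (n%:~R * 2%:R * a%:~R)) => //.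
  have nR0 : n%:~R != 0 :> R by rewrite intr_eq0.
  rewrite fmorph_div !rmorphM !rmorphB !rmorphM /= !ratr_int ratr_nat -e /y.
  by field; rewrite nR0 aR0.
have hy : y = 2%:R * a%:~R * alpha + b%:~R by [].
clearbody D y.
have D0 : 0 < D.
  rewrite -(ltr_int R) -y2 lt_neqAle -expr2 sqr_ge0 andbT eq_sym sqrf_eq0.
  by apply/eqP => y0; apply: (y_irr 0 1) => //; rewrite y0 mulr0.
have ns x : x * x <> Posz 4 * D.
  move=> e; have : (2%:R * y - x%:~R) * (2%:R * y + x%:~R) = 0.
    have : (x * x)%:~R = (Posz 4 * D)%:~R :> R by rewrite e.
    rewrite !rmorphM /= -y2 -[(Posz 4)%:~R]/(4%:R : R) => h.
    have -> : (2%:R * y - x%:~R) * (2%:R * y + x%:~R) = 4%:R * (y * y) - x%:~R * x%:~R by ring.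
    by rewrite h subrr.
  move/eqP; rewrite mulf_eq0 => /orP [/eqP h|/eqP h].
    by apply: (y_irr x 2) => //; apply/eqP; rewrite -subr_eq0 -h.
  apply: (y_irr (- x) 2) => //; rewrite rmorphN; apply/eqP; rewrite -subr_eq0 opprK.
  by rewrite -h.
have [t [u [r [t2 u0 r0 e]]]] := unit_trace D0 ns.
have uR : 0 < u%:~R :> R by rewrite ltr0z.
have rR : 0 < r%:~R :> R by rewrite ltr0z.
(* By the Pell equation this is the square root of t^2 - 4, so (t + w)/2 is the required unit. *)
pose w := 2%:R * `|y| * r%:~R / u%:~R : R.
have w2 : w * w = t%:R * t%:R - 4%:R.
  have := congr1 (fun z : int => z%:~R : R) e.
  rewrite /= !(rmorphB, rmorphM) /= -y2 -[(Posz 4)%:~R]/(4%:R : R) -[(Posz t)%:~R]/(t%:R : R) => e'.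
  have hn : `|y| * `|y| = y * y by rewrite -normrM ger0_norm // -expr2 sqr_ge0.
  have -> : w * w = 4%:R * (`|y| * `|y|) * (r%:~R * r%:~R) / (u%:~R * u%:~R).
    by rewrite /w; field; rewrite gt_eqF.
  by rewrite hn -e'; field; rewrite gt_eqF.
have w0 : 0 <= w.
  by apply: divr_ge0; [apply: mulr_ge0; [apply: mulr_ge0|]|]; rewrite ?ler0n ?normr_ge0 // ltW.
have t3 : 3%:R <= t%:R :> R by rewrite ler_nat.
pose s : int := if 0 <= y then 1 else -1.
have sy : s%:~R * `|y| = y.
  rewrite /s; case: (lerP 0 y) => h; first by rewrite mulr1z mul1r ger0_norm.
  by rewrite rmorphN1 mulN1r ltr0_norm // opprK.
pose e0 : int := if 0 <= a then 1 else -1.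
have ea : e0 * a = `|a|%N.
  by rewrite /e0; case: (lerP 0 a) => h; lia.
exists t, ((t%:R + w) / 2%:R); split=> //.
- by lra.
- by rewrite expr2; have : (t%:R + w) * (t%:R + w) = 2%:R * t%:R * (t%:R + w) - 4%:R; [lra | move=> h; lra].
(* The witnesses come from 2 a alpha = y - b, where 2 r |y| = u w and w is twice the unit minus t.
   The signs [s] of y and [e0] of a are needed because the multiplier has to be positive. *)
exists (4 * `|a| * `|r|)%N, (e0 * (- s * u * Posz t - Posz 2 * r * b)), (e0 * (Posz 2 * s * u)); split.
  by rewrite !muln_gt0 /= !absz_gt0 a0 gt_eqF.
have -> : (4 * `|a| * `|r|)%N%:R = 4%:R * (e0%:~R * a%:~R) * r%:~R :> R.
  by rewrite -intrM ea !natrM !natr_absz (gtr0_norm r0).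
have hw : u%:~R * w = 2%:R * `|y| * r%:~R by rewrite /w; field; rewrite gt_eqF.
have hal : 2%:R * a%:~R * alpha = y - b%:~R by rewrite hy; ring.
have -> : 4%:R * (e0%:~R * a%:~R) * r%:~R * alpha = e0%:~R * (2%:R * r%:~R * (2%:R * a%:~R * alpha)) :> R by ring.
rewrite hal -{1}sy !(rmorphB, rmorphM, rmorphN) /= -[(Posz t)%:~R]/(t%:R : R) -[(Posz 2)%:~R]/(2%:R : R).
have -> : 2%:R * r%:~R * (s%:~R * `|y| - b%:~R) = s%:~R * (2%:R * `|y| * r%:~R) - 2%:R * r%:~R * b%:~R :> R by ring.
by rewrite -hw; field.
Qed.

End Unit.

End QuadraticUnit.

(** * The decision procedure *)

HB.instance Definition _ := hasDecEq.Build tree eqtreeP.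

#[export] Instance encinj_tree : EncInj tree.
Proof. by []. Qed.

Definition nfa_map (Q Q' : Type) (f : Q -> Q') (A : nfa Q) : nfa Q' :=
  ((map f (states A), map f (initial A)),
   ([seq (f e.1, (e.2.1, f e.2.2)) | e <- trans A], map f (final A))).

Section NfaMap.
Variables (Q Q' : eqType) (f : Q -> Q').
Hypothesis f_inj : injective f.

Lemma mem_trans_map (A : nfa Q) p a q :
  ((f p, (a, f q)) \in trans (nfa_map f A)) = ((p, (a, q)) \in trans A).
Proof.
apply/mapP/idP => [[[p' [a' q']] h [/f_inj -> -> /f_inj ->]] //|h].
by exists (p, (a, q)).
Qed.

Lemma steps_map (A : nfa Q) w p q : steps (nfa_map f A) (f p) w q <->
  exists2 q', q = f q' & steps A p w q'.
Proof.
elim: w p q => [|a w IH] p q /=; first by split=> [<-|[q' -> ->]] //; exists p.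
split=> [[p' /mapP [[p0 [a0 q0]] h [/f_inj e -> ->]] /IH [q' -> hs]]|[q' -> [p' h hs]]].
  by exists q' => //; exists q0 => //; rewrite e.
by exists (f p'); rewrite ?mem_trans_map //; apply/IH; exists q'.
Qed.

Lemma accepts_map (A : nfa Q) w : accepts (nfa_map f A) w <-> accepts A w.
Proof.
split=> [[p [q [/mapP [p' hp ->] /mapP [q' hq ->] /steps_map [q'' /f_inj e hs]]]]|[p [q [hp hq hs]]]].
  by exists p', q'; rewrite -e in hs; split.
by exists (f p), (f q); split; try exact: map_f; apply/steps_map; exists q.
Qed.

Lemma recognises_map t (A : nfa Q) ns P : recognises t A ns P -> recognises t (nfa_map f A) ns P.
Proof.
move=> [[h1 h2 h3] h4]; split; first split.
- by move=> x /mapP [p /h1 hp ->]; apply: map_f.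
- by move=> x /mapP [p /h2 hp ->]; apply: map_f.
- by move=> x a y /mapP [[p [a' q]] /h3 [k1 k2 k3] [-> -> ->]]; split=> //; apply: map_f.
move=> w /h4 ->; split=> -[m h]; exists m; exact/accepts_map.
Qed.

End NfaMap.

(* [det] projects the innermost block away, determinizes and complements.  Its states
   are encoded again as trees so that the automata of all levels have the same type. *)
Definition level (z : nfa tree * seq block_letter) : nfa tree * seq block_letter :=
  (nfa_map enc (det z.1 (map behead z.2)), map behead z.2).

(** What the automata compute, whatever the quantifiers are: a negated existential for each block
    but the outermost, and a plain search for the last one. *)
Fixpoint game (ns : seq nat) (P : seq (seq int) -> Prop) : Prop :=
  match ns with
  | [::] => True
  | [:: n] => exists2 xs, size xs = n & P [:: xs]
  | n :: ns' => game ns' (fun e => ~ exists2 xs, size xs = n & P (xs :: e))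
  end.

Lemma levels_correct t ns z P : 2 < t -> ns != [::] ->
  z.2 =i alphabet t ns -> recognises t z.1 ns P ->
  let A := (foldl (fun z _ => level z) z (behead ns)).1 in
  has (mem (final A)) (clos A) <-> game ns P.
Proof.
move=> t2; elim: ns z P => [|n [|n' ns] IH] z P // _ hal hr.
  exact: (clos_recognises t2 hr).
apply: (IH (level z)) => // [a|].
  rewrite -(behead_alphabet t2 n); apply/mapP/mapP => -[b hb ->];
  by exists b; rewrite // ?hal // -hal.
apply: recognises_map; first exact: (@enc_inj (seq tree)).
exact: det_recognises.
Qed.

Section Semantics.
Variables (R : realType) (alpha : R) (phi : formula).

Definition is_exists (q : quantifier) : bool := if q is Exists then true else false.

Lemma exists_tuple n (P : seq int -> Prop) :
  (exists x : n.-tuple int, P x) <-> exists2 xs, size xs = n & P xs.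
Proof.
split=> [[x h]|[xs h1 h2]]; first by exists x; rewrite ?size_tuple.
by exists (tcast h1 (in_tuple xs)); rewrite val_tcast.
Qed.

Lemma forall_tuple n (P : seq int -> Prop) :
  (forall x : n.-tuple int, P x) <-> ~ exists2 xs, size xs = n & ~ P xs.
Proof.
split=> [h [xs /eqP h1 h2]|h x]; first exact: h2 (h (Tuple h1)).
by apply: contrapT => hx; apply: h; exists x; rewrite ?size_tuple.
Qed.

(** The predicate stands for truth below an existential quantifier and for falsity below a universal
    one. A negated existential turns either reading into the one that suits the next quantifier
    outwards, because the quantifiers alternate. *)
Lemma game_quantified q ns suf P : ns != [::] ->
  (forall e, P e <-> (quantified_true alpha (iter (size ns) dual q) suf (rev e) phi <->
                      is_exists (iter (size ns).-1 dual q))) ->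
  game ns P <-> (quantified_true alpha q (rev ns ++ suf) [::] phi <-> is_exists q).
Proof.
elim: ns suf P => [|n ns IH] suf P // _ hP.
have next e : (~ exists2 xs, size xs = n & P (xs :: e)) <->
   (quantified_true alpha (iter (size ns) dual q) (n :: suf) (rev e) phi <->
     ~~ is_exists (iter (size ns) dual q)).
  have hP' xs : P (xs :: e) <-> (quantified_true alpha (dual (iter (size ns) dual q)) suf (rcons (rev e) xs) phi
      <-> is_exists (iter (size ns) dual q)).
    by rewrite hP rev_cons.
  case: (iter (size ns) dual q) hP' => /= hP'.
    have ft := @forall_tuple n (fun xs => quantified_true alpha Exists suf (rcons (rev e) xs) phi).
    split=> [h|[_ h]].
      split=> // _; apply/ft => -[xs h1 h2]; apply: h; exists xs => //.
      by apply/hP'; split=> // h3.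
    move=> [xs h1 /hP' h2]; have /ft := h isT; apply; exists xs => // h3.
    by have : false by apply/h2.
  have et := @exists_tuple n (fun xs => quantified_true alpha Forall suf (rcons (rev e) xs) phi).
  split=> [h|[h _]].
    split=> // /et [xs h1 h2]; exfalso; apply: h; exists xs => //.
    by apply/hP'; split.
  move=> [xs h1 /hP' h2]; suff: false by [].
  by apply: h; apply/et; exists xs => //; apply/h2.
case: ns IH hP next => [|n' ns] IH hP next.
  rewrite /=; have hn := next [::]; rewrite /rev /= in hn.
  (* The outermost block is searched without complementation; a double negation makes [next]
     applicable. *)
  have -> : (exists2 xs, size xs = n & P [:: xs]) <-> ~ ~ (exists2 xs, size xs = n & P [:: xs]).
    by split=> [h k|/contrapT].
  rewrite hn /=; case: (is_exists q) => /=; split.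
  - move=> h; split=> // _; apply: contrapT => k; apply: h; split=> //.
  - by move=> h [k _]; have : false by apply: k; apply/h.
  - by move=> h; split=> // k; exfalso; apply: h; split=> // _; exact: k.
  - by move=> h [_ k]; have : false by apply/h; exact: k.
rewrite rev_cons cat_rcons; apply: (IH (n :: suf)) => // e.
by rewrite next /=; case: (iter (size ns) dual q).
Qed.

End Semantics.

Section Decision.
Variables (t m : nat) (A B : int).

Definition scale (c : int * int) : int * int := (Posz m * c.1 + A * c.2, B * c.2)%R.

Definition scale_atom (a : atom) : atom :=
  (strict a, ([seq (scale cv.1, cv.2) | cv <- terms a], scale (bound a))).

Definition innermost_dims (s : pstate) : seq nat := rev (map snd (p_blocks s)).
Definition innermost_sign (s : pstate) : bool := (head (false, 0) (rev (p_blocks s))).1.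
Definition atoms (s : pstate) : seq atom := map scale_atom (rev (p_ats s)).
Definition first_nfa (s : pstate) : nfa tree :=
  nfa_map enc (body_nfa t (atoms s) (rev (p_prog s)) (innermost_sign s) (alphabet t (innermost_dims s))).
Definition last_nfa (s : pstate) : nfa tree * seq block_letter :=
  foldl (fun z _ => level z) (first_nfa s, alphabet t (innermost_dims s)) (behead (innermost_dims s)).
Definition decide_state (s : pstate) : bool :=
  let A := (last_nfa s).1 in
  has (mem (final A)) (clos A) == (head (false, 0) (p_blocks s)).1.
Definition decide (w : seq bool) : bool := decide_state (parse_bits w).

Lemma pblocks_dims q ns : map snd (pblocks q ns) = ns.
Proof. by elim: ns q => //= n ns IH q; rewrite IH. Qed.

Lemma pblocks_last q ns : ns != [::] ->
  (head (false, 0) (rev (pblocks q ns))).1 = is_exists (iter (size ns).-1 dual q).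
Proof.
elim: ns q => [|n [|n' ns] IH] q // _.
have := IH (dual q) isT; rewrite [pblocks q _]/= rev_cons.
case e : (rev (pblocks (dual q) (n' :: ns))) => [|x s] /=; last by rewrite -iterSr.
by have := congr1 size e; rewrite size_rev.
Qed.

Variables (R : realType) (alpha b : R).
Hypotheses (t_gt2 : 2 < t) (m_gt0 : 0 < m) (b_gt1 : (1 < b)%R).
Hypothesis b_root : (b ^+ 2 = t%:R * b - 1)%R.
Hypothesis alphaE : (m%:R * alpha = A%:~R + B%:~R * b)%R.

Lemma oval_scale c : (oval b (scale c) = m%:R * coef_val alpha c)%R.
Proof.
rewrite /oval /scale /coef_val /= !rmorphD !rmorphM /= mulrDr.
rewrite [(m%:R * (_ * alpha))%R]mulrCA alphaE -[((Posz m)%:~R)%R]/(m%:R : R)%R.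
by ring.
Qed.

Lemma atom_true_scale e st s d :
  atom_true b e (scale_atom (st, (s, d))) = formula_true alpha (rev e) (Ineq st s d).
Proof.
have mR : (0 < m%:R :> R)%R by rewrite ltr0n.
rewrite /atom_true /= oval_scale big_map.
rewrite (eq_bigr (fun cv => m%:R * (coef_val alpha cv.1 * (var_val (rev e) cv.2)%:~R)))%R; last first.
  by move=> cv _; rewrite /= oval_scale mulrA.
by rewrite -mulr_sumr; case: st; rewrite /strict /= ?ltr_pM2l ?ler_pM2l.
Qed.

Lemma valid_atoms dims phi : vars_in dims phi ->
  all (valid_atom (rev dims)) (map scale_atom (rev (fats phi))).
Proof.
rewrite all_map all_rev; elim: phi => [st s d|f IH|f IHf g IHg|f IHf g IHg] //=.
- rewrite andbT /valid_atom /= all_map size_rev revK => h.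
  by apply: sub_all h => cv.
- by rewrite all_cat => /andP [/IHf -> /IHg ->].
- by rewrite all_cat => /andP [/IHf -> /IHg ->].
Qed.

Theorem decide_correct r (S : sentence r) : 0 < r ->
  decide (encode S) <-> sentence_true alpha S.
Proof.
move=> r0; rewrite /decide parse_encode; set s := clean _ _ _ _ _ _.
have dn : dims S != [::] :> seq nat by rewrite -size_eq0 size_tuple -lt0n.
have hd : innermost_dims s = rev (dims S) by rewrite /innermost_dims pblocks_dims.
have hn : rev (dims S) != [::] by rewrite -size_eq0 size_rev size_eq0.
pose P e := eval_prog (rev (p_prog s)) (map (atom_true b e) (atoms s)) = innermost_sign s.
have hP : recognises t (first_nfa s) (rev (dims S)) P.
  rewrite /first_nfa hd; apply: recognises_map.
    by apply enc_inj.
  apply: (body_recognises t_gt2 b_gt1 b_root) => //; exact: valid_atoms (body_closed S).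
have Pe e : P e <-> (formula_true alpha (rev e) (body S) <->
   is_exists (iter (size (rev (dims S))).-1 dual (first_quantifier S))).
  rewrite /P /innermost_sign pblocks_last // size_rev /atoms -map_comp.
  have := eval_prog_formula (T := fun st s d => atom_true b e (scale_atom (st, (s, d))))
    (V := formula_true alpha (rev e)) (body S) (fun st s d => esym (atom_true_scale e st s d))
    (fun f => erefl) (fun f g => erefl) (fun f g => erefl).
  rewrite (eq_map (_ : (fun a : atom => _) =1 atom_true b e \o scale_atom)); last first.
    by case=> st [u d].
  move=> ->; split=> [-> //|h]; apply/idP/idP; first by move/h.
  by move=> k; apply/h.
rewrite /decide_state.
have hl' : has (mem (final (last_nfa s).1)) (clos (last_nfa s).1) <-> game (rev (dims S)) P.
  rewrite /last_nfa hd.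
  by apply: (levels_correct (z := (first_nfa s, alphabet t (rev (dims S)))) t_gt2 hn).
have hg := @game_quantified R alpha (body S) (first_quantifier S) (rev (dims S)) [::] P hn.
have {}hg := hg (fun e => Pe e); rewrite revK cats0 in hg.
have -> : (head (false, 0) (p_blocks s)).1 = is_exists (first_quantifier S).
  by rewrite /s /=; case: (val (dims S)) dn => //= n ns _; case: (first_quantifier S).
rewrite -/(sentence_true alpha S) in hg.
move: (has _ _) hl' => h1 hl'.
have key : h1 <-> (sentence_true alpha S <-> is_exists (first_quantifier S)) by rewrite hl'.
case: (is_exists _) key => /=; case: h1 {hl'} => /= key; split=> //.
- by move=> _; apply (proj1 key).
- by move=> h; have : false by apply/key; split.
- by move=> h; have : false by apply (proj1 key).
- move=> _; apply: contrapT => h; have : false by apply/key; split.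
  by [].
Qed.

End Decision.

(** * Running time of the decision procedure *)

Section Restricted.
Context {G : Type} {eG : Enc G} (B : G -> nat).
Context {X : Type} {eX : Enc X} {A : Type} {eA : Enc A}.
Variables (l : G -> seq X) (a : G -> A) (step : G -> A -> X -> A).

(* The states reached by a loop form a context of their own, so that the cost of
   one step need only be bounded at these states. *)
Record occ : Type := Occ {
  occ_ctx : G; occ_done : seq X; occ_elt : X; occ_todo : seq X;
  occ_eq : l occ_ctx = occ_done ++ occ_elt :: occ_todo }.

Definition occ_acc (o : occ) : A := foldl (step (occ_ctx o)) (a (occ_ctx o)) (occ_done o).

#[export] Instance enc_occ : Enc occ := fun o => enc (occ_ctx o, (occ_acc o, occ_elt o)).

Lemma eff_foldl_occ : Eff B l -> Eff B a ->
  Eff (fun o => B (occ_ctx o)) (fun o => step (occ_ctx o) (occ_acc o) (occ_elt o)) ->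
  Eff B (fun g => foldl (step g) (a g) (l g)).
Proof.
move=> hl ha [p [K [k hK] hp]]; apply: eff_foldl_raw => //.
exists p, (fun g => (B g).+2 ^ k); first by exists k.
move=> g s x t e acc; exact: evals_le (hK (Occ e)) (hp (Occ e)).
Qed.

Lemma eff_occ_view : pbound (fun o => B (occ_ctx o)) (fun o => wt (occ_ctx o, (occ_acc o, occ_elt o))) ->
  Eff (fun o => B (occ_ctx o)) (fun o => (occ_ctx o, (occ_acc o, occ_elt o))).
Proof. by move=> h; apply: eff_recode (eff_id (G := occ) h). Qed.

End Restricted.

Lemma wt_catr A {eA : Enc A} (u v : seq A) : wt v <= wt (u ++ v).
Proof. by pose proof (wt_cat u v); pose proof (wt_gt0 u); lia. Qed.

Lemma wt_int (z : int) : wt z = 2 * `|z| + 3.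
Proof. by rewrite /wt /enc /enc_int [enc _]/= weight_node -!/(wt _) !wt_nat; case: z => n /=; lia. Qed.

Section Components.
Context {G : Type} {eG : Enc G} (B : G -> nat).

Lemma eff_nseq X {eX : Enc X} (n : G -> nat) (x : G -> X) :
  Eff B n -> Eff B x -> Eff B (fun g => nseq (n g) (x g)).
Proof.
move=> hn hx; apply: (eff_ext (f := fun g => map (fun=> x g) (nseq (n g) tt))).
  by move=> g; rewrite map_nseq.
by apply: (eff_map (f := fun g _ => x g)) (eff_units hn) _; exact: eff_lift.
Qed.

Lemma wt_irange n : wt (irange n) <= (2 * n).+1 * (2 * n + 4) + 1.
Proof.
rewrite -size_irange; apply: leq_trans (wt_size_all (m := 2 * n + 3) _) _; last by lia.
by apply/allP => z; rewrite mem_irange wt_int; lia.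
Qed.

Lemma eff_irange (n : G -> nat) : Eff B n -> Eff B (fun g => irange (n g)).
Proof.
move=> hn; have hc := eff_ctx hn.
pose st (z : nat * seq int) := (z.1.+1, [:: Posz z.1.+1, (- Posz z.1.+1)%R & z.2]).
have iE m : iter m st (0, [:: 0%R]) = (m, irange m) by elim: m => //= m ->.
apply: (eff_ext (f := fun g => (iter (n g) st (0, [:: 0%R])).2)).
  by move=> g; rewrite iE.
have pn : pbound B (fun g => n g).
  by apply: pbound_le (eff_weight hn) => g; rewrite wt_nat; lia.
apply: eff_snd; apply: (eff_iter (f := fun _ => st)
  (K := fun g => (2 * n g + 1) * (2 * n g + 4) + (2 * n g + 4))) => //.
- exact: eff_const.
- by rewrite /st; eff.
- have p1 k : pbound B (fun g => 2 * n g + k).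
    by apply: pbound_add (pbound_const _ _); apply: pbound_mul (pbound_const _ 2) pn.
  exact: pbound_add (pbound_mul (p1 1) (p1 4)) (p1 4).
move=> g i hi; rewrite iE wt_pair wt_nat /=; have := wt_irange i; nia.
Qed.

Lemma eff_allpairs X {eX : Enc X} Y {eY : Enc Y} Z {eZ : Enc Z} (l : G -> seq X)
    (m : G -> X -> seq Y) (f : G -> X -> Y -> Z) :
  Eff B l -> Eff (ext B) (fun z : G * X => m z.1 z.2) ->
  Eff (ext (ext B)) (fun z : (G * X) * Y => f z.1.1 z.1.2 z.2) ->
  Eff B (fun g => flatten [seq [seq f g x y | y <- m g x] | x <- l g]).
Proof.
move=> hl hm hf; apply: eff_flatten; apply: (eff_map (f := fun g x => [seq f g x y | y <- m g x])) => //.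
exact: (eff_map (f := fun (z : G * X) y => f z.1 z.2 y)).
Qed.

Lemma eff_digit (a : G -> block_letter) (i j : G -> nat) : Eff B a -> Eff B i -> Eff B j ->
  Eff B (fun g => digit (rev (a g)) (i g) (j g)).
Proof. by move=> h1 h2 h3; rewrite /digit; eff. Qed.

Lemma eff_cnorm (t : nat) (c : G -> int * int) : Eff B c -> Eff B (fun g => cnorm t (c g)).
Proof. by move=> h; have hc := eff_ctx h; rewrite /cnorm; eff. Qed.

End Components.

Section AtomComponents.
Variable t : nat.
Context {G : Type} {eG : Enc G} (B : G -> nat).

Lemma absz_digit (a : block_letter) i j : `|digit (rev a) i j| <= wt a.
Proof.
rewrite /digit; case: (ltnP i (size (rev a))) => hi; last first.
  by rewrite [nth [::] _ i]nth_default // nth_nil.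
case: (ltnP j (size (nth [::] (rev a) i))) => hj; last by rewrite nth_default.
pose proof (wt_nth (0%R : int) hj) as h1; pose proof (wt_nth ([::] : seq int) hi) as h2.
rewrite wt_rev in h2; have := ltn_trans h1 h2; rewrite wt_int.
by move: (nth _ _ j) (@wt _ _ a) => z n; lia.
Qed.

Lemma lin_bound s a : `|(lin s a).1| + `|(lin s a).2| <= wt s * wt a.
Proof.
elim: s => [|[c v] s IH] //=; have := absz_digit a v.1 v.2.
set d := digit _ _ _ => hd; set z := lin s a in IH *.
rewrite wt_cons wt_pair wt_pair !wt_int /=.
have h1 := abszM c.1 d; have h2 := abszM c.2 d.
have h3 : `|(c.1 * d + z.1)%R| <= `|c.1| * wt a + `|z.1|.
  by apply: leq_trans (_ : `|(c.1 * d)%R| + `|z.1| <= _); [lia | rewrite h1 leq_add2r leq_mul].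
have h4 : `|(c.2 * d + z.2)%R| <= `|c.2| * wt a + `|z.2|.
  by apply: leq_trans (_ : `|(c.2 * d)%R| + `|z.2| <= _); [lia | rewrite h2 leq_add2r leq_mul].
apply: (leq_trans (leq_add h3 h4)).
have -> : `|c.1| * wt a + `|z.1| + (`|c.2| * wt a + `|z.2|) =
  (`|c.1| + `|c.2|) * wt a + (`|z.1| + `|z.2|) by rewrite mulnDl; lia.
apply: leq_trans (leq_add (leqnn _) IH) _.
by rewrite -mulnDl leq_mul //; lia.
Qed.

Lemma eff_lin (s : G -> seq ((int * int) * (nat * nat))) (a : G -> block_letter) :
  Eff B s -> Eff B a -> Eff B (fun g => lin (s g) (a g)).
Proof.
move=> hs ha; have hc := eff_ctx hs.
apply: (eff_foldr (a := fun=> (0, 0)%R)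
  (step := fun g cv acc => let d := digit (rev (a g)) cv.2.1 cv.2.2 in
    (cv.1.1 * d + acc.1, cv.1.2 * d + acc.2)%R)
  (K := fun g => 2 * (wt (s g) * wt (a g)) + 10)) => //.
- exact: eff_const.
- have hd : Eff (ext (X := ((int * int) * (nat * nat)) * (int * int)) B)
     (fun z => digit (rev (a z.1)) z.2.1.2.1 z.2.1.2.2).
    by apply: eff_digit; eff.
  by cbv zeta beta; eff.
- apply: pbound_add (pbound_const _ _); apply: pbound_mul (pbound_const _ _) _.
  exact: pbound_mul (eff_weight hs) (eff_weight ha).
move=> g u v e; rewrite -[foldr _ _ v]/(lin v (a g)) wt_pair !wt_int.
have h := lin_bound v (a g).
have h2 : wt v * wt (a g) <= wt (s g) * wt (a g) by rewrite leq_mul // e wt_catr.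
apply: leq_trans (_ : 2 * (`|(lin v (a g)).1| + `|(lin v (a g)).2|) + 10 <= _).
  by move: (absz _) (absz _) => p q; lia.
by rewrite leq_add2r leq_mul2l; exact: leq_trans h h2.
Qed.

Definition cnorm_sum (s : seq ((int * int) * (nat * nat))) : nat :=
  foldr (fun cv n => cnorm t cv.1 + n) 0 s.

Lemma cnorm_sum_bound s : cnorm_sum s <= t.+1 * wt s.
Proof.
elim: s => [|[c v] s IH] //=; rewrite -/(cnorm_sum s) wt_cons !wt_pair !wt_int /cnorm /=.
by nia.
Qed.

Lemma eff_cap (x : G -> atom) : Eff B x -> Eff B (fun g => cap t (x g)).
Proof.
move=> h; have hc := eff_ctx h; rewrite /cap.
have h1 : Eff B (fun g => cnorm_sum (terms (x g))).
  have ht : Eff B (fun g => terms (x g)) by rewrite /terms; eff.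
  apply: (eff_foldr (a := fun=> 0) (step := fun _ cv n => cnorm t cv.1 + n)
    (K := fun g => 2 * (t.+1 * wt (terms (x g))) + 1)) => //.
  - exact: eff_const.
  - have hn : Eff (ext (X := ((int * int) * (nat * nat)) * nat) B) (fun z => cnorm t z.2.1.1).
      by apply: eff_cnorm; eff.
    by eff.
  - apply: pbound_add (pbound_const _ _); apply: pbound_mul (pbound_const _ _) _.
    exact: pbound_mul (pbound_const _ _) (eff_weight ht).
  move=> g u v e; rewrite -[foldr _ _ v]/(cnorm_sum v) wt_nat -addn1 leq_add2r leq_mul2l /=.
  apply: leq_trans (cnorm_sum_bound v) _.
  by rewrite leq_mul // e wt_catr.
have h2 : Eff B (fun g => cnorm t (bound (x g))) by apply: eff_cnorm; rewrite /bound; eff.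
have h3 : Eff B (fun g => 3 * t) by exact: eff_const.
exact: eff_muln h3 (eff_addn h1 h2).
Qed.

Lemma eff_hstep (z e : G -> point) : Eff B z -> Eff B e -> Eff B (fun g => hstep t (z g) (e g)).
Proof. by move=> h1 h2; have hc := eff_ctx h1; rewrite /hstep; eff. Qed.

Lemma eff_sstep (E : G -> nat) (z e : G -> point) : Eff B E -> Eff B z -> Eff B e ->
  Eff B (fun g => sstep t (E g) (z g) (e g)).
Proof.
move=> h0 h1 h2; have hc := eff_ctx h1; rewrite /sstep.
by apply: eff_if; [eff | exact: eff_hstep | exact: h1].
Qed.

Lemma eff_opp2 (e : G -> point) : Eff B e -> Eff B (fun g => opp2 (e g)).
Proof. by move=> h; rewrite /opp2; eff. Qed.

Lemma eff_mid (d : G -> int * int) : Eff B d -> Eff B (fun g => mid t (d g)).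
Proof. by move=> h; have hc := eff_ctx h; rewrite /mid; eff. Qed.

Lemma eff_decided (E : G -> nat) (f : G -> point) : Eff B E -> Eff B f ->
  Eff B (fun g => decided (E g) (f g)).
Proof. by move=> h h'; have hc := eff_ctx h; rewrite /decided; eff. Qed.

Lemma eff_holds (x : G -> atom) (f : G -> point) : Eff B x -> Eff B f ->
  Eff B (fun g => holds t (x g) (f g)).
Proof.
move=> h h'; have hc := eff_ctx h; have hcap := eff_cap h.
by rewrite /holds /strict; eff.
Qed.

Lemma eff_box (E : G -> nat) : Eff B E -> Eff B (fun g => box t (E g)).
Proof.
move=> h; have hc := eff_ctx h.
have h1 : Eff B (fun g => irange ((2 * t + 4) * E g)) by apply: eff_irange; eff.
by rewrite /box; apply: eff_allpairs => //; eff.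
Qed.

End AtomComponents.

Section AtomLists.
Variable t : nat.
Context {G : Type} {eG : Enc G} (B : G -> nat).

Lemma eff_atom_states (x : G -> atom) : Eff B x -> Eff B (fun g => atom_states t (x g)).
Proof.
move=> h; have hc := eff_ctx h; have hb := eff_box t (eff_cap t h).
by rewrite /atom_states; apply: eff_allpairs => //; eff.
Qed.

Lemma eff_atom_initial (x : G -> atom) : Eff B x -> Eff B (fun g => atom_initial t (x g)).
Proof.
move=> h; have hc := eff_ctx h; have hcap := eff_cap t h; have hb := eff_box t hcap.
rewrite /atom_initial; apply: (eff_map (f := fun g f => (((0, 0)%R, f), holds t (x g) f))).
  apply: (eff_filter (f := fun g f => decided (cap t (x g)) f)) => //.
  by apply: eff_decided; eff.
have hh : Eff (ext (X := point) B) (fun z => holds t (x z.1) z.2) by apply: eff_holds; eff.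
by eff.
Qed.

Lemma eff_atom_final (x : G -> atom) : Eff B x -> Eff B (fun g => atom_final t (x g)).
Proof.
move=> h; have hc := eff_ctx h; have hs := eff_atom_states h.
rewrite /atom_final; apply: (eff_filter (f := fun g (y : point * point) =>
   y.2 == sstep t (cap t (x g)) y.1 (mid t (bound (x g))))) => //.
apply: eff_eqop; first by eff.
apply: eff_sstep; [by apply: eff_cap; eff | by eff |].
by apply: eff_mid; rewrite /bound; eff.
Qed.

Lemma eff_atom_trans (a : G -> block_letter) (x : G -> atom) : Eff B a -> Eff B x ->
  Eff B (fun g => atom_trans t (a g) (x g)).
Proof.
move=> ha h; have hc := eff_ctx h; have hs := eff_atom_states h.
have hl : Eff B (fun g => lin (terms (x g)) (a g)) by apply: eff_lin => //; rewrite /terms; eff.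
have hcap := eff_cap t h; have ho := eff_opp2 hl.
rewrite /atom_trans; apply: eff_allpairs => //; last by eff.
apply: (eff_filter (f := fun (z : G * (point * point)) y =>
   (y.1 == sstep t (cap t (x z.1)) z.2.1 (lin (terms (x z.1)) (a z.1))) &&
   (z.2.2 == sstep t (cap t (x z.1)) y.2 (opp2 (lin (terms (x z.1)) (a z.1)))))); first by eff.
apply: eff_andb; apply: eff_eqop; try by eff.
  by apply: eff_sstep; eff.
by apply: eff_sstep; eff.
Qed.

End AtomLists.

Lemma wt_filter X {eX : Enc X} (p : pred X) (s : seq X) : wt (filter p s) <= wt s.
Proof. by elim: s => //= x s IH; case: (p x); rewrite !wt_cons; lia. Qed.

Lemma tree_of_seq_map X {eX : Enc X} (s : seq X) : enc (map enc s) = enc s.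
Proof. by rewrite /enc /enc_seq; elim: s => //= x s ->. Qed.

(** The encoding of a tree is the tree itself, so turning the states into trees leaves the code of
    the automaton unchanged. *)
Lemma enc_nfa_map Q {eQ : Enc Q} (A : nfa Q) : enc (nfa_map enc A) = enc A.
Proof.
case: A => [[s i] [tr f]].
have e : enc [seq (enc e.1, (e.2.1, enc e.2.2)) | e <- tr] = enc tr.
  by rewrite /enc /enc_seq; elim: tr => //= x u ->.
have e' : enc (nfa_map enc ((s, i), (tr, f))) =
  Node (Node (enc (map enc s)) (enc (map enc i)))
    (Node (enc [seq (enc e.1, (e.2.1, enc e.2.2)) | e <- tr]) (enc (map enc f))) by [].
by rewrite e' e !tree_of_seq_map.
Qed.

Section Evaluation.
Context {G : Type} {eG : Enc G} (B : G -> nat).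

Lemma wt_bools (s : seq bool) : wt s <= 4 * size s + 1.
Proof. by elim: s => //= b s IH; rewrite wt_cons; case: b; rewrite /wt /= in IH *; lia. Qed.

Lemma eval_steps_size prog z :
  size (foldl eval_step z prog).1 <= size z.1 + size prog /\
  size (foldl eval_step z prog).2 <= size z.2.
Proof.
elim: prog z => [|op prog IH] z /=; first by rewrite addn0.
have [h1 h2] := IH (eval_step z op).
have : size (eval_step z op).1 <= (size z.1).+1 /\ size (eval_step z op).2 <= size z.2.
  rewrite /eval_step; case: z {h1 h2} => s u /=.
  by case: ifP => _ /=; rewrite ?size_behead; [|case: ifP => _ /=; rewrite ?size_behead; [|case: ifP => _ /=; rewrite ?size_behead]]; split; lia.
lia.
Qed.

Lemma eff_eval_prog (prog : G -> seq nat) (bs : G -> seq bool) :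
  Eff B prog -> Eff B bs -> Eff B (fun g => eval_prog (prog g) (bs g)).
Proof.
move=> h1 h2; have hc := eff_ctx h1; rewrite /eval_prog; apply: eff_head; apply: eff_fst.
apply: (eff_foldl (a := fun g => ([::], bs g)) (step := fun _ => eval_step)
  (K := fun g => 4 * size (prog g) + (4 * size (bs g) + 10))) => //.
- by eff.
- by rewrite /eval_step; eff.
- have p1 : pbound B (fun g => size (prog g)) by apply: pbound_le (eff_weight h1) => g; pose proof (size_wt (prog g)); lia.
  have p2 : pbound B (fun g => size (bs g)) by apply: pbound_le (eff_weight h2) => g; pose proof (size_wt (bs g)); lia.
  apply: pbound_add; first by apply: pbound_mul (pbound_const _ _) p1.
  by apply: pbound_add (pbound_const _ _); apply: pbound_mul (pbound_const _ _) p2.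
move=> g u v e; have [k1 k2] := eval_steps_size u ([::], bs g).
rewrite wt_pair; have := wt_bools (foldl eval_step ([::], bs g) u).1.
have := wt_bools (foldl eval_step ([::], bs g) u).2; rewrite e size_cat.
by move: k1 k2 => /=; lia.
Qed.

End Evaluation.

Section Body.
Variable t : nat.
Context {G : Type} {eG : Enc G} (B : G -> nat).

Lemma size_atom_initial x : size (atom_initial t x) <= size (atom_states t x).
Proof.
rewrite /atom_initial size_map /atom_states size_allpairs.
have : size [seq f <- box t (cap t x) | decided (cap t x) f] <= size (box t (cap t x)).
  by rewrite size_filter count_size.
have : 0 < size (box t (cap t x)).
  by have := mem_box t (cap t x) (0, 0)%R; case: (box t (cap t x)).
nia.
Qed.

Lemma size_atom_trans a x : size (atom_trans t a x) <= size (atom_states t x) ^ 2.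
Proof.
have key (s u : seq (point * point)) (p : point * point -> pred (point * point)) :
    size (flatten [seq [seq (y, z) | z <- s & p y z] | y <- u]) <= size u * size s.
  elim: u => //= y u IH; rewrite size_cat size_map mulSn leq_add //.
  by rewrite size_filter count_size.
by rewrite expnS expn1; exact: key.
Qed.

Lemma prod_le (l : seq atom) (f h : atom -> nat) : (forall x, f x <= h x) ->
  \prod_(x <- l) f x <= \prod_(x <- l) h x.
Proof. by move=> le; elim: l => [|x l IH]; rewrite ?big_nil // !big_cons leq_mul. Qed.

Lemma eff_body (ats : G -> seq atom) (prog : G -> seq nat) (sg : G -> bool) (al : G -> seq block_letter) :
  Eff B ats -> Eff B prog -> Eff B sg -> Eff B al ->
  pbound B (fun g => \prod_(x <- ats g) (size (atom_states t x)).+1) ->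
  Eff B (fun g => body_nfa t (ats g) (prog g) (sg g) (al g)).
Proof.
move=> h1 h2 h3 h4 hp; have hc := eff_ctx h1.
have small_prod (f : atom -> nat) : (forall x, f x <= size (atom_states t x)) ->
   pbound B (fun g => \prod_(x <- ats g) (f x).+1).
  by move=> le; apply: pbound_le hp => g; apply: prod_le.
have hst : Eff B (fun g => prodl (map (atom_states t) (ats g))).
  apply: eff_prodl; last by apply: pbound_le hp => g; rewrite big_map.
  by apply: (eff_map (f := fun _ => atom_states t)) => //; apply: eff_atom_states; eff.
have hin : Eff B (fun g => prodl (map (atom_initial t) (ats g))).
  apply: eff_prodl; last first.
    by apply: pbound_le (small_prod _ size_atom_initial) => g; rewrite big_map.
  by apply: (eff_map (f := fun _ => atom_initial t)) => //; apply: eff_atom_initial; eff.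
have hfi : Eff B (fun g => prodl (map (atom_final t) (ats g))).
  apply: eff_prodl; last first.
    apply: pbound_le (small_prod (fun x => size (atom_final t x)) _) => [g|x]; first by rewrite big_map.
    by rewrite size_filter count_size.
  by apply: (eff_map (f := fun _ => atom_final t)) => //; apply: eff_atom_final; eff.
apply: eff_pair; apply: eff_pair => //.
  apply: (eff_map (f := fun _ l => map fst l)); last by eff.
  apply: (eff_filter (f := fun g l => eval_prog (prog g) (map snd l) == sg g)) => //.
  have he : Eff (ext (X := seq ((point * point) * bool)) B) (fun z => eval_prog (prog z.1) (map snd z.2)).
    by apply: eff_eval_prog; eff.
  have hs : Eff (ext (X := seq ((point * point) * bool)) B) (fun z => sg z.1) by eff.
  apply: (eff_ext (f := fun z : G * seq ((point * point) * bool) =>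
      if eval_prog (prog z.1) (map snd z.2) then sg z.1 else ~~ sg z.1)); last by eff.
  by move=> z; case: eval_prog; case: (sg z.1).
apply: (eff_allpairs (m := fun g a => prodl (map (atom_trans t a) (ats g)))
  (f := fun _ a l => (map fst l, (a, map snd l)))) => //; last by eff.
apply: eff_prodl.
  apply: (eff_map (f := fun z => atom_trans t z.2)); first by eff.
  by apply: eff_atom_trans; eff.
apply: pbound_le (pbound_lift (X := block_letter) (pbound_exp 2 hp)) => z.
rewrite big_map; elim: (ats z.1) => [|x l IH]; first by rewrite !big_nil.
rewrite !big_cons expnMn leq_mul //; have := size_atom_trans z.2 x; rewrite !expnS !expn0; lia.
Qed.

End Body.

Section Closure.
Context {G : Type} {eG : Enc G} (B : G -> nat).

Lemma eff_is_zero (a : G -> block_letter) : Eff B a -> Eff B (fun g => is_zero (a g)).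
Proof.
move=> h; have hc := eff_ctx h.
by apply: (eff_ext (f := fun g => all (fun s => all (fun d : int => d == 0%R) s) (a g))) => //; eff.
Qed.
End Closure.

Section Projection.
Context {G : Type} {eG : Enc G} (B : G -> nat).

Lemma eff_clos (A : G -> nfa tree) : Eff B A -> Eff B (fun g => clos (A g)).
Proof.
move=> h; have hc := eff_ctx h; rewrite /clos.
have hs : Eff B (fun g => states (A g)) by rewrite /states; eff.
have hi : Eff B (fun g => initial (A g)) by rewrite /initial; eff.
have ht : Eff B (fun g => trans (A g)) by rewrite /trans; eff.
apply: (eff_iter (f := fun g => grow (A g)) (K := fun g => wt (states (A g)) + wt (initial (A g)))) => //.
- by apply: eff_succn; eff.
- rewrite /grow; apply: (eff_filter (f := fun (z : G * seq tree) q => (q \in z.2) ||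
    has (fun e => [&& e.1 \in z.2, is_zero (behead e.2.1) & e.2.2 == q]) (trans (A z.1)))); first by eff.
  apply: eff_orb; first by eff.
  apply: (eff_has (f := fun (y : (G * seq tree) * tree) e =>
    [&& e.1 \in y.1.2, is_zero (behead e.2.1) & e.2.2 == y.2])); first by eff.
  by apply: eff_andb; first eff; apply: eff_andb; [apply: eff_is_zero; eff | eff].
- exact: pbound_add (eff_weight hs) (eff_weight hi).
move=> g [|i] _ /=; first by rewrite leq_addl.
by apply: leq_trans (wt_filter _ _) _; rewrite leq_addr.
Qed.

Lemma eff_level (z : G -> nfa tree * seq block_letter) : Eff B z ->
  pbound B (fun g => 2 ^ size (states (z g).1)) -> Eff B (fun g => level (z g)).
Proof.
move=> h hb; have hc := eff_ctx h; rewrite /level.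
have hs : Eff B (fun g => states (z g).1) by rewrite /states; eff.
have hf : Eff B (fun g => final (z g).1) by rewrite /final; eff.
have ht : Eff B (fun g => trans (z g).1) by rewrite /trans; eff.
have hcl : Eff B (fun g => clos (z g).1) by apply: eff_clos; eff.
have hsub := eff_sublists hs hb.
have hal : Eff B (fun g => map behead (z g).2) by eff.
apply: eff_pair => //.
apply: (eff_recode (f := fun g => det (z g).1 (map behead (z g).2))).
  by move=> g; rewrite enc_nfa_map.
apply: eff_pair; first by eff.
apply: eff_pair.
  apply: (eff_allpairs (m := fun g _ => map behead (z g).2)
    (f := fun g U a => (U, (a, dstep (z g).1 U a)))) => //; first by eff.
  have hd : Eff (ext (X := block_letter) (ext (X := seq tree) B)) (fun y => dstep (z y.1.1).1 y.1.2 y.2).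
    apply: (eff_filter (f := fun (y : (G * seq tree) * block_letter) q =>
      has (fun e => [&& e.1 \in y.1.2, behead e.2.1 == y.2 & e.2.2 == q]) (trans (z y.1.1).1))); first by eff.
    apply: (eff_has (f := fun (x : ((G * seq tree) * block_letter) * tree) e =>
      [&& e.1 \in x.1.1.2, behead e.2.1 == x.1.2 & e.2.2 == x.2])); by eff.
  by eff.
apply: (eff_filter (f := fun g U => ~~ has (mem (final (z g).1)) U)) => //.
apply: eff_negb; apply: (eff_has (f := fun (y : G * seq tree) q => q \in final (z y.1).1)); by eff.
Qed.

End Projection.

(** * Cost of parsing *)

Section Parsing.
Context {G : Type} {eG : Enc G} (B : G -> nat).

Lemma chunk_bound (w : seq bool) z :
  wt (foldl chunk_step z w) <= wt z + 10 * size w.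
Proof.
elim: w z => [|b w IH] z /=; first by lia.
apply: leq_trans (IH _) _; rewrite /chunk_step; case: z => u v.
have hb := wt_bool b.
by case: ifP => _; rewrite !wt_pair /= !wt_cons; move: hb; rewrite ?wt_nil; lia.
Qed.

Lemma eff_chunks (w : G -> seq bool) : Eff B w -> Eff B (fun g => chunks (w g)).
Proof.
move=> h; have hc := eff_ctx h; rewrite /chunks; apply: eff_snd.
apply: (eff_foldl (a := fun=> ([::], [::])) (step := fun _ => chunk_step)
  (K := fun g => 3 + 10 * wt (w g))) => //.
- exact: eff_const.
- by rewrite /chunk_step; eff.
- by apply: pbound_add (pbound_const _ _) _; apply: pbound_mul (pbound_const _ _) (eff_weight h).
move=> g u v e; apply: leq_trans (chunk_bound _ _) _.
have : size u <= wt (w g).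
  by pose proof (size_wt (w g)) as hw; move: hw; rewrite e size_cat; lia.
by rewrite wt_pair !wt_nil; lia.
Qed.

Lemma eff_add_term (tm : G -> (int * int) * (nat * nat)) (ats : G -> seq atom) :
  Eff B tm -> Eff B ats -> Eff B (fun g => add_term (tm g) (ats g)).
Proof. by move=> h h'; have hc := eff_ctx h; rewrite /add_term /strict /terms /bound; eff. Qed.

End Parsing.

Section Actions.
Context {G : Type} {eG : Enc G} (B : G -> nat).

Lemma eff_act (x : symbol) (s : G -> pstate) : Eff B s -> Eff B (fun g => act x (s g)).
Proof.
move=> h; have hc := eff_ctx h.
have ht : Eff B (fun g => add_term (p_cs (s g), head (0, 0) (p_vs (s g))) (p_ats (s g))).
  by apply: eff_add_term; rewrite /p_cs /p_vs /p_ats; eff.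
case: x; rewrite /act /mkp; try exact: h;
  rewrite /p_num /p_w /p_c1 /p_inc /p_cs /p_vs /p_ats /p_prog /p_ops /p_blocks;
  rewrite /p_cs /p_vs /p_ats in ht; by eff.
Qed.

End Actions.

Lemma wt_behead X {eX : Enc X} (s : seq X) : wt (behead s) <= wt s.
Proof. by case: s => //= x s; rewrite wt_cons; lia. Qed.

Lemma wt_head X {eX : Enc X} x0 (s : seq X) : wt (head x0 s) <= wt x0 + wt s.
Proof. by case: s => [|x s] /=; rewrite ?wt_cons; lia. Qed.

Lemma wt_add_term tm ats : wt (add_term tm ats) <= wt tm + wt ats + 50.
Proof.
case: tm => [[c1 c2] [i j]]; case: ats => [|[st [tms bd]] ats].
  rewrite -[add_term _ [::]]/[:: (false, ([:: ((c1, c2), (i, j))], (0, 0)%R))].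
  by rewrite !wt_cons !wt_pair /= !wt_cons !wt_nil !wt_pair !wt_int (_ : wt false = 1) //=; lia.
rewrite -[add_term _ _]/((st, (((c1, c2), (i, j)) :: tms, bd)) :: ats).
by rewrite !wt_cons !wt_pair /= !wt_cons !wt_pair /=; lia.
Qed.

Lemma wt_true : wt true = 3.
Proof. by []. Qed.

Lemma wt_false : wt false = 1.
Proof. by []. Qed.

(** A digit may double the weight of the next one, and numbers are unary; hence the parser state can
    grow by a constant factor per symbol. This is exponential in the length of the word but
    polynomial in the budget. *)
Lemma wt_act x s : wt (act x s) <= 3 * wt s + 100.
Proof.
case: s => [[[[n w] [c1 inc]] [[cs1 cs2] vs]] [[ats prog] [ops blocks]]].
pose proof (wt_add_term ((cs1, cs2), head (0, 0) vs) ats) as ht.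
pose proof (wt_head (0, 0) vs) as hh; pose proof (wt_behead ops) as hb; pose proof (wt_head 0 ops) as ho.
pose proof (wt_bool inc) as hi; pose proof (size_wt vs) as hsz.
have h1 : `|(n + w)%R| <= `|n| + `|w| by lia.
have h2 : `|(w + w)%R| <= 2 * `|w| by lia.
have h3 : `|(- n)%R| = `|n| by lia.
rewrite !wt_pair !wt_int !wt_nat in ht; rewrite !wt_pair !wt_nat in hh; rewrite !wt_nat in ho.
cbn [fst snd] in ht, hh.
case: x; rewrite /act /mkp /p_num /p_w /p_c1 /p_inc /p_cs /p_vs /p_ats /p_prog /p_ops /p_blocks;
  cbn [fst snd]; move: ht; move: (add_term _ _) => at' ht;
  try (case: ifP => _); rewrite ?wt_pair; cbn [fst snd];
  rewrite ?wt_cons ?wt_pair; cbn [fst snd]; rewrite ?wt_int ?wt_nat ?wt_nil ?wt_pair; cbn [fst snd];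
  rewrite ?wt_int ?wt_nat ?wt_nil ?wt_true ?wt_false ?h3;
  move: h1 h2 ht hh hb ho hi hsz; clear;
  by lia.

Qed.

Lemma wt_pstep s g : wt (pstep s g) <= 3 * wt s + 100.
Proof. by rewrite /pstep; do 15 (case: ifP => _; first exact: wt_act); lia. Qed.

Lemma wt_parse s l : wt (foldl pstep s l) <= 3 ^ size l * (wt s + 100).
Proof.
elim: l s => [|g l IH] s /=; first by lia.
by apply: leq_trans (IH _) _; have := wt_pstep s g; rewrite expnS; nia.
Qed.

#[export] Instance encinj_bool : EncInj bool.
Proof. by case; case. Qed.

Lemma size_chunks w : size (chunks w) <= size w.
Proof.
suff H z : size (foldl chunk_step z w).2 <= size z.2 + size w by exact: (H ([::], [::])).
elim: w z => [|b w IH] z /=; first by lia.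
by apply: leq_trans (IH _) _; rewrite /chunk_step; case: ifP => _ /=; lia.
Qed.

Section Steps.
Context {G : Type} {eG : Enc G} (B : G -> nat).

Lemma eff_case_act (x : symbol) (s : G -> pstate) (g : G -> seq bool) (e : G -> pstate) :
  Eff B s -> Eff B g -> Eff B e ->
  Eff B (fun z => if g z == code_of x then act x (s z) else e z).
Proof.
move=> hs hg he; have hc := eff_ctx hs.
apply: eff_if he; last exact: eff_act.
by apply: eff_eqop hg _; exact: eff_const.
Qed.

Lemma eff_pstep (s : G -> pstate) (g : G -> seq bool) :
  Eff B s -> Eff B g -> Eff B (fun z => pstep (s z) (g z)).
Proof. by move=> hs hg; rewrite /pstep; do 15 (apply: eff_case_act => //). Qed.

End Steps.

Lemma eff_parse_bits G {eG : Enc G} (B : G -> nat) (w : G -> seq bool) :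
  Eff B w -> pbound B (fun g => 2 ^ size (w g)) -> Eff B (fun g => parse_bits (w g)).
Proof.
move=> h h2; have hc := eff_ctx h; rewrite /parse_bits.
apply: (eff_foldl (a := fun=> pstate0) (step := fun _ => pstep)
  (K := fun g => (2 ^ size (w g)) ^ 2 * (wt pstate0 + 100))) => //.
- exact: eff_chunks.
- exact: eff_const.
- by apply: eff_pstep; eff.
- by apply: pbound_mul (pbound_exp _ h2) (pbound_const _ _).
move=> g u v e; apply: leq_trans (wt_parse _ _) _; rewrite leq_mul2r; apply/orP; right.
have hs : size u <= size (w g) by apply: leq_trans (size_chunks _); rewrite e size_cat; lia.
rewrite -expnM; apply: (@leq_trans (4 ^ size u)); first by case: (size u) => // n; rewrite leq_exp2r.
by rewrite mulnC (expnM 2 2) leq_exp2l //; lia.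
Qed.

(** The step is treated for an arbitrary encoding of the reachable states that gives access to
    context, accumulator and element. The time of a step may then be justified by properties of the
    actual run. *)
Lemma eff_foldl_restricted G {eG : Enc G} (B : G -> nat) X {eX : Enc X} A {eA : Enc A}
    (l : G -> seq X) (a : G -> A) (step : G -> A -> X -> A) :
  Eff B l -> Eff B a ->
  pbound (fun o : occ l => B (occ_ctx o)) (fun o => wt (occ_acc a step o)) ->
  (forall eo : Enc (occ l), Eff (fun o : occ l => B (occ_ctx o)) (@occ_ctx G X l) ->
    Eff (fun o : occ l => B (occ_ctx o)) (occ_acc a step) ->
    Eff (fun o : occ l => B (occ_ctx o)) (@occ_elt G X l) ->
    Eff (fun o => B (occ_ctx o)) (fun o : occ l => step (occ_ctx o) (occ_acc a step o) (occ_elt o))) ->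
  Eff B (fun g => foldl (step g) (a g) (l g)).
Proof.
move=> hl ha hacc hs; apply: eff_foldl_occ => //.
have hc := pbound_comp (fun o : occ l => occ_ctx o) (eff_ctx hl).
have hw := pbound_comp (fun o : occ l => occ_ctx o) (eff_weight hl).
have hv : @Eff _ (enc_occ a step) _ _ (fun o : occ l => B (occ_ctx o))
    (fun o => (occ_ctx o, (occ_acc a step o, occ_elt o))).
  apply: eff_occ_view.
  apply: pbound_le (pbound_add (pbound_add hc (pbound_add hacc hw)) (pbound_const _ 3)) => o.
  rewrite !wt_pair /=.
  have h3 : wt (occ_elt o) <= wt (l (occ_ctx o)).
    rewrite (occ_eq o); pose proof (wt_cat (occ_done o) (occ_elt o :: occ_todo o)) as e.
    by rewrite wt_cons in e; pose proof (wt_gt0 (occ_done o)); lia.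
  by lia.
by apply: (hs (enc_occ a step)); [apply: (@eff_fst _ (enc_occ a step) _ _ _ _ _ _ hv)
  | apply: (@eff_fst _ (enc_occ a step) _ _ _ _ _ _ (@eff_snd _ (enc_occ a step) _ _ _ _ _ _ hv))
  | apply: (@eff_snd _ (enc_occ a step) _ _ _ _ _ _ (@eff_snd _ (enc_occ a step) _ _ _ _ _ _ hv))].
Qed.

(** * Cost of the alphabet *)

Section Alphabet.
Variable t : nat.

Lemma wt_block n : wt (prodl (nseq n (irange t))) <=
  (2 * t + 2) ^ n * ((2 * t + 2) ^ n * (wt (irange t)).+1 + 2) + 1.
Proof.
apply: leq_trans (wt_prodl _) _; rewrite leq_add2r size_prodl big_nseq size_irange.
have -> : iter n (muln (2 * t).+1) 1 = (2 * t).+1 ^ n by elim: n => //= n ->; rewrite expnS.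
have hn : n <= (2 * t + 2) ^ n by apply: ltnW; apply: ltn_expl; lia.
apply: leq_mul; first by case: n {hn} => // n; rewrite leq_exp2r //; lia.
have -> : wt (nseq n (irange t)) = n * (wt (irange t)).+1 + 1.
  by elim: n {hn} => //= n IH; rewrite wt_cons IH; lia.
by rewrite -addn1 -addnA leq_add2r leq_mul2r hn orbT.
Qed.

Definition alphabet_weight (D k : nat) : nat :=
  D * (k * (D * (D * (wt (irange t)).+1 + 2) + 1).+1 + 2) + 1.

Lemma size_alphabet ns : size (alphabet t ns) = (2 * t).+1 ^ sumn ns.
Proof.
rewrite /alphabet size_prodl big_map; elim: ns => [|n ns IH]; first by rewrite big_nil.
rewrite big_cons IH size_prodl big_nseq size_irange /= expnD; congr (_ * _).
by elim: n => //= n ->; rewrite expnS.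
Qed.

Lemma wt_alphabet ns D k : (2 * t + 2) ^ sumn ns <= D -> size ns <= k ->
  wt (alphabet t ns) <= alphabet_weight D k.
Proof.
move=> hD hk; apply: leq_trans (wt_prodl _) _; rewrite leq_add2r.
apply: leq_mul.
  rewrite -/(alphabet t ns) size_alphabet; apply: leq_trans hD.
  by case: (sumn ns) => // n; rewrite leq_exp2r //; lia.
have hm : wt [seq prodl (nseq n (irange t)) | n <- ns] <=
    (size ns * (D * (D * (wt (irange t)).+1 + 2) + 1).+1).+1.
  apply: wt_map => i x0 hi; apply: leq_trans (wt_block _) _.
  have le : (2 * t + 2) ^ nth x0 ns i <= D.
    apply: leq_trans hD; rewrite leq_exp2l; last by lia.
    elim: ns i hi {hk} => //= n ns IH [|i] hi /=; first by rewrite leq_addr.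
    by apply: leq_trans (IH _ hi) _; rewrite leq_addl.
  by rewrite leq_add2r leq_mul // leq_add2r leq_mul.
by move: (_ + 1).+1 hm => M hm; have := leq_mul hk (leqnn M); lia.
Qed.

Definition alphabet_step (acc : seq block_letter) (n : nat) : seq block_letter :=
  flatten [seq [seq x :: s | s <- acc] | x <- prodl (nseq n (irange t))].

Lemma alphabet_foldl ns : foldl alphabet_step [:: [::]] ns = alphabet t (rev ns).
Proof.
elim/last_ind: ns => [|ns n IH]; first by [].
by rewrite foldl_rcons IH rev_rcons.
Qed.

End Alphabet.

Section AlphabetEff.
Variable t : nat.
Context {G : Type} {eG : Enc G} (B : G -> nat).

Lemma pbound_alphabet_weight (D k : G -> nat) : pbound B D -> pbound B k ->
  pbound B (fun g => alphabet_weight t (D g) (k g)).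
Proof.
move=> hD hk; rewrite /alphabet_weight.
have h1 : pbound B (fun g => (D g * (D g * (wt (irange t)).+1 + 2) + 1).+1).
  apply: (pbound_le (h' := fun g => D g * (D g * (wt (irange t)).+1 + 2) + 2)) => [g|]; first by lia.
  apply: pbound_add (pbound_const _ _); apply: pbound_mul (hD) _.
  by apply: pbound_add (pbound_const _ _); apply: pbound_mul (hD) (pbound_const _ _).
apply: pbound_add (pbound_const _ _); apply: pbound_mul (hD) _.
by apply: pbound_add (pbound_const _ _); apply: pbound_mul.
Qed.

(** The letters of a block are exponentially many in its dimension [n]. They fit the budget only
    because [n] is an entry of [ns], which is why the loop is restricted to occurring states. *)
Lemma eff_alphabet (ns : G -> seq nat) : Eff B ns ->
  pbound B (fun g => (2 * t + 2) ^ sumn (ns g)) -> Eff B (fun g => alphabet t (ns g)).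
Proof.
move=> h hD; have hc := eff_ctx h.
pose l := fun g => rev (ns g).
pose st := fun _ : G => alphabet_step t; pose a0 := fun _ : G => [:: [::]] : seq block_letter.
apply: (eff_ext (f := fun g => foldl (st g) (a0 g) (l g))).
  by move=> g; rewrite alphabet_foldl revK.
have hsz : pbound B (fun g => size (ns g)).
  by apply: pbound_le (eff_weight h) => g; pose proof (size_wt (ns g)); lia.
have hns (o : occ l) : ns (occ_ctx o) = rev (occ_todo o) ++ (occ_elt o) :: rev (occ_done o).
  by rewrite -[ns _]revK -/(l (occ_ctx o)) (occ_eq o) rev_cat rev_cons cat_rcons.
apply: eff_foldl_restricted; first by rewrite /l; eff.
- exact: eff_const.
- apply: pbound_le (pbound_comp (fun o : occ l => occ_ctx o) (pbound_alphabet_weight hD hsz)) => o.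
  rewrite /occ_acc alphabet_foldl; apply: wt_alphabet; rewrite hns.
    by rewrite leq_exp2l ?sumn_cat /=; lia.
  by rewrite size_cat /=; lia.
move=> eo ho ha he; have hco := eff_ctx he.
rewrite /st /alphabet_step; apply: eff_allpairs; [| exact: eff_lift | by eff].
apply: eff_prodl; first by apply: eff_nseq he _; apply: eff_const.
apply: pbound_le (pbound_comp (fun o : occ l => occ_ctx o) hD) => o; rewrite big_nseq size_irange.
have -> n k : iter n (muln k) 1 = k ^ n by elim: n => //= n ->; rewrite expnS.
rewrite -addn2; rewrite leq_exp2l; last by lia.
by rewrite hns sumn_cat /=; lia.
Qed.

End AlphabetEff.

(** * Size of the first automaton *)

Lemma size_encode r (S : sentence r) : encoding_length S =
  4 * (size (write_prefix (first_quantifier S) 0 (dims S)) + size (write_formula (body S))).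
Proof.
rewrite /encoding_length /encode -size_cat; elim: (_ ++ _) => //= x l IH.
by rewrite size_cat IH; case: x => /=; lia.
Qed.

Lemma sumn_prefix q i ns : sumn ns + size ns <= size (write_prefix q i ns).
Proof.
elim: ns q i => //= n ns IH q i; rewrite size_cat; have := IH (dual q) i.+1.
suff : n <= size (flatten [seq write_var (i, j) | j <- iota 0 n]) by lia.
rewrite -[X in X <= _](size_iota 0 n); elim: (iota 0 n) => //= j js IHj.
by rewrite !size_cat /=; lia.
Qed.

Lemma write_pos_bound p : nat_of_pos p < 2 ^ size (write_pos p).
Proof.
elim: p => //= p IH; rewrite size_rcons expnS ?NatTrec.doubleE -?muln2; lia.
Qed.

Lemma write_nat_bound n : n < 2 ^ size (write_nat n).
Proof.
rewrite /write_nat; have := bin_of_natK n; case: (bin_of_nat n) => [|p] /= e; first by rewrite -e.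
by rewrite -[X in X < _]e; exact: write_pos_bound.
Qed.

Lemma write_int_bound z : `|z| < 2 ^ size (write_int z).
Proof.
case: z => n; first exact: write_nat_bound.
by have := write_nat_bound n.+1; rewrite /= expnS; lia.
Qed.

Definition cabs (c : coef) : nat := `|c.1| + `|c.2|.

Lemma write_coef_bound c : cabs c + 2 <= 2 ^ size (write_coef c).
Proof.
case: c => z1 z2; rewrite /cabs /write_coef /= size_cat /= size_cat /= /fst.
have := write_int_bound z1; have := write_int_bound z2.
move: (size (write_int z1)) (size (write_int z2)) => v u.
rewrite (_ : (v + (u + 2).+1).+1 = 4 + v + u); last by lia.
rewrite !expnD; have h1 : 0 < 2 ^ u by rewrite expn_gt0.
have h2 : 0 < 2 ^ v by rewrite expn_gt0.
by move: (2 ^ u) (2 ^ v) h1 h2 (absz _) (absz _) => a b h1 h2 x y; nia.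
Qed.

Definition atom_abs (x : atom) : nat := \sum_(cv <- terms x) cabs cv.1 + cabs (bound x) + 2.

Lemma size_write_atom st s d : size (write_formula (Ineq st s d)) =
  \sum_(cv <- s) (size (write_coef cv.1) + size (write_var cv.2)).+1 + (size (write_coef d)).+1.
Proof.
rewrite -[write_formula _]/(flatten [seq SPlus :: write_coef cv.1 ++ write_var cv.2 | cv <- s] ++
  (if st then SLt else SLe) :: write_coef d).
rewrite size_cat size_flatten /shape -map_comp sumnE big_map; congr (_ + _).
by apply: eq_bigr => cv _; rewrite -size_cat.
Qed.

Lemma write_atom_bound st s d : atom_abs (st, (s, d)) <= 2 ^ size (write_formula (Ineq st s d)).
Proof.
rewrite size_write_atom /atom_abs -[terms _]/s -[bound _]/d.
elim: s => [|cv s IH].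
  rewrite !big_nil add0n; apply: leq_trans (write_coef_bound d) _.
  by rewrite leq_exp2l //; lia.
rewrite !big_cons; have := write_coef_bound cv.1; move: IH.
set b := _ + (size (write_coef d)).+1; move: (size (write_coef _)) (size (write_var _)) => c v IH hc.
rewrite -(addnA _.+1) -/b; apply: (@leq_trans (2 ^ (c + b))); last by rewrite leq_exp2l //; lia.
by rewrite expnD; move: (2 ^ c) (2 ^ b) hc IH => x y; move: (\sum_(j <- s) _) => u; nia.
Qed.

Section Sizes.
Variables (t m : nat) (A B : int).

Definition blowup : nat := m + `|A| + `|B|.

Lemma cabs_scale c : cabs (scale m A B c) <= blowup * cabs c.
Proof.
rewrite /cabs /scale /blowup /=.
have h2 := abszM B c.2; have h3 := abszM A c.2.
have h1 : `|(Posz m * c.1)%R| = m * `|c.1| by rewrite abszM.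
have h4 : `|(Posz m * c.1 + A * c.2)%R| <= `|(Posz m * c.1)%R| + `|(A * c.2)%R| by lia.
rewrite h2; apply: leq_trans (leq_add h4 (leqnn _)) _; rewrite h1 h3.
by move: (absz _) (absz _) (absz _) (absz _) => a b c' d; nia.
Qed.

Lemma cnorm_cabs c : cnorm t c <= t.+1 * cabs c.
Proof. by rewrite /cnorm /cabs; nia. Qed.

Lemma atom_abs_scale x : atom_abs (scale_atom m A B x) <= blowup.+1 * atom_abs x.
Proof.
rewrite /atom_abs /terms /bound /scale_atom /= big_map.
have h1 := cabs_scale (bound x); rewrite {1}/bound in h1.
have h2 : \sum_(cv <- x.2.1) cabs (scale m A B cv.1) <= blowup * \sum_(cv <- x.2.1) cabs cv.1.
  by rewrite big_distrr leq_sum // => cv _; exact: cabs_scale.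
rewrite /bound in h1 *; rewrite /terms.
by move: (cabs _) (cabs _) (\sum_(cv <- _) _) (\sum_(cv <- _) _) h1 h2 => a b c d; nia.
Qed.

Lemma cap_atom_abs x : cap t x <= 3 * t * (t.+1 * atom_abs x).
Proof.
rewrite /cap -/(cnorm_sum t (terms x)) leq_mul2l; apply/orP; right.
rewrite /atom_abs.
have h : cnorm_sum t (terms x) <= t.+1 * \sum_(cv <- terms x) cabs cv.1.
  rewrite big_distrr /=; elim: (terms x) => [|cv s IH] /=; first by rewrite big_nil.
  by rewrite big_cons leq_add // cnorm_cabs.
by have := cnorm_cabs (bound x); nia.
Qed.

Lemma size_box E : size (box t E) = (2 * ((2 * t + 4) * E)).+1 ^ 2.
Proof. by rewrite /box size_allpairs !size_irange expnS expn1. Qed.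

Lemma size_atom_states x : size (atom_states t x) = (2 * ((2 * t + 4) * cap t x)).+1 ^ 4.
Proof. by rewrite /atom_states size_allpairs size_box -expnD. Qed.

Definition growth : nat := 2 * ((2 * t + 4) * (3 * t * (t.+1 * blowup.+1))) + 2.

Lemma atom_states_bound st s d :
  (size (atom_states t (scale_atom m A B (st, (s, d))))).+1 <=
  2 ^ (4 * (growth + 1) * size (write_formula (Ineq st s d))).
Proof.
rewrite size_atom_states; set y := _ * cap t _; set n := size _.
have n0 : 0 < n by rewrite /n /= size_cat /=; lia.
have hn : (2 * y).+2 <= growth * 2 ^ n.
  have h1 := cap_atom_abs (scale_atom m A B (st, (s, d))).
  have h2 := atom_abs_scale (st, (s, d)); have h3 := write_atom_bound st s d.
  have h : cap t (scale_atom m A B (st, (s, d))) <= 3 * t * (t.+1 * blowup.+1) * 2 ^ n.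
    apply: (leq_trans h1); rewrite -!mulnA leq_mul2l; apply/orP; right.
    rewrite leq_mul2l; apply/orP; right; rewrite leq_mul2l; apply/orP; right.
    by apply: (leq_trans h2); rewrite leq_mul2l h3 orbT.
  have h0 : 0 < 2 ^ n by rewrite expn_gt0.
  rewrite /y /growth; move: h h0; move: (2 * t + 4) (cap _ _) (3 * t * _) (2 ^ n) => a c q N h h0.
  have : a * c <= a * (q * N) by rewrite leq_mul2l h orbT.
  by rewrite mulnDl -!mulnA; move: (a * c) (a * (q * N)) => u v; lia.
have hg : growth * 2 ^ n <= 2 ^ ((growth + 1) * n).
  rewrite mulnDl mul1n expnD leq_mul2r; apply/orP; right.
  apply: leq_trans (ltnW (ltn_expl growth (ltnSn 1))) _; rewrite leq_exp2l //; nia.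
apply: (@leq_trans ((2 * y).+2 ^ 4)).
  by rewrite !expnS !expn0; nia.
rewrite -mulnA (mulnC 4) expnM leq_exp2r //; exact: leq_trans hn hg.
Qed.

(** Each factor is exponential in the length of its own inequality. As these lengths add up, the
    exponent stays linear in the length of the formula; a uniform bound for the factors would make
    it quadratic. *)
Lemma prod_atom_states phi :
  \prod_(x <- map (scale_atom m A B) (rev (fats phi))) (size (atom_states t x)).+1 <=
  2 ^ (4 * (growth + 1) * size (write_formula phi)).
Proof.
rewrite big_map (perm_big _ (permEl (perm_rev _))).
elim: phi => [st s d|f IH|f IHf g IHg|f IHf g IHg]; rewrite [fats _]/=.
- by rewrite big_seq1; exact: atom_states_bound.
- by apply: leq_trans IH _; rewrite leq_exp2l //= leq_mul2l leqnSn orbT.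
- rewrite big_cat /=; apply: leq_trans (leq_mul IHf IHg) _.
  by rewrite -expnD leq_exp2l // -mulnDr leq_mul2l !size_cat /= size_cat; apply/orP; right; lia.
- rewrite big_cat /=; apply: leq_trans (leq_mul IHf IHg) _.
  by rewrite -expnD leq_exp2l // -mulnDr leq_mul2l !size_cat /= size_cat; apply/orP; right; lia.
Qed.

End Sizes.

(** * Running time of the projections *)

Lemma wt_map_behead X {eX : Enc X} (s : seq (seq X)) : wt (map behead s) <= wt s.
Proof. by elim: s => //= x s IH; rewrite !wt_cons; pose proof (wt_behead x); lia. Qed.

Lemma wt_map_enc X {eX : Enc X} (s : seq X) : wt (map enc s) = wt s.
Proof. by rewrite /wt tree_of_seq_map. Qed.

Lemma square_lt_exp n : 5 <= n -> n ^ 2 + 2 <= 2 ^ n.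
Proof.
elim: n => // n IH; rewrite leq_eqVlt => /orP [/eqP <- //|h].
by have := IH h; rewrite (expnS 2 n) !expnS !expn0; nia.
Qed.

Lemma clos_filter (A : nfa tree) : exists p, clos A = filter p (states A).
Proof. by rewrite /clos iterS /grow; eexists. Qed.

Lemma wt_sublists_elt X {eX : Enc X} (l : seq X) : all (fun s => wt s <= wt l) (sublists l).
Proof.
elim: l => //= x l IH; rewrite all_cat all_map; apply/andP.
by split; apply: sub_all IH => s hs /=; rewrite !wt_cons; lia.
Qed.

(** The exponents are chosen so that a subset construction leads from X to 2 ^ X with the same
    exponents; nothing is lost that would accumulate over the levels. *)
Definition bounded (X : nat) (z : nfa tree * seq block_letter) : Prop :=
  [/\ size (states z.1) <= X, wt (states z.1) <= X ^ 2, wt z.2 <= X & wt z.1 <= X ^ 5].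

Lemma bounded_level X z : 8 <= X -> bounded X z -> bounded (2 ^ X) (level z).
Proof.
move=> X8 [h1 h2 h3 _]; have hY := square_lt_exp (leq_trans (isT : 5 <= 8) X8).
have hst : 2 ^ size (states z.1) <= 2 ^ X by rewrite leq_exp2l.
have ws : wt (sublists (states z.1)) <= (2 ^ X) ^ 2.
  apply: leq_trans (wt_sublists _) _.
  apply: (@leq_trans (2 ^ X * (X ^ 2).+1 + 1)); first by rewrite leq_add2r leq_mul.
  by move: (2 ^ X) (X ^ 2) hY => Y V hY; rewrite expnS expn1; nia.
have wal : wt (map behead z.2) <= X by exact: leq_trans (wt_map_behead _) h3.
have wi : wt [:: clos z.1] <= 2 ^ X.
  have hcl : wt (clos z.1) <= X ^ 2.
    by have [p ->] := clos_filter z.1; exact: leq_trans (wt_filter _ _) h2.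
  by apply: leq_trans hY; rewrite wt_cons wt_nil addn1 addn2 !ltnS.
have wf : wt [seq U <- sublists (states z.1) | ~~ has (mem (final z.1)) U] <= (2 ^ X) ^ 2.
  exact: leq_trans (wt_filter _ _) ws.
have X2 : X <= X ^ 2 by rewrite expnS expn1; nia.
have wtr : wt [seq (U, (a, dstep z.1 U a)) | U <- sublists (states z.1), a <- map behead z.2] <= (2 ^ X) ^ 4.
  apply: leq_trans (wt_size_all (m := 3 * X ^ 2 + 2) _) _.
    rewrite all_flatten all_map; apply: sub_all (wt_sublists_elt (states z.1)) => U hU /=.
    rewrite all_map; apply: sub_all (wt_all (map behead z.2)) => a ha /=.
    rewrite !wt_pair /=; have hd : wt (dstep z.1 U a) <= wt (states z.1) by exact: wt_filter.
    apply: (@leq_trans (X ^ 2 + (X + X ^ 2).+1).+1); last by lia.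
    rewrite ltnS leq_add ?(leq_trans hU) // ltnS leq_add ?(leq_trans ha) //.
    exact: leq_trans hd h2.
  rewrite size_allpairs size_sublists.
  have hsal : size (map behead z.2) <= X by pose proof (size_wt (map behead z.2)); lia.
  apply: (@leq_trans (2 ^ X * X * (3 * X ^ 2 + 2).+1 + 1)).
    by rewrite leq_add2r leq_mul // leq_mul.
  have Y256 : X * 8 <= X ^ 2 by rewrite expnS expn1 leq_mul2l X8 orbT.
  apply: (@leq_trans (2 ^ X * 2 ^ X * (3 * 2 ^ X) + 1)).
    by rewrite leq_add2r leq_mul //; [rewrite leq_mul2l; lia | lia].
  move: (2 ^ X) hY => Y hY; rewrite !expnS expn0; nia.
split.
- by rewrite size_map size_sublists.
- by rewrite wt_map_enc.
- by apply: leq_trans wal _; apply: leq_trans X2 (leq_trans (leq_addr _ _) hY).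
rewrite (_ : wt _ = wt (det z.1 (map behead z.2))); last by rewrite /wt enc_nfa_map.
apply: (@leq_trans (((2 ^ X) ^ 2 + 2 ^ X).+1 + ((2 ^ X) ^ 4 + (2 ^ X) ^ 2).+1).+1).
  by rewrite wt_pair ltnS; apply: leq_add; rewrite wt_pair ltnS leq_add.
apply: (@leq_trans (2 ^ X * (2 ^ X) ^ 4)); last by rewrite -expnS.
rewrite !(expnS (2 ^ X)) expn0 !muln1.
move: (2 ^ X) hY => Y hY.
have hYY : Y * 64 <= Y * Y by rewrite leq_mul2l; apply/orP; right; move: X2; lia.
have h4 : Y * Y * 64 <= Y * (Y * (Y * Y)) by rewrite -!mulnA !leq_mul2l; nia.
by nia.
Qed.

(** A program sees only the word; the sentence restricts the inputs to well-formed ones and lets the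
    budget depend on the arity. *)
Record input : Type := Input {
  arity : nat; sent : sentence arity; arity_gt0 : 0 < arity }.

Definition word (x : input) : seq bool := encode (sent x).

#[export] Instance enc_input : Enc input := fun x => enc (word x).

Definition parsed (x : input) : pstate := parse_bits (word x).
Definition base (x : input) : nat := 2 ^ size (word x).

Lemma parsedE x : parsed x = clean (0, 0)%R [::] (fats (body (sent x))) (fprog (body (sent x))) [::]
    (pblocks (first_quantifier (sent x)) (dims (sent x))).
Proof. exact: parse_encode. Qed.

Lemma innermost_parsed x : innermost_dims (parsed x) = rev (dims (sent x)).
Proof. by rewrite parsedE /innermost_dims pblocks_dims. Qed.

Lemma word_gt0 x : 4 <= size (word x).
Proof.
have := sumn_prefix (first_quantifier (sent x)) 0 (dims (sent x)).
have := size_encode (sent x); rewrite /encoding_length -/(word x) size_tuple.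
by have := arity_gt0 x; lia.
Qed.

Lemma pbound_exp2 k : pbound base (fun x => 2 ^ (k * size (word x))).
Proof.
apply: (pbound_le (h' := fun x => base x ^ k)); last exact: pbound_exp (pbound_budget _).
by move=> x; rewrite /base -expnM mulnC.
Qed.

Lemma eff_word : Eff base word.
Proof.
apply: (eff_recode (f := fun x : input => x)) => //; apply: eff_id.
apply: (pbound_le (h' := fun x => 4 * base x + 1)) => [x|].
  apply: leq_trans (wt_bools (word x)) _.
  by rewrite leq_add2r leq_mul2l ltnW // ltn_expl.
apply: pbound_add (pbound_const _ _); apply: pbound_mul (pbound_const _ _) (pbound_budget _).
Qed.

Lemma eff_parsed : Eff base parsed.
Proof. by apply: eff_parse_bits eff_word _; apply: pbound_budget. Qed.

Section Decide.
Variables (t m : nat) (A B : int).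

Lemma eff_atoms : Eff base (fun x => atoms m A B (parsed x)).
Proof.
have h := eff_parsed; have hc := eff_ctx h; rewrite /atoms /p_ats.
apply: (eff_map (f := fun _ => scale_atom m A B)); first by eff.
by rewrite /scale_atom /scale /strict /terms /bound; eff.
Qed.

Lemma eff_innermost_dims : Eff base (fun x => innermost_dims (parsed x)).
Proof. by have h := eff_parsed; have hc := eff_ctx h; rewrite /innermost_dims /p_blocks; eff. Qed.

Lemma eff_parsed_alphabet : Eff base (fun x => alphabet t (innermost_dims (parsed x))).
Proof.
apply: eff_alphabet eff_innermost_dims _.
apply: (pbound_le _ (pbound_exp2 (2 * t + 2))) => x.
rewrite innermost_parsed sumn_rev expnM.
apply: (@leq_trans ((2 ^ (2 * t + 2)) ^ sumn (dims (sent x)))).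
  by case: (sumn _) => // n; rewrite leq_exp2r // ltnW // ltn_expl.
rewrite leq_exp2l; last by rewrite -[X in X < _](expn0 2) ltn_exp2l //; lia.
have := sumn_prefix (first_quantifier (sent x)) 0 (dims (sent x)).
by have := size_encode (sent x); rewrite /encoding_length -/(word x); lia.
Qed.

Lemma eff_first_nfa : Eff base (fun x => first_nfa t m A B (parsed x)).
Proof.
have h := eff_parsed; have hc := eff_ctx h.
rewrite /first_nfa; apply: (eff_recode (f := fun x => body_nfa t (atoms m A B (parsed x))
  (rev (p_prog (parsed x))) (innermost_sign (parsed x)) (alphabet t (innermost_dims (parsed x))))).
  by move=> x; rewrite enc_nfa_map.
apply: eff_body; [exact: eff_atoms | by rewrite /p_prog; eff | by rewrite /innermost_sign /p_blocks; eff | exact: eff_parsed_alphabet |].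
apply: (pbound_le _ (pbound_exp2 (4 * (growth t m A B + 1)))) => x.
rewrite parsedE; apply: leq_trans (prod_atom_states _ _ _ _ _) _.
rewrite leq_exp2l // leq_mul2l; apply/orP; right.
by have := size_encode (sent x); rewrite /encoding_length -/(word x); lia.
Qed.

Definition start_level (x : input) := (first_nfa t m A B (parsed x), alphabet t (innermost_dims (parsed x))).

Lemma eff_start_level : Eff base start_level.
Proof. exact: eff_pair eff_first_nfa eff_parsed_alphabet. Qed.

Lemma start_level_bounded : exists2 c, 0 < c & forall x,
  [/\ 8 <= 2 ^ (c * size (word x)), base x <= 2 ^ (c * size (word x)) &
      bounded (2 ^ (c * size (word x))) (start_level x)].
Proof.
have [k hk] := pbound_add (eff_weight eff_start_level) (pbound_add (pbound_budget base) (pbound_const _ 8)).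
(* The sum of [base x] and 2 is at most the square of [base x], which turns the exponent [k] into
   [2 * k]; the successor keeps the constant positive. *)
exists (2 * k).+1 => // x; have hl := word_gt0 x.
have hX : wt (start_level x) + (base x + 8) <= 2 ^ ((2 * k).+1 * size (word x)).
  apply: leq_trans (hk x) _; rewrite /base.
  apply: (@leq_trans ((2 ^ (2 * size (word x))) ^ k)); last by rewrite -expnM leq_exp2l //; nia.
  case: k {hk} => // k; rewrite leq_exp2r // mul2n -addnn expnD.
  have : 2 ^ 4 <= 2 ^ size (word x) by rewrite leq_exp2l.
  by move: (2 ^ size _) => y; nia.
move: (2 ^ ((2 * k).+1 * _)) hX => X hX.
have hw : wt (start_level x) = ((((wt (states (start_level x).1) + wt (initial (start_level x).1)).+1 +
  (wt (trans (start_level x).1) + wt (final (start_level x).1)).+1).+1 + wt (start_level x).2)).+1 by [].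
have hw1 : wt (start_level x).1 <= wt (start_level x) by rewrite [X in _ <= X]wt_pair; lia.
pose proof (size_wt (states (start_level x).1)) as hs.
split; [lia | lia |].
have X1 : 0 < X by lia.
have X2 : X <= X ^ 2 by rewrite expnS expn1; nia.
have X5 : X <= X ^ 5 by rewrite expnS leq_pmulr // expn_gt0 X1.
move: hw hw1 hs hX; move: (start_level x) => z.
move=> hw hw1 hs hX; split.
- by apply: leq_trans (_ : wt (states z.1) <= _); lia.
- by apply: leq_trans X2; lia.
- by lia.
- by apply: leq_trans X5; lia.
Qed.

End Decide.

(** * Towers and the final bound *)

Definition height (j n : nat) : nat := iter j (expn 2) n.

Lemma height_le j n : n <= height j n.
Proof. by elim: j => //= j IH; apply: leq_trans IH (ltnW (ltn_expl _ _)). Qed.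

Lemma height_mono i j n : i <= j -> height i n <= height j n.
Proof. by move=> /subnK <-; rewrite /height iterD; exact: height_le. Qed.

(** A power at the top of a tower is dominated by a factor at its bottom: going up one level needs
    only k z <= z^k for z >= 2. *)
Lemma height_exp j n k : 0 < k -> 2 <= n -> height j.+1 n ^ k <= height j.+1 (k * n).
Proof.
move=> k0 n2; elim: j => [|j IH].
  by rewrite /= -expnM mulnC.
rewrite [height j.+2 n]iterS [height j.+2 _]iterS -expnM leq_exp2l //.
apply: leq_trans IH; rewrite -/(height j.+1 n).
have : 2 <= height j.+1 n by exact: leq_trans n2 (height_le _ _).
move: (height _ _) => z z2; case: k k0 => // k _.
rewrite expnS leq_mul2l; apply/orP; right.
by apply: leq_trans (ltn_expl k z2).
Qed.

Lemma tower_height (R : realType) j n : tower j (n%:R : R)%R = ((height j n)%:R)%R.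
Proof.
elim: j => //= j IH; rewrite /tower /= -/(tower j _) IH.
by rewrite powR_mulrn // natrX.
Qed.

Section Decide.
Variables (t m : nat) (A B : int).

(** One exponential for the first automaton and one for each of the r - 1 determinizations, together
    a tower of height r over c l. *)
Definition budget (c : nat) (x : input) : nat := height (arity x).-1 (2 ^ (c * size (word x))).

Lemma foldl_level (T : Type) z (s : seq T) : foldl (fun z _ => level z) z s = iter (size s) level z.
Proof. by elim: s z => //= y s IH z; rewrite IH -iterSr. Qed.

Lemma bounded_iter j X z : 8 <= X -> bounded X z -> bounded (height j X) (iter j level z).
Proof.
move=> X8 h; elim: j => //= j IH; apply: bounded_level IH.
exact: leq_trans X8 (height_le _ _).
Qed.

Lemma eff_decide : exists2 c, 0 < c &
  Eff (budget c) (fun x : input => decide t m A B (word x)).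
Proof.
have [c c0 hs] := start_level_bounded t m A B; exists c => //.
have base_budget : pbound (budget c) base.
  apply: pbound_le (pbound_budget _) => x; have [_ h _] := hs x.
  exact: leq_trans h (height_le _ _).
have hst : Eff (budget c) (start_level t m A B) := eff_budget base_budget (eff_start_level t m A B).
have hp : Eff (budget c) parsed := eff_budget base_budget eff_parsed.
have hd : Eff (budget c) (fun x => behead (innermost_dims (parsed x))).
  by apply: eff_behead; exact: eff_budget base_budget eff_innermost_dims.
have hc := eff_ctx hp.
pose l x := behead (innermost_dims (parsed x)).
(* Whenever a level is about to be computed, fewer than r - 1 have been, so that one more
   exponential of the current size is still within the budget. *)
have hj (o : occ l) : size (occ_done o) < (arity (occ_ctx o)).-1.
  have := congr1 size (occ_eq o); rewrite /l size_behead innermost_parsed size_rev size_tuple size_cat /= => ->.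
  by rewrite addnS ltnS leq_addr.
have hb (o : occ l) (X := height (size (occ_done o)) (2 ^ (c * size (word (occ_ctx o))))) :
    bounded X (occ_acc (start_level t m A B) (fun _ z _ => level z) o) /\ 2 ^ X <= budget c (occ_ctx o).
  have [h8 _ hbd] := hs (occ_ctx o); split.
    by rewrite /occ_acc foldl_level; exact: bounded_iter.
  exact: (height_mono _ (hj o)).
have hlast : Eff (budget c) (fun x => last_nfa t m A B (parsed x)).
  apply: (eff_ext (f := fun x => foldl (fun z _ => level z) (start_level t m A B x) (l x))) => //.
  apply: (eff_foldl_restricted (step := fun _ z _ => level z)) => //.
    apply: (pbound_le (h' := fun o : occ l => budget c (occ_ctx o) ^ 5 + budget c (occ_ctx o) + 1)) => [o|].
      have [[_ _ h1 h2] h3] := hb o; have := ltnW (ltn_expl (height (size (occ_done o)) (2 ^ (c * size (word (occ_ctx o))))) (isT : 1 < 2)).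
      move=> h4; have {}h4 := leq_trans h4 h3; rewrite wt_pair addn1 ltnS leq_add //.
        by apply: leq_trans h2 _; rewrite leq_exp2r.
      exact: leq_trans h1 h4.
    apply: pbound_add (pbound_const _ _); apply: pbound_add (pbound_budget _).
    exact: pbound_exp (pbound_budget _).
  move=> eo ho ha _; apply: eff_level ha _.
  apply: pbound_le (pbound_budget _) => o; have [[h1 _ _ _] h3] := hb o.
  by apply: leq_trans h3; rewrite leq_exp2l.
have hn : Eff (budget c) (fun x => (last_nfa t m A B (parsed x)).1) by eff.
have hcl := eff_clos hn.
have hf : Eff (budget c) (fun x => final (last_nfa t m A B (parsed x)).1) by rewrite /final; eff.
rewrite /decide /decide_state /p_blocks; cbv zeta.
apply: eff_eqop; last by rewrite -/parsed; eff.
by apply: (eff_has (f := fun x q => q \in final (last_nfa t m A B (parsed x)).1)) => //; eff.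
Qed.

End Decide.

(** Since y + 2 <= y^2 for the tower y, the k-th power is at most y^(2 k + 1), and [height_exp]
    moves the positive exponent 2 k + 1 to the bottom. *)
Lemma budget_exp c k (x : input) : 0 < c ->
  (budget c x).+2 ^ k <= height (arity x) ((2 * k).+1 * c * size (word x)).
Proof.
move=> c0; have hl := word_gt0 x; have hr := arity_gt0 x.
have -> : budget c x = height (arity x) (c * size (word x)).
  by rewrite /budget; case: (arity x) hr => // r _; rewrite /height iterSr.
have hcl : 4 <= c * size (word x) by apply: leq_trans hl _; rewrite leq_pmull.
rewrite -mulnA; case: (arity x) hr => // r _.
apply: leq_trans (height_exp r (ltn0Sn (2 * k)) (leq_trans _ hcl)); last by [].
have := leq_trans hcl (height_le r.+1 _); move: (height _ _) => y y4.
apply: (@leq_trans ((y ^ 2) ^ k)).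
  by case: k => // k; rewrite leq_exp2r // expnS expn1; nia.
by rewrite -expnM leq_exp2l; lia.
Qed.

Local Open Scope ring_scope.

Theorem theorem1p2 (R : realType) (alpha : R) (halpha : quadratic_irrational alpha) :
  exists (M : machine) (K C : R), 0 < K /\ 0 < C /\
    forall (r : nat) (S : sentence r), (1 <= r)%N ->
      exists t : nat,
        t%:R <= K * tower r (C * (encoding_length S)%:R) /\
        decides_in M (encode S) (sentence_true alpha S) t.
Proof.
have [t [b [t2 b1 broot [m [A [B [m0 alphaE]]]]]]] := quadratic_unit halpha.
have [c c0 hd] := eff_decide t m A B.
have [M [K [k hk] hM]] := decider_of_eff (w := word) hd.
(* The whole polynomial overhead of the machine goes into [C], which leaves K = 1. *)
exists M, 1, ((2 * k).+1 * c)%:R; split=> //; split; first by rewrite ltr0n muln_gt0 c0.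
move=> r S r0; pose x := Input S r0.
have [n hn hdec] := hM x _ (decide_correct t2 m0 b1 broot alphaE S r0).
exists n; split => //.
rewrite mul1r -natrM tower_height ler_nat; apply: leq_trans hn _.
exact: leq_trans (hk x) (budget_exp k x c0).
Qed.
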